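(* Let $m\ge1$. Let $\Xi^{\boldsymbol{\alpha}}=(\xi^{\mathbf{A}},\zeta^{\mathbf{A}})$ be a constant pure tractor spinor on $\mathcal{Q}^{2m+1}$, $\Xi$ its associated twistor in $\mathbb{PT}$, $\check{\Xi}$ its corresponding $\gamma$-plane in $\mathcal{Q}^{2m+1}$, and $\mathcal{U}:=\mathcal{Q}^{2m+1}\setminus\check{\Xi}$. Then $\xi^{\mathbf{A}}$ is a pure conformal Killing spinor on $\mathcal{Q}^{2m+1}$ with zero set $\check{\Xi}$, and its associated integrable and co-integrable almost null structure $N_\xi$ on $\mathcal{U}$ arises from the submanifold $\mathbf{D}_\Xi\setminus\{\Xi\}$ in $\widehat{\mathcal{U}}\subset\mathbb{PT}$. In particular, each leaf of $N_\xi$ consists of a $\gamma$-plane intersecting $\check{\Xi}$ in an $(m-1)$-plane. Each leaf of $N_\xi^\perp$ consists of a $1$-parameter family of $\gamma$-planes intersecting in an $(m-1)$-plane. Any two $\gamma$-planes contained in two distinct leaves of $N_\xi^\perp$ intersect in an $(m-2)$-plane.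
   Context: Everything is holomorphic; $n=2m+1$. $\mathbb{V}\cong\mathbb{C}^{2m+3}$ has a non-degenerate symmetric bilinear form $h_{\mathcal{A}\mathcal{B}}$; $\mathbb{S}$ is the $2^{m+1}$-dimensional spinor representation of $\mathrm{Spin}(2m+3,\mathbb{C})$, with Clifford generators $\Gamma_{\mathcal{A}}$ acting on $\mathbb{S}$, $\Gamma_{(\mathcal{A}}\Gamma_{\mathcal{B})}=-h_{\mathcal{A}\mathcal{B}}\,\mathrm{Id}$. Let $\Gamma^{(0)}$ be the $\mathrm{Spin}$-invariant bilinear form on $\mathbb{S}$ and $\Gamma^{(k)}:\mathbb{S}\times\mathbb{S}\to\wedge^k\mathbb{V}^*$ the bilinear forms $\Gamma^{(k)}_{\mathcal{A}_1\dots\mathcal{A}_k}(Z,W)=\Gamma^{(0)}(\Gamma_{\mathcal{A}_k}\cdots\Gamma_{\mathcal{A}_1}Z,W)$ skew-symmetrised over $\mathcal{A}_1\dots\mathcal{A}_k$. $\mathcal{Q}^n=\{[X]\in\mathbb{P}\mathbb{V}:h(X,X)=0\}$ carries its natural holomorphic conformal structure. A $\gamma$-plane is an $m$-dimensional linear subspace of $\mathcal{Q}^n$. A non-zero spinor $Z\in\mathbb{S}$ is pure if $\{V\in\mathbb{V}:V^{\mathcal{A}}\Gamma_{\mathcal{A}}Z=0\}$ has dimension $m+1$; its projectivisation $\check{Z}$ is then a $\gamma$-plane, and this identifies twistor space $\mathbb{PT}$ (the space of $\gamma$-planes) with the projective pure spinors in $\mathbb{P}\mathbb{S}$. A $k$-plane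 means a $k$-dimensional linear subspace of projective space (a $(-1)$-plane is empty). For $x\in\mathcal{Q}^n$, $\hat{x}=\{Z\in\mathbb{PT}:x\in\check{Z}\}$; $\widehat{\mathcal{U}}=\bigcup_{x\in\mathcal{U}}\hat{x}$. For $\Xi\in\mathbb{PT}$, $$\mathbf{D}_\Xi:=\{[Z]\in\mathbb{P}\mathbb{S}:\Gamma^{(k)}(Z,\Xi)=0\text{ for all }k<m\},$$ an $(m+1)$-dimensional linear subspace contained in $\mathbb{PT}$. Tractor spinors: a constant tractor spinor is a parallel section of the tractor spinor bundle, i.e. an element $\Xi\in\mathbb{S}$. At $x=[X]$ the filtration of $\mathbb{S}$ has subspace $\ker(X^{\mathcal{A}}\Gamma_{\mathcal{A}})$, and the spinor field $\xi^{\mathbf{A}}$ is the projection of $\Xi$ to the quotient. In the standard chart $\mathbb{C}\mathbb{E}^n\subset\mathcal{Q}^n$ with flat metric $g_{ab}$, flat coordinates $x^a$ and Clifford generators $\gamma_a$ ($\gamma_{(a}\gamma_{b)}=-g_{ab}\mathrm{Id}$) acting on the $2^m$-dimensional spinor space, this reads $\xi=\mathring{\xi}-\frac{1}{\sqrt2}x^a\gamma_a\mathring{\zeta}$, $\zeta=\mathring{\zeta}$, with constant spinors $\mathring\xi,\mathring\zeta$. The pure tractor spinor condition is purity of $\Xi\in\mathbb{S}$. A conformal Killing spinor is a spinor field $\xi$ with $\nabla_a\xi+\frac{1}{\sqrt2}\gamma_a\zeta=0$ for some spinor field $\zeta$ (a conformally invariant equation; $\zeta$ takes values in the corresponding spinor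 bundle of conformal weight $-1$). A spinor field $\xi$ is pure if, where non-zero, its annihilator $\{v\in\mathrm{T}_x\mathcal{Q}^n:v^a\gamma_a\xi=0\}$ is $m$-dimensional; this annihilator is the totally null rank-$m$ distribution (almost null structure) $N_\xi$, with orthogonal complement $N_\xi^\perp$. Integrable/co-integrable means that $N_\xi$, respectively $N_\xi^\perp$, is closed under Lie bracket of local sections. ''$N_\xi$ arises from $\mathcal{W}\subset\widehat{\mathcal{U}}$'' means: for each $x\in\mathcal{U}$ the submanifold $\mathcal{W}$ meets $\hat{x}$ in a point $Z_x$ and $(N_\xi)_x=\mathrm{T}_x\check{Z}_x$, so that the leaves of $N_\xi$ are the $\gamma$-planes $\check{Z}$, $Z\in\mathcal{W}$ (restricted to $\mathcal{U}$). *)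

(* Defs.v *)
From HB Require Import structures.
From mathcomp Require Export all_boot all_order fingroup perm all_algebra.
From mathcomp Require Export complex.
From mathcomp Require Export boolp classical_sets reals topology normedtype derive.

Set Implicit Arguments.
Unset Strict Implicit.
Unset Printing Implicit Defensive.

Export Order.TTheory GRing.Theory Num.Theory.
Export numFieldNormedType.Exports.
Local Open Scope classical_set_scope.
Local Open Scope ring_scope.

(* The definitions are stated over an abstract field [C]; the theorem takes
   [C := complexes R], with [R] the real numbers.  Differentiability over a
   normed [C]-vector space is then complex differentiability.  The alias makes
   the topology and norm of [numClosedFieldType] available on [R[i]]. *)
Definition complexes (R : realType) : numClosedFieldType := R[i].

Section Annihilator.
Variables (C : numClosedFieldType) (aT bT cT : vectType C).
Variable b : aT -> bT -> cT.

Definition annihilator (A : {vspace aT}) : {vspace bT} :=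
  (\bigcap_(i < \dim A) lker (linfun (b (vbasis A)`_i)))%VS.

Lemma annihilatorP (A : {vspace aT}) (y : bT) :
  (forall x, linear (b x)) -> (forall z, linear (b^~ z)) ->
  reflect (forall x, x \in A -> b x y = 0) (y \in annihilator A).
Proof.
move=> br bl.
have brE x : linfun (b x) =1 b x.
  pose Bx := GRing.isLinear.Build C bT cT *:%R (b x) (br x).
  pose f : {linear bT -> cT} := HB.pack (b x) Bx.
  exact: (lfunE f).
pose By := GRing.isLinear.Build C aT cT *:%R (b^~ y) (bl y).
pose g : {linear aT -> cT} := HB.pack (b^~ y) By.
apply: (iffP idP) => [yA x xA|yA].
  rewrite (coord_vbasis xA); change (g (\sum_(i < \dim A)
    coord (vbasis A) i x *: (vbasis A)`_i) = 0).
  rewrite linear_sum big1 // => i _; rewrite linearZ /=.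
  have /subvP/(_ y yA) : (annihilator A <= lker (linfun (b (vbasis A)`_i)))%VS.
    by rewrite /annihilator (bigcapv_inf i).
  by rewrite memv_ker brE => /eqP ->; rewrite scaler0.
rewrite memvE; apply/subv_bigcapP => i _; rewrite -memvE memv_ker brE.
by rewrite yA // vbasis_mem // mem_nth // size_tuple.
Qed.

End Annihilator.

Section Projective.
Variables (C : numClosedFieldType) (T : vectType C).

(* The projective space of [T] is the set of lines in [T]; a linear subspace of
   it is given by a linear subspace of [T], of dimension one more. *)
Definition projective_points (P : {vspace T}) : set {vspace T} :=
  [set x | \dim x = 1%N /\ (x <= P)%VS].

Definition is_plane (k : int) (P : {vspace T}) : Prop := (\dim P)%:Z = k + 1.

End Projective.

Section SpinGeometry.
Variables (C : numClosedFieldType) (m : nat).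

Local Notation V := 'rV[C]_((2 * m).+3).
Local Notation S := 'cV[C]_(2 ^ m.+1)%N.
Local Notation MS := 'M[C]_(2 ^ m.+1)%N.
Local Notation En := 'rV[C]_((2 * m).+1).

Variables (h : 'M[C]_((2 * m).+3)) (Gamma : 'I_((2 * m).+3) -> MS).

Definition hform (X Y : V) : C := (X *m h *m Y^T) 0 0.

Definition clifford_relations : Prop :=
  forall A B, 2^-1 *: (Gamma A *m Gamma B + Gamma B *m Gamma A) = (- h A B)%:M.

Definition cliff (X : V) : MS := \sum_A X 0 A *: Gamma A.

Definition spin_group : set MS :=
  [set g | exists s : seq V, [/\ ~~ odd (size s),
     (forall v, v \in s -> hform v v = 1) &
     g = \big[mulmx/1%:M]_(v <- s) cliff v]].

(* A bilinear form on [S] is given by its matrix [G0]. *)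
Definition spin_form (G0 : MS) (Z W : S) : C := (Z^T *m G0 *m W) 0 0.

Definition spin_invariant (G0 : MS) : Prop :=
  forall g, spin_group g ->
  forall Z W, spin_form G0 (g *m Z) (g *m W) = spin_form G0 Z W.

(* The component [A_1 ... A_k] of [Gamma^(k)(Z, W)]; the product inside is
   [Gamma_(A_k) ... Gamma_(A_1)], with its indices permuted by [s]. *)
Definition spin_kform (G0 : MS) (k : nat) (Z W : S)
    (A : 'I_k -> 'I_((2 * m).+3)) : C :=
  (k`!)%:R^-1 * \sum_(s : 'S_k) (-1) ^+ s *
    spin_form G0 ((\big[mulmx/1%:M]_(i < k) Gamma (A (s (rev_ord i)))) *m Z) W.

Definition quadric : set {vspace V} :=
  [set x | \dim x = 1%N /\ forall X, X \in x -> hform X X = 0].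

Definition orth (P : {vspace V}) : {vspace V} :=
  annihilator (hform : V -> V -> C^o) P.

Definition gamma_plane (P : {vspace V}) : Prop :=
  is_plane m%:Z P /\ forall X, X \in P -> hform X X = 0.

(* [check z] is the common kernel in [V] of the spinors in [z]. *)
Definition check (z : {vspace S}) : {vspace V} :=
  annihilator (fun (Z : S) (X : V) => cliff X *m Z) z.

Definition pure (Z : S) : Prop := Z != 0 /\ \dim (check <[Z]>) = m.+1.

Definition twistor_space : set {vspace S} :=
  [set z | exists2 Z, pure Z & z = <[Z]>%VS].

Definition hat (x : {vspace V}) : set {vspace S} :=
  [set z | twistor_space z /\ (x <= check z)%VS].

Definition hat_set (U : set {vspace V}) : set {vspace S} :=
  \bigcup_(x in U) hat x.

Definition D_twistor (G0 : MS) (Xi : S) : set {vspace S} :=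
  [set z | \dim z = 1%N /\ forall Z, Z \in z -> forall k, (k < m)%N ->
     forall A : 'I_k -> 'I_((2 * m).+3), spin_kform G0 Z Xi A = 0].

(* At a point [x] of the quadric, [T_x = x^perp / x], up to scale, and the
   conformal structure is induced by [h].  A distribution [D] is a family of
   subspaces of the [T_x], each represented by its inverse image [D x] in
   [x^perp]: thus [x <= D x <= x^perp] and [D x] has dimension one more than
   the rank of the distribution.  For example, a linear subspace [P] of the
   quadric has [T_x P = P / x], so it is represented by [P] itself. *)
Definition distribution := {vspace V} -> {vspace V}.

Definition perp (D : distribution) : distribution :=
  fun x => (orth x :&: orth (D x))%VS.

(* A flat chart: the standard chart for the flat metric [g_ab = h(e_a, e_b)],
   the [e_a] being the rows of [fc_e].  The charts cover the quadric. *)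
Record flat_chart := FlatChart {
  fc_O : V;
  fc_I : V;
  fc_e : 'M[C]_((2 * m).+1, (2 * m).+3);
  fc_OO : hform fc_O fc_O = 0;
  fc_II : hform fc_I fc_I = 0;
  fc_OI : hform fc_O fc_I = 1;
  fc_Oe : fc_O *m h *m fc_e^T = 0;
  fc_Ie : fc_I *m h *m fc_e^T = 0;
  fc_ee : fc_e *m h *m fc_e^T \in unitmx }.

Definition flat_metric (c : flat_chart) (v w : En) : C :=
  hform (v *m fc_e c) (w *m fc_e c).

Definition chart_vec (c : flat_chart) (x : En) : V :=
  fc_O c + x *m fc_e c - (2^-1 * flat_metric c x x) *: fc_I c.

Definition chart_pt (c : flat_chart) (x : En) : {vspace V} :=
  <[chart_vec c x]>%VS.

Definition in_distribution (D : distribution) (c : flat_chart) (x v : En) :=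
  'D_v (chart_vec c) x \in D (chart_pt c x).

Definition holomorphic_distribution (U : set {vspace V}) (k : nat)
    (D : distribution) : Prop :=
  (forall x, U x -> [/\ (x <= D x)%VS, (D x <= orth x)%VS & \dim (D x) = k.+1])
  /\
  forall c x0, U (chart_pt c x0) ->
  exists (O : set En) (s : En -> 'M[C]_(k, (2 * m).+1)),
    [/\ open O, O x0 & forall x, O x ->
      [/\ U (chart_pt c x), differentiable s x, row_free (s x) &
          forall v, in_distribution D c x v <-> (v <= s x)%MS]].

Definition almost_null_structure (U : set {vspace V}) (D : distribution) :=
  holomorphic_distribution U m D /\
  forall x, U x -> (D x <= perp D x)%VS.

Definition local_section (U : set {vspace V}) (D : distribution)
    (c : flat_chart) (O : set En) (v : En -> En) : Prop :=
  forall x, O x ->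
    [/\ U (chart_pt c x), differentiable v x & in_distribution D c x (v x)].

Definition lie_bracket (v w : En -> En) (x : En) : En :=
  'D_(v x) w x - 'D_(w x) v x.

Definition integrable (U : set {vspace V}) (D : distribution) : Prop :=
  forall (c : flat_chart) (O : set En) (v w : En -> En), open O ->
    local_section U D c O v -> local_section U D c O w ->
  forall x, O x -> in_distribution D c x (lie_bracket v w x).

Definition co_integrable (U : set {vspace V}) (D : distribution) : Prop :=
  integrable U (perp D).

(* A plaque is an embedded polydisc of dimension [k] in [U], contained in one
   chart, whose tangent spaces are the fibres of [D]. *)
Definition plaque (U : set {vspace V}) (k : nat) (D : distribution)
    (P : set {vspace V}) : Prop :=
  exists (c : flat_chart) (phi : 'rV[C]_k -> En) (a : 'rV[C]_k) (r : C),
    [/\ 0 < r,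
        (forall u v, ball a r u -> ball a r v -> phi u = phi v -> u = v),
        P = [set chart_pt c (phi u) | u in ball a r] &
        forall u, ball a r u ->
          [/\ U (chart_pt c (phi u)), differentiable phi u,
              (forall v, 'D_v phi u = 0 -> v = 0) &
              forall w, in_distribution D c (phi u) w <->
                        exists v, w = 'D_v phi u]].

(* A connected immersed integral manifold of [D]: the plaques that it contains
   are the parametrised polydiscs of its manifold structure, and it is
   connected for the topology that they generate. *)
Definition connected_integral_manifold (U : set {vspace V}) (k : nat)
    (D : distribution) (L : set {vspace V}) : Prop :=
  [/\ L !=set0,
      (forall x, L x -> exists P, [/\ plaque U k D P, P x & P `<=` L]) &
      forall A, A `<=` L -> A !=set0 ->
        (forall P, plaque U k D P -> P `<=` L -> P `&` A !=set0 -> P `<=` A) ->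
        A = L].

Definition leaf (U : set {vspace V}) (k : nat) (D : distribution)
    (L : set {vspace V}) : Prop :=
  connected_integral_manifold U k D L /\
  forall L', connected_integral_manifold U k D L' -> L `<=` L' -> L' = L.

(* The fibre at [x] of the spinor bundle is [S / ker x].  A spinor field is
   given by a representative [xi x] at each [x]; the notions below depend only
   on its class.  Since [V X + X V = - 2 h(V, X)], the Clifford action of
   [x^perp] on [S] induces the one of [x^perp / x] on [S / ker x]. *)
Definition spinor_field := {vspace V} -> S.

Definition spinor_vanishes (x : {vspace V}) (Z : S) : Prop :=
  forall X, X \in x -> cliff X *m Z = 0.

Definition tractor_projection (Xi : S) : spinor_field := fun=> Xi.

Definition zero_set (xi : spinor_field) : set {vspace V} :=
  [set x | quadric x /\ spinor_vanishes x (xi x)].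

(* [N_xi]: the [V] in [x^perp] that send the class of [xi x] to zero in
   [S / ker x]. *)
Definition N_of (xi : spinor_field) : distribution := fun x =>
  (orth x :&:
   annihilator (fun X Y : V => cliff X *m (cliff Y *m xi x)) x)%VS.

Definition pure_spinor_field (xi : spinor_field) : Prop :=
  forall x, quadric x -> ~ spinor_vanishes x (xi x) -> \dim (N_of xi x) = m.+1.

(* In a flat chart, [ker I] is a complement of [ker x] in [S] for all [x]; the
   resulting trivialisation of the spinor bundle is parallel for the flat
   metric, and [gamma_a] is the action of [e_a] on [ker I]. *)
Definition flat_spinor (c : flat_chart) (f : En -> S) : Prop :=
  forall x, cliff (fc_I c) *m f x = 0.

Definition flat_gamma (c : flat_chart) (v : En) : MS :=
  \sum_a v 0 a *: cliff (row a (fc_e c)).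

Definition flat_representative (c : flat_chart) (xi : spinor_field)
    (f : En -> S) : Prop :=
  flat_spinor c f /\
  forall x, spinor_vanishes (chart_pt c x) (f x - xi (chart_pt c x)).

Definition flat_killing (c : flat_chart) (f zeta : En -> S) : Prop :=
  forall x v : En, 'D_v f x + (sqrtC 2)^-1 *: (flat_gamma c v *m zeta x) = 0.

(* The equation is conformally invariant and the flat charts cover the quadric,
   so it may be imposed in the flat metric of each chart; [zeta] depends on
   that metric. *)
Definition conformal_killing (xi : spinor_field) : Prop :=
  forall c : flat_chart, exists f zeta : En -> S,
    [/\ flat_representative c xi f, flat_spinor c zeta,
        (forall x, differentiable f x), (forall x, differentiable zeta x) &
        flat_killing c f zeta].

(* [D] arises from [W]; here [T_x (check z)] is represented by [check z]. *)
Definition arises_from (U : set {vspace V}) (D : distribution)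
    (W : set {vspace S}) : Prop :=
  [/\ W `<=` hat_set U,
      (forall x, U x ->
         exists2 z, W `&` hat x = [set z] & D x = check z) &
      forall L, leaf U m D L <->
        exists2 z, W z & L = projective_points (check z) `&` U].

(* [L] is swept out in [U] by gamma-planes depending holomorphically and
   injectively on one complex parameter, any two of them meeting in one and the
   same (m-1)-plane [K]. *)
Definition one_parameter_family (U L : set {vspace V}) : Prop :=
  exists (T : set C) (Z : C -> S) (K : {vspace V}),
    [/\ [/\ open T, connected T & T !=set0],
        (forall t, T t -> derivable Z t 1 /\ hat_set U <[Z t]>%VS),
        (forall s t, T s -> T t -> <[Z s]>%VS = <[Z t]>%VS -> s = t),
        is_plane (m%:Z - 1) K /\
        (forall s t, T s -> T t -> s != t ->
           (check <[Z s]> :&: check <[Z t]>)%VS = K) &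
        L = (\bigcup_(t in T) projective_points (check <[Z t]>)) `&` U].

(* A gamma-plane is contained in a leaf when its part in [U] is, and is not
   empty. *)
Definition contains_gamma_plane (U L : set {vspace V}) (P : {vspace V}) :=
  [/\ gamma_plane P, projective_points P `&` U !=set0 &
      projective_points P `&` U `<=` L].

Lemma cliff_linear : linear cliff.
Proof.
move=> a X Y; rewrite /cliff scaler_sumr -big_split /=; apply: eq_bigr => A _.
by rewrite !mxE scalerDl scalerA.
Qed.

Lemma orthP (P : {vspace V}) (Y : V) :
  reflect (forall X, X \in P -> hform X Y = 0) (Y \in orth P).
Proof.
apply: annihilatorP => [X|Y'] a U W; rewrite /hform.
  by rewrite linearP /= linearP /= !mxE.
by rewrite !mulmxDl -!scalemxAl !mxE.
Qed.

Lemma checkP (z : {vspace S}) (X : V) :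
  reflect (forall Z, Z \in z -> cliff X *m Z = 0) (X \in check z).
Proof.
apply: annihilatorP => [Z|Y] a U W; last by rewrite linearP.
by rewrite cliff_linear mulmxDl -scalemxAl.
Qed.

Lemma N_ofP (xi : spinor_field) (x : {vspace V}) (Y : V) :
  reflect (forall X, X \in x ->
             hform X Y = 0 /\ cliff X *m (cliff Y *m xi x) = 0)
          (Y \in N_of xi x).
Proof.
have annP := annihilatorP (b := fun X Y : V => cliff X *m (cliff Y *m xi x)).
have br X : linear (fun Y : V => cliff X *m (cliff Y *m xi x)).
  by move=> a U W; rewrite cliff_linear mulmxDl -scalemxAl linearP.
have bl Y' : linear (fun X : V => cliff X *m (cliff Y' *m xi x)).
  by move=> a U W; rewrite cliff_linear mulmxDl -scalemxAl.
rewrite memv_cap; apply: (iffP andP).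
  by move=> [/orthP oY /(annP _ _ br bl) aY] X xX; split; [exact: oY|exact: aY].
move=> H; split; first by apply/orthP => X /H [].
by apply/(annP _ _ br bl) => X /H [].
Qed.

End SpinGeometry.

(* Main.v *)
From HB Require Import structures.
Require Import Defs.
From mathcomp Require Import functions set_interval ring zify.
Set Implicit Arguments.
Unset Strict Implicit.
Unset Printing Implicit Defensive.
Local Open Scope classical_set_scope.
Local Open Scope ring_scope.

(** Let [N0] be the maximal isotropic space of the vectors that kill [Xi], so
    that the points of [N0] form the gamma-plane of the twistor, and let [X] be
    a null vector outside [N0].

    The space [X + (N0 :&: X^perp)] kills [X Xi] and already has the maximal
    dimension [m + 1] of an isotropic space, so [X Xi] is a pure spinor with
    this isotropic space ([check_cliff]).  A vector [Y] of [X^perp]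
    anticommutes with [X], hence [X Y Xi = 0] if and only if [Y] kills [X Xi]:
    the fibre of [N_xi] at [X] is the gamma-plane of [X Xi].  Consequently
    [N_xi] and its orthogonal complement have the same form
    [x^perp :&: (x + K)], with [K = N0] for the first and [K = N0^perp] for
    the second ([N_of_dist_mod], [perp_N_dist_mod]).  Such a distribution is
    the kernel of the differential of the projection from [K], that is, of
    [X |-> [X mod K]], and all statements about integrability and leaves are
    proved once, for every [K] between [N0] and [N0^perp].

    Integrability ([dist_mod_bracket]): tangency says that the values of the
    functionals of [K^perp] on the tangent vector are proportional to their
    values on [X]; differentiating the two-by-two minors gives the bracket.

    Leaves ([leaf_fibre]): they are the fibres of the projection.  On a plaque
    the projection [F] satisfies [dF = a F], and then [F F^* / |F|^2] has zero
    derivative along real segments, so the line of [F] is constant.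
    Conversely, let [I] be in [N0] with [h(O, I) = 1].  The flat chart with
    origin [O] and point at infinity [I] avoids [N0], contains the whole fibre
    through [O], and in it the distribution is constant and the fibre is a
    linear subspace, which is visibly exhausted by polydiscs.

    Twistors ([D_twistorE]): the linear space of the [D_Xi] is [V Xi], of
    dimension [m + 2].  The invariant form satisfies
    [G0(v Z, W) = (-1)^(m+1) G0(Z, v W)] ([invariant_adjoint]).  A word of at
    most [m] vectors applied to [Xi] pairs to zero with [Xi], because some
    vector of [N0] is orthogonal to all its letters; so [V Xi] satisfies the
    equations.  Conversely, if the words of fewer than [m] vectors applied to
    [Z] pair to zero with [Xi], then those of at most [m + 1] vectors applied
    to [n n' Z], with [n], [n'] in [N0], do too; these words suffice by the
    Fock description of the spinors, so [n n' Z = 0], which forces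
    [Z] into [V Xi].  Every element of [V Xi] outside the line of [Xi] is
    [X Xi] for a null vector [X] outside [N0], which gives the correspondence
    between [N_xi] and [D_Xi].

    The incidence statements are then linear algebra: a fibre for
    [K = N0^perp] is determined by the subspace [N0 :&: X^perp] of dimension
    [m], contained in all the gamma-planes of the fibre. *)

(** * Row spaces and the quadratic space *)

Section RowSpaces.
Variables (C : fieldType) (n : nat).
Implicit Types P : {vspace 'rV[C]_n}.

(** Subspaces of row vectors are matched with row spaces of matrices, for
    which ranks and kernels are available. *)
Lemma vspace_row_basis P k : \dim P = k ->
  exists2 B : 'M[C]_(k, n), row_free B & forall v, (v \in P) = (v <= B)%MS.
Proof.
move=> <-; pose B := \matrix_(i < \dim P) (vbasis P)`_i; exists B.
  have fr := basis_free (vbasisP P).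
  rewrite -kermx_eq0; apply/rowV0P => v /sub_kermxP vB.
  have /freeP/(_ (v 0)) fr0 := fr.
  apply/rowP => i; rewrite mxE; apply: fr0.
  rewrite -[RHS]vB; apply/rowP => j; rewrite !mxE summxE.
  by apply: eq_bigr => l _; rewrite !mxE.
move=> v; apply/idP/idP => [vP|/submxP [u ->]].
  rewrite (coord_vbasis vP); apply: summx_sub => i _; apply: scalemx_sub.
  by rewrite -(rowK (fun i : 'I_(\dim P) => (vbasis P)`_i) i) row_sub.
rewrite mulmx_sum_row rpred_sum // => i _; rewrite rpredZ // rowK.
by rewrite vbasis_mem // mem_nth // size_tuple.
Qed.

Lemma dim_row_space k (B : 'M[C]_(k, n)) P :
  (forall v, (v \in P) = (v <= B)%MS) -> \dim P = \rank B.
Proof.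
move=> PB; have [B' fB' PB'] := vspace_row_basis (erefl (\dim P)).
have := fB'; rewrite /row_free => /eqP <-; apply/eqP.
rewrite eqn_leq !mxrankS //; apply/rV_subP => v; by rewrite -PB -PB'.
Qed.

End RowSpaces.

Lemma dim_add_line (C : fieldType) (W : vectType C) (w : W) (P : {vspace W}) : w \notin P ->
  \dim (<[w]> + P) = (\dim P).+1.
Proof.
move=> wP; have := dimv_sum_cap <[w]> P.
have -> : (<[w]> :&: P = 0)%VS.
  apply/eqP; rewrite -subv0; apply/subvP => v /memv_capP [/vlineP [a ->] awP].
  have [->|a0] := eqVneq a 0; first by rewrite scale0r mem0v.
  by move: awP; rewrite rpredZeq (negPf a0) (negPf wP).
rewrite dimv0 dim_vline; case: eqVneq => [w0|_ ].
  by rewrite w0 mem0v in wP.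
lia.
Qed.

Section Quadratic.
Variables (C : numClosedFieldType) (m : nat).
Local Notation V := 'rV[C]_((2 * m).+3).
Variables (h : 'M[C]_((2 * m).+3)).
Hypotheses (hsym : h^T = h) (hunit : h \in unitmx).
Local Notation hf := (hform h).
Implicit Types X Y : V.

Lemma hformC X Y : hf X Y = hf Y X.
Proof.
rewrite /hform -[in LHS](trmxK (X *m h *m Y^T)) mxE.
by rewrite trmx_mul trmxK trmx_mul hsym mulmxA.
Qed.

Lemma hform_is_linear X : linear_for *%R (hf X).
Proof. by move=> a Y Z; rewrite /hform linearP /= linearP /= !mxE. Qed.
HB.instance Definition _ X := GRing.isLinear.Build C V C *%R (hf X) (hform_is_linear X).

Lemma hformDl X Y Z : hf (X + Y) Z = hf X Z + hf Y Z.
Proof. by rewrite hformC linearD /= !(hformC Z). Qed.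
Lemma hformDr X Y Z : hf X (Y + Z) = hf X Y + hf X Z.
Proof. by rewrite linearD. Qed.
Lemma hformZl a X Y : hf (a *: X) Y = a * hf X Y.
Proof. by rewrite hformC linearZ /= (hformC Y). Qed.
Lemma hformZr a X Y : hf X (a *: Y) = a * hf X Y.
Proof. by rewrite linearZ. Qed.
Lemma hformNl X Y : hf (- X) Y = - hf X Y.
Proof. by rewrite hformC linearN /= (hformC Y). Qed.
Lemma hformNr X Y : hf X (- Y) = - hf X Y.
Proof. by rewrite linearN. Qed.
Lemma hform0l Y : hf 0 Y = 0. Proof. by rewrite hformC linear0. Qed.
Lemma hform0r Y : hf Y 0 = 0. Proof. by rewrite linear0. Qed.

Definition hform_simp := (hformDl, hformDr, hformZl, hformZr, hformNl, hformNr,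
                       hform0l, hform0r).

Lemma hform_mulmxl k (u : 'rV_k) (M : 'M_(k, (2 * m).+3)) X :
  hf (u *m M) X = \sum_i u 0 i * hf (row i M) X.
Proof.
rewrite mulmx_sum_row hformC linear_sum /=; apply: eq_bigr => i _.
by rewrite linearZ /= hformC.
Qed.

Lemma hform_eq0 X : (forall Y, hf X Y = 0) -> X = 0.
Proof.
move=> X0; have Xh0 : X *m h = 0.
  apply/rowP => j; have := X0 (delta_mx 0 j).
  by rewrite /hform trmx_delta -colE !mxE.
by rewrite -[X](mulmxK hunit) Xh0 mul0mx.
Qed.

Lemma hform_dual X : X != 0 -> exists Y, hf X Y = 1.
Proof.
move=> X0; apply: contrapT => H; move/negP: X0; apply; apply/eqP.
apply: hform_eq0 => Y; apply: contrapT => /eqP XY; apply: H.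
by exists ((hf X Y)^-1 *: Y); rewrite hformZr mulVf.
Qed.

Lemma memv_orthC (P Q : {vspace V}) : (P <= orth h Q)%VS -> (Q <= orth h P)%VS.
Proof.
move=> /subvP PQ; apply/subvP => X XQ; apply/orthP => Y YP.
by rewrite hformC; have /orthP/(_ _ XQ) := PQ _ YP.
Qed.

(** The orthogonal of [P] is the kernel of [h B^T], with [B] a basis of [P];
    as [h] is invertible this matrix has the rank of [B]. *)
Lemma dim_orth (P : {vspace V}) : (\dim (orth h P) + \dim P = (2 * m).+3)%N.
Proof.
have [B fB PB] := vspace_row_basis (erefl (\dim P)).
have E v : (v \in orth h P) = (v <= kermx (h *m B^T))%MS.
  apply/(orthP h P v)/sub_kermxP => [vo|vK X].
    apply/rowP => j; rewrite mulmxA mxE.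
    have := vo (row j B); rewrite PB row_sub => /(_ isT).
    rewrite hformC /hform tr_row !mxE => E; rewrite -[RHS]E.
    by apply: eq_bigr => i _; rewrite !mxE.
  rewrite PB => /submxP [a ->]; rewrite hformC /hform trmx_mul mulmxA.
  by rewrite -(mulmxA v) vK mul0mx mxE.
rewrite (dim_row_space E) mxrank_ker.
have -> : \rank (h *m B^T) = \dim P.
  rewrite -mxrank_tr trmx_mul trmxK mxrankMfree; first exact/eqP.
  by rewrite row_free_unit unitmx_tr.
rewrite subnK //; have := dimvS (subvf P).
by rewrite dimvf /dim /= mul1n.
Qed.

Definition isotropic (P : {vspace V}) := forall X, X \in P -> hf X X = 0.

Lemma isotropicP (P : {vspace V}) : isotropic P -> (P <= orth h P)%VS.
Proof.
move=> iP; apply/subvP => Y YP; apply/orthP => X XP.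
have := iP _ (rpredD XP YP); rewrite !hform_simp (iP _ XP) (iP _ YP) (hformC Y).
rewrite add0r addr0 -mulr2n => /eqP; by rewrite mulrn_eq0 /= => /eqP.
Qed.

Lemma isotropic_orth (P : {vspace V}) X Y : isotropic P -> X \in P -> Y \in P -> hf X Y = 0.
Proof. by move=> /isotropicP/subvP iP XP YP; have /orthP/(_ _ XP) := iP _ YP. Qed.

Lemma isotropic_dim (P : {vspace V}) : isotropic P -> (\dim P <= m.+1)%N.
Proof. by move=> /isotropicP/dimvS; have := dim_orth P; lia. Qed.

Lemma isotropic_add (P : {vspace V}) X : isotropic P -> hf X X = 0 ->
  (forall Y, Y \in P -> hf X Y = 0) -> isotropic (<[X]> + P).
Proof.
move=> iP XX XP Y /memv_addP [_ /vlineP [a ->]] [Z ZP ->].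
by rewrite !hform_simp XX (iP _ ZP) (hformC Z) XP // !(mulr0, addr0).
Qed.

(** Otherwise [X] could be added to [P], against [isotropic_dim]. *)
Lemma isotropic_max (P : {vspace V}) X : isotropic P -> \dim P = m.+1 -> hf X X = 0 ->
  (forall Y, Y \in P -> hf X Y = 0) -> X \in P.
Proof.
move=> iP dP XX XP; apply: contraT => XnP.
have := isotropic_dim (isotropic_add iP XX XP).
by rewrite (dim_add_line XnP) dP ltnn.
Qed.

Lemma dim_cap_orth (P : {vspace V}) X I : I \in P -> hf X I != 0 ->
  (\dim (P :&: orth h <[X]>)).+1 = \dim P.
Proof.
move=> IP XI; have IN : I \notin (P :&: orth h <[X]>)%VS.
  apply/negP => /memv_capP [_ /orthP/(_ X (memv_line X))]; exact/eqP.
rewrite -(dim_add_line IN); congr (\dim _); apply/eqP; rewrite eqEsubv.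
rewrite subv_add -memvE IP capvSl /=; apply/subvP => Y YP.
have -> : Y = (hf X Y / hf X I) *: I + (Y - (hf X Y / hf X I) *: I).
  by rewrite addrC subrK.
rewrite memv_add ?memvZ ?memv_line ?orbT //; apply/memv_capP; split.
  by rewrite rpredB ?rpredZ.
apply/orthP => _ /vlineP [a ->]; rewrite hformZl hformDr hformNr.
by rewrite hformZr divfK // subrr mulr0.
Qed.

Lemma dim_orth_hyperbolic X J : hf J J = 0 -> hf X J = 1 ->
  \dim (orth h (<[X]> + <[J]>)) = (2 * m).+1.
Proof.
move=> JJ XJ; have XnJ : X \notin (<[J]>)%VS.
  by apply/negP => /vlineP [a E]; move/eqP: XJ; rewrite E hformZl JJ mulr0 eq_sym oner_eq0.
have J0 : J != 0.
  by apply/negP => /eqP E; move/eqP: XJ; rewrite E hform0r eq_sym oner_eq0.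
have := dim_orth (<[X]> + <[J]>)%VS; rewrite (dim_add_line XnJ) dim_vline J0.
by move: (\dim (orth h (<[X]> + <[J]>))) => d; lia.
Qed.

End Quadratic.

(** * Clifford action and isotropic spaces of spinors *)

HB.instance Definition _ (C : numClosedFieldType) m
    (Gamma : 'I_((2 * m).+3) -> 'M[C]_(2 ^ m.+1)%N) :=
  GRing.isLinear.Build C 'rV[C]_((2 * m).+3) 'M[C]_(2 ^ m.+1)%N *:%R
    (cliff Gamma) (cliff_linear Gamma).

Section Spinors.
Variables (C : numClosedFieldType) (m : nat).
Local Notation V := 'rV[C]_((2 * m).+3).
Local Notation S := 'cV[C]_(2 ^ m.+1)%N.
Variables (h : 'M[C]_((2 * m).+3)) (Gamma : 'I_((2 * m).+3) -> 'M[C]_(2 ^ m.+1)%N).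
Hypotheses (hsym : h^T = h) (hunit : h \in unitmx).
Hypothesis hcl : clifford_relations h Gamma.
Local Notation hf := (hform h).
Local Notation c := (cliff Gamma).
Implicit Types (X Y v w : V) (Z : S).

Lemma cliff_delta A : c (delta_mx 0 A) = Gamma A.
Proof.
rewrite /cliff (bigD1 A) //= mxE !eqxx scale1r big1 ?addr0 // => B BA.
by rewrite mxE (negPf BA) andbF scale0r.
Qed.

(** The relations on the generators extend to all vectors by bilinearity. *)
Lemma cliff_anticomm X Y : c X *m c Y + c Y *m c X = (- (2 * hf X Y))%:M.
Proof.
have E A B : Gamma A *m Gamma B + Gamma B *m Gamma A = (- (2 * h A B))%:M.
  have := hcl A B; move/(congr1 (fun M => 2 *: M)).
  by rewrite scalerA divff ?pnatr_eq0 // scale1r scale_scalar_mx mulrN.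
have hfE : hf X Y = \sum_A \sum_B X 0 A * Y 0 B * h A B.
  rewrite /hform !mxE exchange_big /=; apply: eq_bigr => B _; rewrite !mxE mulr_suml.
  by apply: eq_bigr => A _; ring.
have ccE (u v : V) : c u *m c v = \sum_A \sum_B (u 0 A * v 0 B) *: (Gamma A *m Gamma B).
  rewrite /cliff mulmx_suml; apply: eq_bigr => A _; rewrite mulmx_sumr.
  by apply: eq_bigr => B _; rewrite -scalemxAl -scalemxAr scalerA.
rewrite !ccE [X in _ + X]exchange_big /= -big_split hfE mulr_sumr /= -sumrN.
rewrite rmorph_sum; apply: eq_bigr => A _ /=; rewrite -big_split mulr_sumr /= -sumrN.
rewrite rmorph_sum; apply: eq_bigr => B _ /=; rewrite (mulrC (Y 0 B)) -scalerDr E.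
by rewrite scale_scalar_mx; congr (_%:M); ring.
Qed.

Lemma cliff_swap X Y Z :
  c X *m (c Y *m Z) = - (c Y *m (c X *m Z)) - (2 * hf X Y) *: Z.
Proof.
have : (c X *m c Y + c Y *m c X) *m Z = - (2 * hf X Y) *: Z.
  by rewrite cliff_anticomm mul_scalar_mx.
rewrite mulmxDl -!mulmxA scaleNr => E.
by rewrite -E addrC addrK.
Qed.

Lemma cliff_sq X Z : c X *m (c X *m Z) = - hf X X *: Z.
Proof.
have two0 : (2 : C) != 0 by rewrite pnatr_eq0.
apply: (scalerI two0); rewrite {1}scaler_nat mulr2n {1}cliff_swap.
by rewrite addrAC addNr sub0r scalerA mulrN scaleNr.
Qed.

(** A vector that kills a non-zero spinor is null, as its square is the
    scalar [- h(X, X)]. *)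
Lemma cliff_ker_null X Z : Z != 0 -> c X *m Z = 0 -> hf X X = 0.
Proof.
move=> Z0 XZ; have := cliff_sq X Z; rewrite XZ mulmx0 => /esym/eqP.
by rewrite scaler_eq0 (negPf Z0) orbF oppr_eq0 => /eqP.
Qed.

Lemma mem_check1 Z X : (X \in check Gamma <[Z]>) = (c X *m Z == 0).
Proof.
apply/(checkP Gamma)/eqP => [->|XZ _ /vlineP [a ->]] //; first exact: memv_line.
by rewrite linearZ /= XZ scaler0.
Qed.

Lemma check_isotropic Z : Z != 0 -> isotropic h (check Gamma <[Z]>).
Proof. by move=> Z0 X; rewrite mem_check1 => /eqP; exact: cliff_ker_null. Qed.

Lemma check_dim_le Z : Z != 0 -> (\dim (check Gamma <[Z]>) <= m.+1)%N.
Proof. by move=> Z0; apply: (isotropic_dim hsym hunit); exact: check_isotropic. Qed.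

Section Pure.
Variable Xi : S.
Hypothesis pXi : pure Gamma Xi.
Let N0 := check Gamma <[Xi]>%VS.

Lemma pure_neq0 : Xi != 0. Proof. by case: pXi. Qed.
Lemma pure_dim : \dim N0 = m.+1. Proof. by case: pXi. Qed.
Lemma pure_isotropic : isotropic h N0.
Proof. exact: check_isotropic pure_neq0. Qed.
Lemma mem_N0 X : (X \in N0) = (c X *m Xi == 0). Proof. exact: mem_check1. Qed.
Lemma cliff_N0 X : X \in N0 -> c X *m Xi = 0. Proof. by rewrite mem_N0 => /eqP. Qed.

(** The rows of [B] are a basis of the isotropic space and those of [D] are
    dual to it, with the factor that turns [n_i d_i + d_i n_i] into [1].  The
    remaining direction [u] is not null, since [u] would otherwise be in the
    isotropic space and pair to zero with its dual family. *)
Lemma witt_frame : exists (B D : 'M[C]_(m.+1, (2 * m).+3)) (u : V),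
  [/\ forall v, (v \in N0) = (v <= B)%MS,
      forall i j, hf (row i B) (row j D) = - 2^-1 * (i == j)%:R,
      forall i, hf (row i B) u = 0 /\ hf (row i D) u = 0 & hf u u != 0].
Proof.
have [B fB PB] := vspace_row_basis pure_dim.
pose A := B *m h; have fA : row_free A.
  by rewrite /row_free mxrankMfree ?row_free_unit.
pose D : 'M[C]_(m.+1, (2 * m).+3) := ((- 2^-1) *: pinvmx A)^T.
have hE k (M : 'M[C]_(k, (2 * m).+3)) l (M' : 'M[C]_(l, (2 * m).+3)) i j :
    hf (row i M) (row j M') = (M *m h *m M'^T) i j.
  rewrite /hform !mxE; apply: eq_bigr => a _; rewrite !mxE; congr (_ * _).
  by apply: eq_bigr => b _; rewrite !mxE.
have BD i j : hf (row i B) (row j D) = - 2^-1 * (i == j)%:R.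
  by rewrite hE /D trmxK -scalemxAr mulmxVp // !mxE.
pose E := h *m (col_mx B D)^T.
have [u uE u0] : exists2 u : V, u *m E = 0 & u != 0.
  have : kermx E != 0.
    rewrite kermx_eq0 /row_free; have := rank_leq_col E; lia.
  by case/rowV0Pn => u /sub_kermxP ? ?; exists u.
have uBD i : hf (row i B) u = 0 /\ hf (row i D) u = 0.
  have := uE; rewrite /E mulmxA tr_col_mx mul_mx_row => uE'.
  have u1 : u *m h *m B^T = 0.
    by rewrite -[LHS](row_mxKl _ (u *m h *m D^T)) uE' linear0.
  have u2 : u *m h *m D^T = 0.
    by rewrite -[LHS](row_mxKr (u *m h *m B^T)) uE' linear0.
  split; rewrite (hformC hsym) -[u in hf u](row_id 0) hE.
    by rewrite u1 mxE.
  by rewrite u2 mxE.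
exists B, D, u; split => //; apply: contra u0 => /eqP uu.
have : u \in N0.
  apply: (isotropic_max hsym hunit pure_isotropic pure_dim uu) => Y.
  rewrite PB => /submxP [a ->]; rewrite (hformC hsym) (hform_mulmxl hsym) big1 // => i _.
  by rewrite (uBD i).1 mulr0.
rewrite PB => /submxP [a uaB]; rewrite uaB; suff -> : a = 0 by rewrite mul0mx.
apply/rowP => i; rewrite [RHS]mxE; have := (uBD i).2; rewrite (hformC hsym) uaB.
rewrite (hform_mulmxl hsym) (bigD1 i) //= big1 => [|j ji]; last first.
  by rewrite BD (negPf ji) !mulr0.
rewrite BD eqxx mulr1 addr0 => /eqP; rewrite mulf_eq0 oppr_eq0 invr_eq0 pnatr_eq0 orbF.
by move/eqP.
Qed.

End Pure.
End Spinors.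

(** * The Fock description of spinor space *)

Section Fock.
Variables (C : numClosedFieldType) (m : nat).
Local Notation V := 'rV[C]_((2 * m).+3).
Local Notation S := 'cV[C]_(2 ^ m.+1)%N.
Variables (h : 'M[C]_((2 * m).+3)) (Gamma : 'I_((2 * m).+3) -> 'M[C]_(2 ^ m.+1)%N).
Hypotheses (hsym : h^T = h) (hunit : h \in unitmx).
Hypothesis hcl : clifford_relations h Gamma.
Local Notation hf := (hform h).
Local Notation c := (cliff Gamma).
Implicit Types (X v : V) (Y Z w : S).
Variable Xi : S.
Hypothesis pXi : pure Gamma Xi.
Local Notation N0 := (check Gamma <[Xi]>%VS).

(** Creation operators [d i] and annihilation operators [n i], indexed by
    natural numbers at most [m] so that the tower below can use recursion. *)
Record fock_frame (n d : nat -> V) : Prop := FockFrame {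
  fock_N0 : forall v, v \in N0 <-> exists a : 'I_m.+1 -> C, v = \sum_i a i *: n i;
  fock_nd : forall i j, (i <= m)%N -> (j <= m)%N -> hf (n i) (d j) = - 2^-1 * (i == j)%:R }.

Lemma fock_frame_exists : exists n d u,
  [/\ fock_frame n d, forall i, hf (n i) u = 0, forall i, hf (d i) u = 0 & hf u u != 0].
Proof.
have [B [D [u [PB BD uBD uu]]]] := witt_frame hsym hunit hcl pXi.
exists (fun i => row (inord i) B), (fun i => row (inord i) D), u; split => //.
- split=> [v|i j im jm].
    rewrite PB; split=> [/submxP [a ->]|[a ->]].
      exists (a 0); rewrite mulmx_sum_row; apply: eq_bigr => i _.
      by rewrite inord_val.
    apply/submxP; exists (\row_i a i); rewrite mulmx_sum_row; apply: eq_bigr => i _.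
    by rewrite inord_val mxE.
  by rewrite BD -val_eqE /= !inordK.
- by move=> i; case: (uBD (inord i)).
- by move=> i; case: (uBD (inord i)).
Qed.

Variables (n d : nat -> V).
Hypothesis fr : fock_frame n d.

Lemma fock_mem i : (i <= m)%N -> n i \in N0.
Proof.
move=> im; apply/(fock_N0 fr); exists (fun j : 'I_m.+1 => (j == i :> nat)%:R).
rewrite (bigD1 (Ordinal (n:=m.+1) (m:=i) im)) //= eqxx scale1r big1 ?addr0 // => j.
by rewrite -val_eqE /= => /negPf ->; rewrite scale0r.
Qed.

Lemma fock_kill i j Z : (i <= m)%N -> (j <= m)%N ->
  c (n i) *m (c (d j) *m Z) = - (c (d j) *m (c (n i) *m Z)) + (i == j)%:R *: Z.
Proof.
move=> im jm; rewrite (cliff_swap hcl) (fock_nd fr) // mulrA mulrN divff ?pnatr_eq0 //.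
by rewrite mulN1r scaleNr opprK.
Qed.

Definition cliff_hom X : 'Hom(S, S) := linfun (mulmx (c X)).

(** The spinors obtained from [Xi] with the first [k] creation operators. *)
Fixpoint tower (k : nat) : {vspace S} :=
  if k is k'.+1 then (tower k' + cliff_hom (d k') @: tower k')%VS else <[Xi]>%VS.

Lemma towerSP k Y : reflect
  (exists w w', [/\ w \in tower k, w' \in tower k & Y = w + c (d k) *m w'])
  (Y \in tower k.+1).
Proof.
apply: (iffP memv_addP) => [[w wT [_ /memv_imgP [w' w'T ->] ->]]|[w [w' [wT w'T ->]]]].
  by exists w, w'; rewrite lfunE.
exists w => //; exists (cliff_hom (d k) w'); first exact: memv_img.
by rewrite lfunE.
Qed.

Lemma tower_kill k j Y : (k <= j)%N -> (j <= m)%N -> Y \in tower k -> c (n j) *m Y = 0.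
Proof.
elim: k j Y => [j Y _ jm /vlineP [a ->]|k IH j Y kj jm].
  by rewrite linearZ /= (cliff_N0 (fock_mem jm)) scaler0.
case/towerSP => w [w' [wT w'T ->]].
have kj' := ltnW kj; have km : (k <= m)%N by lia.
rewrite linearD /= fock_kill // !(IH j) // linear0 oppr0 !add0r.
by have -> : (j == k) = false; [lia|rewrite scale0r].
Qed.

(** The annihilation operator [n k] recovers the component along [d k]; both
    the dimension count and the descending inductions rest on this. *)
Lemma tower_lower k w w' : (k <= m)%N -> w \in tower k -> w' \in tower k ->
  c (n k) *m (w + c (d k) *m w') = w'.
Proof.
move=> km wT w'T; rewrite linearD /= fock_kill // !(@tower_kill k) // linear0 oppr0 !add0r.
by rewrite eqxx scale1r.
Qed.

(** By [tower_lower] the creation operator is injective on the tower and its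
    image meets the tower trivially, so each step doubles the dimension. *)
Lemma tower_dim k : (k <= m.+1)%N -> \dim (tower k) = (2 ^ k)%N.
Proof.
elim: k => [_|k IH km]; first by rewrite /= dim_vline (pure_neq0 pXi).
have inj : (lker (cliff_hom (d k)) :&: tower k = 0)%VS.
  apply/eqP; rewrite -subv0; apply/subvP => w /memv_capP [].
  rewrite memv_ker lfunE /= => /eqP dw wT.
  have := tower_lower km (mem0v _) wT; rewrite dw addr0 linear0 => <-.
  exact: mem0v.
have dis : (tower k :&: (cliff_hom (d k) @: tower k) = 0)%VS.
  apply/eqP; rewrite -subv0; apply/subvP => w /memv_capP [wT].
  move/memv_imgP => [w' w'T]; rewrite lfunE /= => wE.
  have := tower_lower km (mem0v _) w'T; rewrite add0r -wE (@tower_kill k) // => w'0.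
  by rewrite wE -w'0 linear0 mem0v.
rewrite /= dimv_disjoint_sum // limg_dim_eq; last by rewrite capvC.
by rewrite IH ?(ltnW km) // expnS mul2n addnn.
Qed.

Lemma tower_full Y : Y \in tower m.+1.
Proof.
have /eqP -> : tower m.+1 == fullv; last exact: memvf.
by rewrite eqEdim subvf tower_dim //= dimvf /dim /= muln1.
Qed.

(** Irreducibility in the form of an induction principle: the spinors are
    generated by [Xi] under the Clifford action. *)
Lemma tower_ind (Q : S -> Prop) : Q Xi ->
  (forall a Y Z, Q Y -> Q Z -> Q (a *: Y + Z)) ->
  (forall X Y, Q Y -> Q (c X *m Y)) -> forall Y, Q Y.
Proof.
move=> QXi Qlin Qc Y; have Q0 : Q 0 by have := Qlin (-1) _ _ QXi QXi; rewrite scaleN1r addNr.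
suff H k W : W \in tower k -> Q W by exact: (H m.+1 _ (tower_full Y)).
elim: k W => [W /vlineP [a ->]|k IH W /towerSP [w [w' [wT w'T ->]]]].
  by have := Qlin a _ _ QXi Q0; rewrite addr0.
by have := Qlin 1 _ _ (IH _ wT) (Qc (d k) _ (IH _ w'T)); rewrite scale1r.
Qed.

(** Descending along the tower: if [n k] kills [w + d_k w'], then [w' = 0]. *)
Lemma common_kernel Z : (forall X, X \in N0 -> c X *m Z = 0) -> Z \in <[Xi]>%VS.
Proof.
move=> ZN; suff H k : (k <= m.+1)%N -> Z \in tower k -> Z \in tower 0.
  exact: (H m.+1 _ (tower_full Z)).
elim: k => // k IH km /towerSP [w [w' [wT w'T ZE]]]; apply: IH (ltnW km) _.
have := tower_lower km wT w'T; rewrite -ZE ZN ?fock_mem // => w'0.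
by rewrite ZE -w'0 linear0 addr0.
Qed.

(** Annihilation operators bring any non-zero spinor down to a multiple of
    [Xi]. *)
Lemma reach_pure (Q : S -> Prop) Z : Z != 0 -> Q Z -> (forall a Y, Q Y -> Q (a *: Y)) ->
  (forall X Y, X \in N0 -> Q Y -> Q (c X *m Y)) -> Q Xi.
Proof.
move=> Z0 QZ Qs Qc; suff H k W : (k <= m.+1)%N -> W != 0 -> Q W -> W \in tower k -> Q Xi.
  exact: (H m.+1 _ _ Z0 QZ (tower_full Z)).
elim: k W => [{QZ Z0}Z _ Z0 QZ /vlineP [a Za]|k IH {QZ Z0}Z km Z0 QZ /towerSP [w [w' [wT w'T ZE]]]].
  have a0 : a != 0 by apply: contra Z0 => /eqP a0; rewrite Za a0 scale0r.
  by have := Qs a^-1 _ QZ; rewrite Za scalerA mulVf // scale1r.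
have nZ := tower_lower km wT w'T.
have [w'0|w'0] := eqVneq w' 0.
  by apply: (IH Z (ltnW km) Z0 QZ); rewrite ZE w'0 linear0 addr0.
apply: (IH w' (ltnW km) w'0 _ w'T); rewrite -nZ -ZE.
exact: Qc (fock_mem km) QZ.
Qed.

(** Each vector imposes one linear condition on the [m + 1] dimensions of the
    isotropic space. *)
Lemma orth_seq (s : seq V) : (size s <= m)%N ->
  exists X, [/\ X \in N0, X != 0 & forall v, v \in s -> hf X v = 0].
Proof.
move=> sm; pose P := <<s>>%VS.
have : (\dim (N0 :&: orth h P) != 0)%N.
  have sP : (\dim P <= m)%N := leq_trans (dim_span s) sm.
  have := dimvS (subvf (N0 + orth h P)%VS); rewrite dimvf /dim /= mul1n => le.
  apply/eqP => E0; move: le; have := dimv_sum_cap N0 (orth h P).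
  rewrite E0 addn0 => ->; rewrite (pure_dim pXi).
  have := dim_orth hsym hunit P; move: sP; clearbody P.
  move: (\dim (orth h P)) (\dim P) => a b; lia.
rewrite dimv_eq0 -vpick0 => p0; exists (vpick (N0 :&: orth h P)).
have /memv_capP [pN /orthP pO] := memv_pick (N0 :&: orth h P).
by split => // v vs; rewrite (hformC hsym) pO // memv_span.
Qed.

End Fock.

(** * The invariant bilinear form *)

Lemma spin_form_is_linear (C : numClosedFieldType) m (G : 'M[C]_(2 ^ m.+1)%N)
  (Z : 'cV[C]_(2 ^ m.+1)%N) : linear_for *%R (spin_form G Z).
Proof. by move=> a Y W; rewrite /spin_form linearP /= !mxE. Qed.
HB.instance Definition _ (C : numClosedFieldType) m (G : 'M[C]_(2 ^ m.+1)%N)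
    (Z : 'cV[C]_(2 ^ m.+1)%N) :=
  GRing.isLinear.Build C 'cV[C]_(2 ^ m.+1)%N C *%R (spin_form G Z)
    (spin_form_is_linear G Z).

Section Form.
Variables (C : numClosedFieldType) (m : nat).
Local Notation V := 'rV[C]_((2 * m).+3).
Local Notation S := 'cV[C]_(2 ^ m.+1)%N.
Local Notation MS := 'M[C]_(2 ^ m.+1)%N.
Implicit Types (G : MS) (Y Z W : S).

Lemma spin_formDl G Y Z W : spin_form G (Y + Z) W = spin_form G Y W + spin_form G Z W.
Proof. by rewrite /spin_form linearD /= !mulmxDl mxE. Qed.
Lemma spin_formZl G a Z W : spin_form G (a *: Z) W = a * spin_form G Z W.
Proof. by rewrite /spin_form linearZ /= -!scalemxAl mxE. Qed.
Lemma spin_formNl G Z W : spin_form G (- Z) W = - spin_form G Z W.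
Proof. by rewrite -scaleN1r spin_formZl mulN1r. Qed.
Lemma spin_form_eq0 G : (forall Z W, spin_form G Z W = 0) -> G = 0.
Proof.
move=> H; apply/matrixP => i j; rewrite [RHS]mxE -[RHS](H (delta_mx i 0) (delta_mx j 0)).
by rewrite /spin_form trmx_delta -rowE -colE !mxE.
Qed.
Lemma spin_formD G G' Z W : spin_form (G + G') Z W = spin_form G Z W + spin_form G' Z W.
Proof. by rewrite /spin_form mulmxDr mulmxDl mxE. Qed.
Lemma spin_formZ a G Z W : spin_form (a *: G) Z W = a * spin_form G Z W.
Proof. by rewrite /spin_form -scalemxAr -scalemxAl mxE. Qed.

Variables (h : 'M[C]_((2 * m).+3)) (Gamma : 'I_((2 * m).+3) -> MS).
Hypotheses (hsym : h^T = h) (hunit : h \in unitmx).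
Hypothesis hcl : clifford_relations h Gamma.
Local Notation hf := (hform h).
Local Notation c := (cliff Gamma).

(** A word of vectors, acting by Clifford multiplication; the last letter
    acts first. *)
Definition cliff_word (s : seq V) (Z : S) : S := foldr (fun v => mulmx (c v)) Z s.

Lemma cliff_word_cat s1 s2 Z : cliff_word (s1 ++ s2) Z = cliff_word s1 (cliff_word s2 Z).
Proof. exact: foldr_cat. Qed.

Lemma cliff_word_linear s : linear (cliff_word s).
Proof. by elim: s => [|v s IH] a Y Z //=; rewrite IH linearP. Qed.
HB.instance Definition _ s := GRing.isLinear.Build C S S *:%R (cliff_word s) (cliff_word_linear s).

Lemma cliff_word_orth X s Z : (forall v, v \in s -> hf X v = 0) ->
  c X *m cliff_word s Z = (-1) ^+ size s *: cliff_word s (c X *m Z).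
Proof.
elim: s => [|v s IH] Xs /=; first by rewrite scale1r.
rewrite (cliff_swap hcl) Xs ?mem_head // mulr0 scale0r subr0 IH => [|w ws]; last first.
  by apply: Xs; rewrite inE ws orbT.
by rewrite linearZ /= exprS mulN1r scaleNr.
Qed.

Variable Xi : S.
Hypothesis pXi : pure Gamma Xi.
Local Notation N0 := (check Gamma <[Xi]>%VS).

Definition clifford_adjoint (e : C) G :=
  forall v Z W, spin_form G (c v *m Z) W = e * spin_form G Z (c v *m W).

Section Adjoint.
Variables (e : C) (G : MS).
Hypothesis Gadj : clifford_adjoint e G.

Lemma adjoint_N0 X Y : X \in N0 -> spin_form G (c X *m Y) Xi = 0.
Proof. by move=> XN; rewrite Gadj (cliff_N0 XN) linear0 mulr0. Qed.

(** Take [X] in the isotropic space orthogonal to all letters.  It kills the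
    spinor [s Xi], which is therefore in the image of [X] (the kernel and the
    image of a null vector coincide), and the image of [X] pairs to zero with
    [Xi]. *)
Lemma adjoint_low s : (size s <= m)%N -> spin_form G (cliff_word s Xi) Xi = 0.
Proof.
move=> sm; have [X [XN X0 Xs]] := orth_seq hsym hunit pXi sm.
have [X' XX'] := hform_dual hunit X0.
have := cliff_swap hcl X X' (cliff_word s Xi).
rewrite (@cliff_word_orth X s Xi Xs) (cliff_N0 XN) !(linear0, scaler0) sub0r XX' mulr1 => E.
have := adjoint_N0 (c X' *m cliff_word s Xi) XN.
by rewrite E -scaleNr spin_formZl => /eqP; rewrite mulf_eq0 oppr_eq0 pnatr_eq0 => /eqP.
Qed.

Variables n d : nat -> V.
Hypothesis fr : fock_frame h Gamma Xi n d.
Local Notation tower := (tower Gamma Xi d).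

(** A spinor of the [k]-th tower is a combination of words of at most [k]
    letters applied to [Xi]. *)
Lemma adjoint_tower_low k Y s : Y \in tower k -> (size s + k <= m)%N ->
  spin_form G (cliff_word s Y) Xi = 0.
Proof.
elim: k Y s => [Y s /vlineP [a ->]|k IH Y s /towerSP [w [w' [wT w'T ->]]] sm].
  by rewrite addn0 => sm; rewrite linearZ /= spin_formZl adjoint_low // mulr0.
rewrite linearD /= spin_formDl IH //; last by lia.
rewrite add0r -[cliff_word s _](cliff_word_cat s [:: d k]) IH // size_cat /=; lia.
Qed.

(** The word [d_m ... d_k] that completes the [k]-th tower to the top. *)
Definition raise k := [seq d i | i <- rev (iota k (m.+1 - k))].

Lemma raiseS k Y : (k <= m)%N -> cliff_word (raise k.+1) (c (d k) *m Y) = cliff_word (raise k) Y.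
Proof.
move=> km; rewrite /raise (subSn km) subSS -[iota k _]/(k :: iota k.+1 (m - k)).
by rewrite rev_cons map_rcons -cats1 cliff_word_cat.
Qed.

(** By [adjoint_low] only the top component of a spinor can pair with [Xi]; if
    it pairs to zero as well, [Xi] is in the radical, and the radical is stable
    under the Clifford action. *)
Lemma adjoint_top : spin_form G (cliff_word (raise 0) Xi) Xi = 0 -> G = 0.
Proof.
move=> th0.
have H k Y : (k <= m.+1)%N -> Y \in tower k -> spin_form G (cliff_word (raise k) Y) Xi = 0.
  elim: k Y => [Y _ /vlineP [a ->]|k IH Y km /towerSP [w [w' [wT w'T ->]]]].
    by rewrite linearZ /= spin_formZl th0 mulr0.
  rewrite linearD /= spin_formDl raiseS // (IH w') ?(ltnW km) // addr0.
  apply: adjoint_tower_low wT _; rewrite size_map size_rev size_iota; lia.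
have H0 Y : spin_form G Y Xi = 0.
  have := H m.+1 Y (leqnn _) (tower_full hunit hcl pXi fr Y).
  by rewrite /raise subnn.
apply: spin_form_eq0 => Z W; move: W Z; apply: (tower_ind hunit hcl pXi fr) => //.
  by move=> a Y Z HY HZ W; rewrite linearP /= HY HZ mulr0 addr0.
(* If [e = 0], a vector that is not null has a multiple of the identity as
   its square, so the form vanishes directly. *)
move=> X Y HY Z; apply/eqP; have [e0|e0] := eqVneq e 0; last first.
  by rewrite -(inj_eq (mulfI e0)) -Gadj HY mulr0.
have [X' X'X] : exists X', hf X' X' != 0.
  by have [_ [_ [u [_ _ _ uu]]]] := fock_frame_exists hsym hunit hcl pXi; exists u.
have := Gadj X' (c X' *m Z) (c X *m Y).
rewrite (cliff_sq hcl) spin_formZl e0 mul0r => /eqP.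
by rewrite mulf_eq0 oppr_eq0 (negPf X'X).
Qed.

Variable u : V.
Hypotheses (nu : forall i, hf (n i) u = 0) (du : forall i, hf (d i) u = 0).
Hypothesis uu : hf u u != 0.

(** The vector [u] anticommutes with the isotropic space, so it preserves the
    line of [Xi]. *)
Lemma orth_eigen : exists2 l, c u *m Xi = l *: Xi & l != 0.
Proof.
have /vlineP [l ul] : c u *m Xi \in <[Xi]>%VS.
  apply: (common_kernel hunit hcl pXi fr) => X XN; rewrite (cliff_swap hcl) (cliff_N0 XN) linear0.
  have /(fock_N0 fr) [a ->] := XN; rewrite (hformC hsym) linear_sum big1 /=.
    by rewrite mulr0 scale0r oppr0 addr0.
  by move=> i _; rewrite linearZ /= (hformC hsym) nu mulr0.
exists l => //; have := cliff_sq hcl u Xi; rewrite ul linearZ /= ul => E.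
apply: contra_neq uu => l0; move/eqP: E; rewrite l0 scale0r scaleNr eq_sym oppr_eq0.
by rewrite scaler_eq0 (negPf (pure_neq0 pXi)) orbF => /eqP.
Qed.

(** Move [u] from the left to the right of the pairing of the top spinor with
    [Xi].  Both are eigenvectors of [u], and anticommuting with the [m + 1]
    creation operators costs the sign [(-1)^(m+1)].  This is where the
    odd dimension enters: it decides which sign an invariant form has. *)
Lemma adjoint_sign : G != 0 -> e = (-1) ^+ m.+1.
Proof.
move=> G0; have [l ul l0] := orth_eigen.
have th0 : spin_form G (cliff_word (raise 0) Xi) Xi != 0.
  by apply: contra_neq G0; exact: adjoint_top.
have := Gadj u (cliff_word (raise 0) Xi) Xi.
rewrite (@cliff_word_orth u (raise 0)) => [|v /mapP [i _ ->]]; last by rewrite (hformC hsym) du.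
rewrite size_map size_rev size_iota subn0 ul !(linearZ, spin_formZl) /=.
by move=> /(mulIf (mulf_neq0 l0 th0)).
Qed.

End Adjoint.

(** Vectors of square one span: a non-null vector is a multiple of one, and a
    null vector [v] is the difference of the non-null vectors [v + t u] and
    [t u], for [t = 1] or [t = -1]. *)
Lemma adjoint_from_units e G :
  (forall v, hf v v = 1 -> forall Z W, spin_form G (c v *m Z) W = e * spin_form G Z (c v *m W)) ->
  clifford_adjoint e G.
Proof.
move=> H1; have H2 v : hf v v != 0 ->
    forall Z W, spin_form G (c v *m Z) W = e * spin_form G Z (c v *m W).
  move=> vv Z W; pose r := sqrtC (hf v v); have r0 : r != 0 by rewrite sqrtC_eq0.
  have -> : c v = r *: c (r^-1 *: v) by rewrite linearZ /= scalerA divff // scale1r.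
  have w1 : hf (r^-1 *: v) (r^-1 *: v) = 1.
    by rewrite (hformZl hsym) hformZr mulrA -invfM -expr2 sqrtCK mulVf.
  move: (r^-1 *: v) w1 => w w1.
  by rewrite -!scalemxAl spin_formZl linearZ /= H1 // mulrCA.
move=> v Z W; have [vv|] := eqVneq (hf v v) 0; last by move/H2; apply.
have [_ [_ [u [_ _ _ uu]]]] := fock_frame_exists hsym hunit hcl pXi.
(* The values at [1] and [-1] add up to [2 h(u, u)] when [v] is null. *)
have [t [t0 tvv]] : exists t : C, t != 0 /\ hf (v + t *: u) (v + t *: u) != 0.
  pose q t := hf (v + t *: u) (v + t *: u).
  have [q1|] := eqVneq (q 1) 0; last by exists 1; rewrite oner_eq0.
  exists (-1); rewrite oppr_eq0 oner_eq0; split=> //.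
  apply: contra uu => /eqP qm; have : q 1 + q (-1) = 0 by rewrite q1 /q qm addr0.
  rewrite /q !(hform_simp hsym) vv (hformC hsym u v) => E.
  have : 2 * hf u u = 0 by rewrite -[RHS]E; ring.
  by move/eqP; rewrite mulf_eq0 pnatr_eq0.
have uu' : hf (t *: u) (t *: u) != 0 by rewrite !(hform_simp hsym) !mulf_neq0.
have -> : c v = c (v + t *: u) - c (t *: u) by rewrite -linearB addrK.
rewrite !mulmxBl spin_formDl spin_formNl linearB (H2 _ tvv) (H2 _ uu').
by rewrite mulrBr.
Qed.

(** Spin invariance concerns pairs of unit vectors, so [B1(Z, W) = G0(v Z, v W)]
    does not depend on the unit vector [v].  The forms [G0 + B1] and [G0 - B1]
    are adjoint with opposite signs, and [adjoint_sign] kills one of them;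
    thus [B1] is a multiple of [G0]. *)
Lemma invariant_adjoint G0 : G0 != 0 -> spin_invariant h Gamma G0 ->
  clifford_adjoint ((-1) ^+ m.+1) G0.
Proof.
move=> G00 inv.
have [n [d [u [fr nu du uu]]]] := fock_frame_exists hsym hunit hcl pXi.
have inv2 v w : hf v v = 1 -> hf w w = 1 -> forall Z W,
    spin_form G0 (c v *m (c w *m Z)) (c v *m (c w *m W)) = spin_form G0 Z W.
  move=> vv ww Z W; rewrite !mulmxA; apply: inv; exists [:: v; w]; split => //.
    by move=> x; rewrite !inE => /orP [] /eqP ->.
  by rewrite !big_cons big_nil mulmx1.
pose r := sqrtC (hf u u); pose v0 := r^-1 *: u.
have v00 : hf v0 v0 = 1.
  by rewrite (hformZl hsym) hformZr mulrA -invfM -expr2 sqrtCK mulVf.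
have sq1 v Z : hf v v = 1 -> c v *m (c v *m Z) = - Z.
  by move=> vv; rewrite (cliff_sq hcl) vv scaleN1r.
pose B1 := (c v0)^T *m G0 *m c v0.
have B1E Z W : spin_form B1 Z W = spin_form G0 (c v0 *m Z) (c v0 *m W).
  by rewrite /spin_form trmx_mul !mulmxA.
have inv1 v : hf v v = 1 -> forall Z W,
    spin_form G0 (c v *m Z) (c v *m W) = spin_form B1 Z W.
  move=> vv Z W; have := inv2 v v0 vv v00 (c v0 *m Z) (c v0 *m W).
  by rewrite !sq1 // !linearN /= spin_formNl opprK B1E.
have adj (s : C) : s * s = 1 -> clifford_adjoint (- s) (G0 + s *: B1).
  move=> ss; apply: adjoint_from_units => v vv Z W.
  have H Z' W' : spin_form (G0 + s *: B1) (c v *m Z') (c v *m W') =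
                 s * spin_form (G0 + s *: B1) Z' W'.
    rewrite !spin_formD !spin_formZ inv1 // (B1E (c v *m Z')) inv2 // mulrDr mulrA ss mul1r.
    by rewrite addrC.
  have := H Z (c v *m W); rewrite sq1 // linearN /= => E.
  by rewrite mulNr -E opprK.
pose e : C := (-1) ^+ m.+1; have ee : e * e = 1 by rewrite -expr2 sqrr_sign.
have e0 : G0 + e *: B1 = 0.
  apply/eqP; apply: contraT => H0.
  have := adjoint_sign (adj e ee) fr nu du uu H0; rewrite -/e => /eqP.
  rewrite eqNr => /eqP e0; move: ee; rewrite e0 mul0r => /eqP.
  by rewrite eq_sym oner_eq0.
have B1G : e *: B1 = - G0 by apply/eqP; rewrite -addr_eq0 addrC e0.
have := adj (- e); rewrite mulrNN ee opprK scaleNr B1G opprK => /(_ erefl) H v Z W.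
have two0 : (2 : C) != 0 by rewrite pnatr_eq0.
by have := H v Z W; rewrite !spin_formD => E; apply: (mulfI two0); rewrite !mulr_natl !mulr2n E mulrDr.
Qed.

(** The radical is stable under the Clifford action: were it non-zero, it would
    contain [Xi] by [reach_pure], hence everything. *)
Lemma adjoint_nondegenerate e G Y : e != 0 -> G != 0 -> clifford_adjoint e G ->
  (forall Z, spin_form G Y Z = 0) -> Y = 0.
Proof.
move=> e0 G0 adj YG; have [n [d [u [fr nu du uu]]]] := fock_frame_exists hsym hunit hcl pXi.
apply/eqP; apply: contraT => Y0; move/negP: G0; case; apply/eqP.
pose Q Y' := forall Z, spin_form G Y' Z = 0.
have QXi : Q Xi.
  apply: (reach_pure hunit hcl pXi fr Y0 YG) => [a Z QZ W|X Z _ QZ W].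
    by rewrite spin_formZl QZ mulr0.
  by rewrite adj QZ mulr0.
apply: spin_form_eq0; apply: (tower_ind hunit hcl pXi fr) => //.
  by move=> a Z W HZ HW x; rewrite spin_formDl spin_formZl HZ HW mulr0 addr0.
by move=> X Z HZ W; rewrite adj HZ mulr0.
Qed.

End Form.

(** * Spinors whose low forms with a pure spinor vanish *)

Section Alternating.
Variables (C : comNzRingType) (T : Type) (k : nat) (g : seq T -> C).
Hypothesis g_swap : forall s1 v w s2, size (s1 ++ v :: w :: s2) = k ->
  g (s1 ++ v :: w :: s2) = - g (s1 ++ w :: v :: s2).

Local Notation list B := (map B (rev (enum 'I_k))).

(** The lists are reversed to agree with the order of the factors in the
    multilinear forms. *)
Lemma alternating_adjacent (B : 'I_k -> T) (i j : 'I_k) : j = i.+1 :> nat ->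
  g (list (B \o tperm i j)) = - g (list B).
Proof.
move=> ij; have [e1 [e2 E]] : exists e1 e2, enum 'I_k = e1 ++ i :: j :: e2.
  exists (take i (enum 'I_k)), (drop j.+1 (enum 'I_k)).
  rewrite -{1}(cat_take_drop i (enum 'I_k)); congr (_ ++ _).
  rewrite (drop_nth i) ?size_enum_ord // nth_ord_enum; congr (_ :: _).
  by rewrite -ij (drop_nth i) ?size_enum_ord // nth_ord_enum.
have := enum_uniq 'I_k; have sz := size_enum_ord k.
rewrite E cat_uniq /= !inE !negb_or => /and5P [_ /and3P [ie1 je1 _] /andP [_ ie2] je2 _].
have mapE (e : seq 'I_k) : i \notin e -> j \notin e -> map (B \o tperm i j) e = map B e.
  move=> ie je; apply/eq_in_map => l le /=; rewrite tpermD //.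
    by apply: contra ie => /eqP ->.
  by apply: contra je => /eqP ->.
rewrite rev_cat !rev_cons !map_cat !map_rcons /= -!cats1 -!catA /=.
rewrite g_swap ?tpermL ?tpermR.
  by rewrite !mapE ?mem_rev // tpermL tpermR.
move: sz; rewrite E !size_cat /= !size_map !size_rev; lia.
Qed.

(** Induction on the distance: [(i j) = (l j) (i l) (l j)] with [l = j - 1]. *)
Lemma alternating_tperm (B : 'I_k -> T) (i j : 'I_k) : i != j ->
  g (list (B \o tperm i j)) = - g (list B).
Proof.
wlog ij : i j / (i < j)%N => [H|_].
  by case: (ltngtP i j) => [|ji|/val_inj ->]; rewrite ?eqxx //; [exact: H|rewrite tpermC eq_sym; exact: H].
have [q jq] : exists q, j = (i + q).+1 :> nat by exists (j - i.+1)%N; lia.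
elim: q B j jq {ij} => [|q IH] B j jq; first by apply: alternating_adjacent; rewrite jq addn0.
have lk : (i + q.+1 < k)%N by have := ltn_ord j; lia.
pose l := Ordinal lk.
have il : i != l by rewrite -val_eqE /=; lia.
have jl : i != j by rewrite -val_eqE /=; lia.
have lj : l != j by rewrite -val_eqE /=; lia.
have tE : tperm i j = (tperm l j * (tperm i l * tperm l j))%g.
  by have := tpermJ i l (tperm l j); rewrite /conjg tpermV tpermL tpermD 1?eq_sym // => ->.
have -> : list (B \o tperm i j) = list (((B \o tperm l j) \o tperm i l) \o tperm l j).
  by apply: eq_map => x /=; rewrite tE !permM.
have lj1 : j = l.+1 :> nat by rewrite /= jq; lia.
by rewrite alternating_adjacent // IH /= ?alternating_adjacent ?opprK //; lia.
Qed.

Lemma alternating_perm (B : 'I_k -> T) (s : 'S_k) :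
  g (list (B \o s)) = (-1) ^+ s * g (list B).
Proof.
have [ts -> dts] := prod_tpermP s; elim: ts B dts => [B _|t ts IH B /andP [dt dts]].
  rewrite big_nil odd_perm1 mul1r; congr g; apply: eq_map => x /=; by rewrite perm1.
rewrite big_cons; have -> : list (B \o (tperm t.1 t.2 * \prod_(t <- ts) tperm t.1 t.2)%g) =
   list ((B \o (\prod_(t <- ts) tperm t.1 t.2)%g) \o tperm t.1 t.2).
  by apply: eq_map => x /=; rewrite permM.
have dt' : t.1 != t.2 by [].
by rewrite alternating_tperm // IH // odd_mul_tperm dt' signr_addb mulN1r mulNr.
Qed.

End Alternating.

Lemma rev_enum_ord k : map (@rev_ord k) (enum 'I_k) = rev (enum 'I_k).
Proof.
case: k => [|k]; first by rewrite (size0nil (size_enum_ord 0)).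
apply: (@eq_from_nth _ ord0); first by rewrite size_map size_rev.
move=> i; rewrite size_map size_enum_ord => ik; apply: val_inj.
rewrite (nth_map ord0) ?size_enum_ord // nth_rev ?size_enum_ord // /=.
by rewrite !nth_enum_ord //; lia.
Qed.

Section Twistor.
Variables (C : numClosedFieldType) (m : nat).
Local Notation V := 'rV[C]_((2 * m).+3).
Local Notation S := 'cV[C]_(2 ^ m.+1)%N.
Local Notation MS := 'M[C]_(2 ^ m.+1)%N.
Implicit Types (G : MS) (Y Z W : S).
Variables (h : 'M[C]_((2 * m).+3)) (Gamma : 'I_((2 * m).+3) -> MS).
Hypotheses (hsym : h^T = h) (hunit : h \in unitmx).
Hypothesis hcl : clifford_relations h Gamma.
Local Notation hf := (hform h).
Local Notation c := (cliff Gamma).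
Local Notation cliff_word := (cliff_word Gamma).
Variable Xi : S.
Hypothesis pXi : pure Gamma Xi.
Local Notation N0 := (check Gamma <[Xi]>%VS).

Variable G0 : MS.
(** The unsymmetrised version of the equations that define [D_Xi]: it can be
    evaluated on words of arbitrary vectors. *)
Definition low_pairing k Z :=
  forall s : seq V, (size s < k)%N -> spin_form G0 (cliff_word s Z) Xi = 0.

Local Notation delta A := (delta_mx 0 A : V).

Lemma big_cliff_word (I : Type) (r : seq I) (a : I -> 'I_((2 * m).+3)) Z :
  (\big[mulmx/1%:M]_(i <- r) Gamma (a i)) *m Z = cliff_word [seq delta (a i) | i <- r] Z.
Proof.
elim: r => [|i r IH]; first by rewrite big_nil mul1mx.
by rewrite big_cons -mulmxA IH /= cliff_delta.
Qed.

Lemma spin_kformE k Z A : spin_kform Gamma G0 Z Xi A =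
  (k`!)%:R^-1 * \sum_(s : 'S_k) (-1) ^+ s *
    spin_form G0 (cliff_word (map (fun i => delta (A (s i))) (rev (enum 'I_k))) Z) Xi.
Proof.
rewrite /spin_kform; congr (_ * _); apply: eq_bigr => s _; congr (_ * _).
have -> : index_enum (ordinal k : finType) = enum 'I_k by rewrite enumT.
by rewrite big_cliff_word -rev_enum_ord -[in RHS]map_comp enumT.
Qed.

Lemma low_pairing_kform k Z : low_pairing k Z ->
  forall j, (j < k)%N -> forall A : 'I_j -> _, spin_kform Gamma G0 Z Xi A = 0.
Proof.
move=> low j jk A; rewrite spin_kformE big1 ?mulr0 // => s _.
by rewrite low ?mulr0 // size_map size_rev size_enum_ord.
Qed.

(** Expand the letters one after the other, beginning with the last. *)
Lemma pairing_basis k Z :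
  (forall s : seq 'I_((2 * m).+3), size s = k ->
     spin_form G0 (cliff_word (map (fun A => delta A) s) Z) Xi = 0) ->
  forall s : seq V, size s = k -> spin_form G0 (cliff_word s Z) Xi = 0.
Proof.
move=> H s sk; suff {s sk} E (s : seq V) t : size (s ++ map (fun A => delta A) t) = k ->
    spin_form G0 (cliff_word (s ++ map (fun A => delta A) t) Z) Xi = 0.
  by have := E s [::]; rewrite cats0; apply.
elim/last_ind: s t => [t|s v IH t sk]; first by rewrite size_map; exact: H.
rewrite cat_rcons cliff_word_cat /= /cliff mulmx_suml linear_sum /= -[spin_form _ _ _]mulr1.
pose f (Y : S) := spin_form G0 Y Xi.
have fsum (I : finType) (F : I -> S) : f (\sum_i F i) = \sum_i f (F i).
  apply: (big_morph f) => [x y|]; first by rewrite /f spin_formDl.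
  by rewrite /f -(scale0r (0 : S)) spin_formZl mul0r.
rewrite mulr1 -/(f _) fsum big1 // => A _.
rewrite -scalemxAl linearZ /f /= spin_formZl.
have := IH (A :: t); rewrite cliff_word_cat /= cliff_delta => ->; first by rewrite mulr0.
by move: sk; rewrite !size_cat size_rcons /=; lia.
Qed.

(** By induction on the length: two adjacent letters anticommute up to a word
    with two letters less, which pairs to zero by induction.  The pairing is
    thus alternating in the letters, so that it equals its
    skew-symmetrisation. *)
Lemma kform_low_pairing k Z :
  (forall j, (j < k)%N -> forall A : 'I_j -> _, spin_kform Gamma G0 Z Xi A = 0) ->
  low_pairing k Z.
Proof.
move=> kf; have H j : (j <= k)%N -> low_pairing j Z; last exact: H.
elim: j => [|j IH] jk s; first by rewrite ltn0.
have low := IH (ltnW jk); rewrite ltnS leq_eqVlt => /predU1P [sj|]; last exact: low.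
apply: pairing_basis sj => {}s sj.
pose g (t : seq V) := spin_form G0 (cliff_word t Z) Xi.
have sj' : size (rev s) = j by rewrite size_rev.
pose A := tnth (in_tuple (rev s)).
have sE : map (fun i => delta (A i)) (rev (enum 'I_(size (rev s)))) = map (fun A => delta A) s.
  by rewrite (map_comp (fun A => delta A) A) map_rev map_tnth_enum /= revK.
have swap s1 v w s2 : size (s1 ++ v :: w :: s2) = size (rev s) ->
    g (s1 ++ v :: w :: s2) = - g (s1 ++ w :: v :: s2).
  rewrite sj' size_cat /= => sz; rewrite /g !cliff_word_cat /= (cliff_swap hcl) linearB linearN /=.
  rewrite linearZ /= -cliff_word_cat spin_formDl !spin_formNl spin_formZl low ?mulr0 ?oppr0 ?addr0 //.
  by rewrite size_cat; lia.
have := kf (size (rev s)); rewrite sj' => /(_ jk); rewrite -sj' => /(_ A).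
rewrite spin_kformE; under eq_bigr => t _.
  rewrite -/(g _) -[map _ _]/(map ((fun i => delta (A i)) \o t) _).
  rewrite (alternating_perm swap) mulrA -expr2 sqrr_sign mul1r sE; over.
rewrite sumr_const -[X in _ * X]mulr_natl card_Sn mulrA mulVf ?mul1r //.
by rewrite pnatr_eq0 -lt0n fact_gt0.
Qed.

(** Move [X] to the left end, where it kills; each letter that it crosses
    leaves a word with one letter less applied to [Z]. *)
Lemma low_pairing_N0 k X Z : clifford_adjoint Gamma ((-1) ^+ m.+1) G0 -> X \in N0 ->
  low_pairing k Z -> low_pairing k.+1 (c X *m Z).
Proof.
move=> adj XN low s; rewrite ltnS => sk.
suff H s1 s2 : (size (s1 ++ s2) <= k)%N -> spin_form G0 (cliff_word s1 (c X *m cliff_word s2 Z)) Xi = 0.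
  by have := H s [::]; rewrite cats0 => /(_ sk).
elim/last_ind: s1 s2 => [s2 _|s1 v IH s2]; first exact: (adjoint_N0 adj).
rewrite cat_rcons => sz; rewrite -cats1 cliff_word_cat /= (cliff_swap hcl) linearB linearN /=.
rewrite linearZ /= spin_formDl !spin_formNl spin_formZl -cliff_word_cat.
rewrite (low (s1 ++ s2)); last by move: sz; rewrite !size_cat /=; lia.
by rewrite (IH (v :: s2)) // !(mulr0, oppr0, addr0).
Qed.

Lemma low_pairing_cliff X : clifford_adjoint Gamma ((-1) ^+ m.+1) G0 ->
  low_pairing m (c X *m Xi).
Proof.
move=> adj s sm; rewrite -[c X *m Xi]/(cliff_word [:: X] Xi) -cliff_word_cat.
apply: (adjoint_low hsym hunit hcl pXi adj); rewrite size_cat addn1; exact: sm.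
Qed.

(** A normalisation of the vector [u] of the frame. *)
Lemma pure_in_orbit : exists2 X, c X *m Xi = Xi & forall Y : V, Y \in N0 -> hf Y X = 0.
Proof.
have [n [d [u [fr nu du uu]]]] := fock_frame_exists hsym hunit hcl pXi.
have [l ul l0] := orth_eigen hsym hunit hcl pXi fr nu uu.
exists (l^-1 *: u); first by rewrite linearZ /= -scalemxAl ul scalerA mulVf // scale1r.
move=> Y /(fock_N0 fr) [a ->]; rewrite (hformC hsym) linear_sum big1 // => i _.
by rewrite linearZ /= (hformZl hsym) (hformC hsym) nu !mulr0.
Qed.

(** The products [n n' Z] vanish by non-degeneracy, so [n_i Z = a_i Xi] for some
    scalars [a_i], and [D Xi], with [D] the combination of the [d_i] with
    coefficients [a_i], has the same images.  Then [Z - D Xi] is killed by all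
    the [n_i]. *)
Lemma low_pairing_image Z : G0 != 0 -> clifford_adjoint Gamma ((-1) ^+ m.+1) G0 ->
  low_pairing m Z -> exists X, Z = c X *m Xi.
Proof.
move=> G00 adj low; have [n [d [u [fr nu du uu]]]] := fock_frame_exists hsym hunit hcl pXi.
have e0 : (-1) ^+ m.+1 != 0 :> C by rewrite signr_eq0.
have nn X X' : X \in N0 -> X' \in N0 -> c X *m (c X' *m Z) = 0.
  move=> XN X'N; have low2 := low_pairing_N0 adj XN (low_pairing_N0 adj X'N low).
  apply: (adjoint_nondegenerate hsym hunit hcl pXi e0 G00 adj) => W.
  suff H k Y s : Y \in tower Gamma Xi d k -> (size s + k <= m.+1)%N ->
      spin_form G0 (cliff_word s (c X *m (c X' *m Z))) Y = 0.
    exact: (H m.+1 W [::] (tower_full hunit hcl pXi fr W) (leqnn _)).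
  elim: k Y s => [Y s /vlineP [a ->]|k IH Y s /towerSP [w [w' [wT w'T ->]]] sm].
    by rewrite addn0 => sm; rewrite linearZ /= low2 ?mulr0.
  rewrite linearD /= IH ?add0r //; last by lia.
  apply: (mulfI e0); rewrite -adj mulr0 -[_ *m _]/(cliff_word (d k :: s) _) IH //= addSnnS //.
have [E _ EN] := pure_in_orbit.
have nZ i : (i <= m)%N -> exists a, c (n i) *m Z = a *: Xi.
  move=> im; apply/vlineP; apply: (common_kernel hunit hcl pXi fr) => X XN.
  by rewrite nn // (fock_mem fr).
have [a aE] : exists a : nat -> C, forall i, (i <= m)%N -> c (n i) *m Z = a i *: Xi.
  have : forall i, exists a, (i <= m)%N -> c (n i) *m Z = a *: Xi.
    move=> i; have [im|_] := boolP (i <= m)%N; last by exists 0.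
    by have [b bE] := nZ _ im; exists b.
  by move/choice=> [a aE]; exists a.
pose D := \sum_(i < m.+1) a i *: d i.
have : Z - c D *m Xi \in <[Xi]>%VS.
  apply: (common_kernel hunit hcl pXi fr) => X /(fock_N0 fr) [b ->].
  rewrite linear_sum mulmx_suml big1 // => i _ /=; rewrite linearZ /= -scalemxAl linearB /=.
  have im : (i <= m)%N by rewrite -ltnS ltn_ord.
  rewrite aE // (cliff_swap hcl) (cliff_N0 (fock_mem fr im)) linear0 oppr0 add0r.
  have -> : hf (n i) D = - 2^-1 * a i.
    rewrite /D linear_sum (bigD1 i) //= big1 => [|j ji].
      by rewrite linearZ /= (fock_nd fr) // eqxx mulr1 addr0 mulrC.
    rewrite linearZ /= (fock_nd fr) //; last by rewrite -ltnS ltn_ord.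
    by rewrite eq_sym val_eqE (negPf ji) !mulr0.
  by rewrite mulrA mulrN divff ?pnatr_eq0 // mulN1r scaleNr opprK subrr scaler0.
case/vlineP => b /eqP; have [E' E'Xi _] := pure_in_orbit.
rewrite subr_eq -{1}E'Xi => /eqP ->; exists (b *: E' + D).
by rewrite linearP /= mulmxDl -scalemxAl.
Qed.

End Twistor.

(** * The almost null structure off the gamma-plane *)

Lemma line_gen (C : fieldType) (T : vectType C) (x : {vspace T}) : \dim x = 1%N ->
  exists2 X, X != 0 & x = <[X]>%VS.
Proof.
move=> dx; exists (vpick x); first by rewrite vpick0 -dimv_eq0 dx.
apply/esym/eqP; rewrite eqEdim -memvE memv_pick dx dim_vline vpick0.
by rewrite -dimv_eq0 dx.
Qed.

Section Incidence.
Variables (C : numClosedFieldType) (m : nat).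
Local Notation V := 'rV[C]_((2 * m).+3).
Local Notation S := 'cV[C]_(2 ^ m.+1)%N.
Local Notation MS := 'M[C]_(2 ^ m.+1)%N.
Implicit Types (X Y : V) (Z W : S).
Variables (h : 'M[C]_((2 * m).+3)) (Gamma : 'I_((2 * m).+3) -> MS).
Hypotheses (hsym : h^T = h) (hunit : h \in unitmx).
Hypothesis hcl : clifford_relations h Gamma.
Local Notation hf := (hform h).
Local Notation c := (cliff Gamma).
Variable Xi : S.
Hypothesis pXi : pure Gamma Xi.
Local Notation N0 := (check Gamma <[Xi]>%VS).
Local Notation U := (quadric h `\` projective_points N0).

(** The null vectors that represent the points off the gamma-plane. *)
Definition off_plane X := hf X X = 0 /\ X \notin N0.

Lemma off_neq0 X : off_plane X -> X != 0.
Proof. by case=> _; apply: contra => /eqP ->; rewrite mem0v. Qed.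

Lemma off_U X : U <[X]>%VS <-> off_plane X.
Proof.
split=> [[[d1 q] np]|offX].
  split; first exact/q/memv_line.
  by apply/negP => XN; apply: np; split => //; rewrite -memvE.
have X0 := off_neq0 offX; case: offX => XX XN; split; last first.
  by case=> _; rewrite -memvE => XN'; rewrite XN' in XN.
split; first by rewrite dim_vline X0.
by move=> _ /vlineP [a ->]; rewrite !(hform_simp hsym) XX !mulr0.
Qed.

Lemma off_gen x : U x -> exists2 X, off_plane X & x = <[X]>%VS.
Proof.
move=> Ux; have [[/line_gen [X X0 xX] _] _] := Ux; exists X => //.
by apply/off_U; rewrite -xX.
Qed.

Lemma orth1 X Y : (Y \in orth h <[X]>) = (hf X Y == 0).
Proof.
apply/(orthP h)/eqP => [->//|XY _ /vlineP [a ->]]; first exact: memv_line.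
by rewrite (hformZl hsym) XY mulr0.
Qed.

(** Otherwise [X] would be orthogonal to a maximal isotropic space, hence in
    it.  The vector [I] later serves as a point at infinity. *)
Lemma off_dual X : off_plane X -> exists2 I, I \in N0 & hf X I = 1.
Proof.
case=> XX XN; apply: contrapT => H; move/negP: XN; apply.
apply: (isotropic_max hsym hunit (pure_isotropic hcl pXi) (pure_dim pXi) XX) => Y YN.
apply: contrapT => /eqP XY; apply: H; exists ((hf X Y)^-1 *: Y); first by rewrite rpredZ.
by rewrite hformZr mulVf.
Qed.

Lemma off_spinor X : off_plane X -> c X *m Xi != 0.
Proof. by case=> _; rewrite (mem_N0 Gamma). Qed.

Lemma N0_orth X Y : X \in N0 -> Y \in N0 -> hf X Y = 0.
Proof. exact: (isotropic_orth hsym (pure_isotropic hcl pXi)). Qed.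

Lemma dim_N0_orth X : off_plane X -> \dim (N0 :&: orth h <[X]>) = m.
Proof.
move=> oX; have [I IN XI] := off_dual oX.
have := dim_cap_orth hsym IN (X := X); rewrite XI oner_eq0 => /(_ isT).
by rewrite (pure_dim pXi) => -[].
Qed.

(** The right-hand side kills [X Xi] and has dimension [m + 1], the largest
    possible for an isotropic space. *)
Lemma check_cliff X : off_plane X ->
  check Gamma <[c X *m Xi]> = (<[X]> + (N0 :&: orth h <[X]>))%VS.
Proof.
move=> oX; apply/esym/eqP; rewrite eqEdim; apply/andP; split; last first.
  rewrite dim_add_line ?dim_N0_orth //; first exact: (check_dim_le hsym hunit hcl (off_spinor oX)).
  by apply/negP => /memv_capP [XN _]; case: oX => _; rewrite XN.
rewrite subv_add -memvE (mem_check1 Gamma) (cliff_sq hcl) oX.1 oppr0 scale0r eqxx /=.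
apply/subvP => Y /memv_capP [YN]; rewrite orth1 => /eqP XY.
rewrite (mem_check1 Gamma) (cliff_swap hcl) (cliff_N0 YN) linear0 (hformC hsym Y) XY.
by rewrite mulr0 scale0r subr0 oppr0.
Qed.

Lemma pure_cliff X : off_plane X -> pure Gamma (c X *m Xi).
Proof.
move=> oX; split; first exact: off_spinor.
rewrite check_cliff // dim_add_line ?dim_N0_orth //.
by apply/negP => /memv_capP [XN _]; case: oX => _; rewrite XN.
Qed.

(** For [Y] orthogonal to [X], the vectors [X] and [Y] anticommute on [Xi]. *)
Lemma N_of_check X : off_plane X ->
  N_of h Gamma (tractor_projection Xi) <[X]>%VS = check Gamma <[c X *m Xi]>.
Proof.
move=> oX; apply/vspaceP => Y; apply/(N_ofP h Gamma (tractor_projection Xi) <[X]> Y)/idP.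
  move=> /(_ X (memv_line X)) [XY XYXi].
  by rewrite (mem_check1 Gamma) (cliff_swap hcl) XYXi (hformC hsym) XY mulr0 scale0r subr0 oppr0.
move=> Yc _ /vlineP [a ->].
have XY : hf X Y = 0.
  move: Yc; rewrite check_cliff // => /memv_addP [_ /vlineP [b ->]] [n /memv_capP [_]].
  rewrite orth1 => /eqP Xn ->.
  by rewrite linearD /= hformZr oX.1 Xn mulr0 addr0.
rewrite (hformZl hsym) XY mulr0; split=> //.
move: Yc; rewrite (mem_check1 Gamma) => /eqP Yc.
rewrite [c _]linearZ /= -scalemxAl (cliff_swap hcl) Yc XY mulr0 scale0r oppr0 addr0.
by rewrite scaler0.
Qed.

Lemma check_line X Y : off_plane X -> off_plane Y -> X \in check Gamma <[c Y *m Xi]> ->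
  <[c X *m Xi]>%VS = <[c Y *m Xi]>%VS.
Proof.
move=> oX oY; rewrite check_cliff // => /memv_addP [_ /vlineP [b ->]] [n /memv_capP [nN _]] E.
have EX : c X *m Xi = b *: (c Y *m Xi).
  by rewrite E linearD /= mulmxDl (cliff_N0 nN) addr0 linearZ /= -scalemxAl.
have b0 : b != 0 by have := off_spinor oX; rewrite EX scaler_eq0 negb_or => /andP [].
apply/eqP; rewrite EX eqEdim -memvE memvZ ?memv_line // !dim_vline scaler_eq0.
by rewrite (negPf b0) leqnn.
Qed.

(** The kernel of the differential of the projection from [K], in the
    representation of tangent vectors by [x^perp]. *)
Definition dist_mod K (x : {vspace V}) : {vspace V} := (orth h x :&: (x + K))%VS.

Lemma N_of_dist_mod x : U x -> N_of h Gamma (tractor_projection Xi) x = dist_mod N0 x.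
Proof.
move=> /off_gen [X oX ->]; rewrite N_of_check // check_cliff //; apply/vspaceP => Y.
apply/idP/idP.
  move=> /memv_addP [_ /vlineP [b ->]] [n /memv_capP [nN]]; rewrite orth1 => /eqP Xn ->.
  apply/memv_capP; split; last by rewrite memv_add ?memvZ ?memv_line.
  by rewrite orth1 linearD /= hformZr oX.1 Xn mulr0 addr0.
move=> /memv_capP [] /[swap] /memv_addP [_ /vlineP [b ->]] [n nN ->].
rewrite orth1 linearD /= hformZr oX.1 mulr0 add0r => Xn.
by rewrite memv_add ?memvZ ?memv_line //; apply/memv_capP; rewrite orth1.
Qed.

(** A vector orthogonal to [X] and to the hyperplane [N0 :&: X^perp] of [N0]
    becomes orthogonal to [N0] after subtraction of a multiple of [X]. *)
Lemma perp_N_dist_mod x : U x ->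
  perp h (N_of h Gamma (tractor_projection Xi)) x = dist_mod (orth h N0) x.
Proof.
move=> Ux; rewrite /perp; have [X oX xX] := off_gen Ux.
rewrite xX N_of_check // check_cliff //; apply/vspaceP => Y.
rewrite /dist_mod !memv_cap orth1; apply: andb_id2l => /eqP XY.
apply/(orthP h)/memv_addP => [YO|[_ /vlineP [b ->]] [n /(orthP h) nO YE] W].
  have [I IN XI] := off_dual oX.
  exists (hf I Y *: X); first by rewrite rpredZ ?memv_line.
  exists (Y - hf I Y *: X); last by rewrite addrC subrK.
  apply/(orthP h) => n nN.
  have nI : n - hf X n *: I \in (N0 :&: orth h <[X]>)%VS.
    apply/memv_capP; split; first by rewrite rpredB // rpredZ.
    by rewrite orth1 linearB /= hformZr XI mulr1 subrr.
  have := YO _ (subvP (addvSr <[X]> _) _ nI).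
  by rewrite !(hform_simp hsym) (hformC hsym n X) mulrC.
move=> /memv_addP [_ /vlineP [a ->]] [n' /memv_capP [n'N]]; rewrite orth1 => /eqP Xn' ->.
move: XY; rewrite YE linearD /= hformZr oX.1 mulr0 add0r => XY.
by rewrite !(hform_simp hsym) oX.1 (nO _ n'N) (hformC hsym n' X) Xn' XY !(mulr0, addr0).
Qed.

End Incidence.

(** * Twistors and the fibres of the projections *)

Definition clifford_orbit (C : numClosedFieldType) m
  (Gamma : 'I_((2 * m).+3) -> 'M[C]_(2 ^ m.+1)%N) (Z : 'cV[C]_(2 ^ m.+1)%N)
  (X : 'rV[C]_((2 * m).+3)) := cliff Gamma X *m Z.

Lemma clifford_orbit_linear (C : numClosedFieldType) m
  (Gamma : 'I_((2 * m).+3) -> 'M[C]_(2 ^ m.+1)%N) (Z : 'cV[C]_(2 ^ m.+1)%N) :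
  linear (clifford_orbit Gamma Z).
Proof. by move=> a X Y; rewrite /clifford_orbit linearP mulmxDl -scalemxAl. Qed.
HB.instance Definition _ (C : numClosedFieldType) m
    (Gamma : 'I_((2 * m).+3) -> 'M[C]_(2 ^ m.+1)%N) (Z : 'cV[C]_(2 ^ m.+1)%N) :=
  GRing.isLinear.Build C 'rV[C]_((2 * m).+3) 'cV[C]_(2 ^ m.+1)%N *:%R
    (clifford_orbit Gamma Z) (clifford_orbit_linear Gamma Z).

Section Twistors.
Variables (C : numClosedFieldType) (m : nat).
Local Notation V := 'rV[C]_((2 * m).+3).
Local Notation S := 'cV[C]_(2 ^ m.+1)%N.
Local Notation MS := 'M[C]_(2 ^ m.+1)%N.
Implicit Types (X Y : V) (Z W : S).
Variables (h : 'M[C]_((2 * m).+3)) (Gamma : 'I_((2 * m).+3) -> MS).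
Hypotheses (hsym : h^T = h) (hunit : h \in unitmx).
Hypothesis hcl : clifford_relations h Gamma.
Local Notation hf := (hform h).
Local Notation c := (cliff Gamma).
Variable Xi : S.
Hypothesis pXi : pure Gamma Xi.
Local Notation N0 := (check Gamma <[Xi]>%VS).
Local Notation U := (quadric h `\` projective_points N0).
Local Notation off_plane := (off_plane h Gamma Xi).

Definition twistor_plane : {vspace S} := limg (linfun (clifford_orbit Gamma Xi)).

Lemma twistor_planeP Z : reflect (exists X, Z = c X *m Xi) (Z \in twistor_plane).
Proof.
apply: (iffP memv_imgP) => [[X _ ->]|[X ->]]; exists X; rewrite ?memvf //; by rewrite lfunE.
Qed.

Lemma dim_twistor_plane : \dim twistor_plane = m.+2.
Proof.
have E : (lker (linfun (clifford_orbit Gamma Xi)) = N0)%VS.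
  by apply/vspaceP => X; rewrite memv_ker lfunE (mem_N0 Gamma).
have := limg_ker_dim (linfun (clifford_orbit Gamma Xi)) fullv.
rewrite capfv E (pure_dim pXi) dimvf /dim /= mul1n -/twistor_plane.
move: (\dim twistor_plane) => d; lia.
Qed.

(** A vector of the isotropic space may be added to [X] without change of
    [X Xi]; one with [h(X, Y) != 0] makes [X] null.  If there is none, [X Xi]
    is killed by the isotropic space and is a multiple of [Xi]. *)
Lemma orbit_off Z : (exists X, Z = c X *m Xi) -> Z \notin <[Xi]>%VS ->
  exists2 X, off_plane X & Z = c X *m Xi.
Proof.
move=> [X ->] ZXi; have [H|H] := pselect (forall Y, Y \in N0 -> hf X Y = 0).
  have [n [d [u [fr _ _ _]]]] := fock_frame_exists hsym hunit hcl pXi.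
  case/negP: ZXi; apply: (common_kernel hunit hcl pXi fr) => Y YN.
  by rewrite (cliff_swap hcl) (cliff_N0 YN) linear0 (hformC hsym Y) H // mulr0 scale0r subr0 oppr0.
have [Y [YN XY]] : exists Y, Y \in N0 /\ hf X Y != 0.
  apply: contrapT => H'; apply: H => Y YN; apply: contrapT => /eqP XY; apply: H'.
  by exists Y.
have YY := pure_isotropic hcl pXi YN.
(* The root of [h(X + t Y, X + t Y) = h(X, X) + 2 t h(X, Y)]. *)
pose t := - hf X X / (2 * hf X Y).
have EXi : c (X + t *: Y) *m Xi = c X *m Xi.
  by rewrite linearD linearZ /= mulmxDl -scalemxAl (cliff_N0 YN) scaler0 addr0.
exists (X + t *: Y); last by rewrite EXi.
split; last first.
  rewrite (mem_N0 Gamma) EXi; apply: contra ZXi => /eqP ->; exact: mem0v.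
rewrite !(hform_simp hsym) YY (hformC hsym Y X) !mulr0 addr0 -addrA -mulr2n -mulr_natl.
by rewrite /t mulrCA divfK ?subrr // mulf_neq0 ?pnatr_eq0.
Qed.

Lemma off_notin_line X : off_plane X -> c X *m Xi \notin <[Xi]>%VS.
Proof.
move=> oX; have [I IN XI] := off_dual hsym hunit hcl pXi oX.
apply/negP => /vlineP [a E]; have := cliff_swap hcl I X Xi.
rewrite E linearZ /= (cliff_N0 IN) !(linear0, scaler0) (hformC hsym) XI mulr1 ?oppr0 ?sub0r.
move/esym/eqP; rewrite oppr_eq0 scaler_eq0 pnatr_eq0 /=; exact/negP/(pure_neq0 pXi).
Qed.

Section TwistorFamily.
Variable G0 : MS.
Hypotheses (G00 : G0 != 0) (G0inv : spin_invariant h Gamma G0).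

Lemma D_twistorE : D_twistor Gamma G0 Xi = projective_points twistor_plane.
Proof.
have adj := invariant_adjoint hsym hunit hcl pXi G00 G0inv.
apply/seteqP; split=> z [dz zD]; split=> //.
  apply/subvP => Z Zz; apply/twistor_planeP.
  apply: (low_pairing_image hsym hunit hcl pXi G00 adj).
  by apply: (kform_low_pairing hunit hcl) => j jm A; apply: zD.
move=> Z Zz j jm A; have /twistor_planeP [X ->] := subvP zD _ Zz.
exact: (low_pairing_kform (low_pairing_cliff hsym hunit hcl pXi X adj)).
Qed.

Lemma D_minusP z : (D_twistor Gamma G0 Xi `\ <[Xi]>%VS) z <->
  exists2 X, off_plane X & z = <[c X *m Xi]>%VS.
Proof.
rewrite D_twistorE; split=> [[[/line_gen [Z Z0 ->] zP] zXi]|[X oX ->]].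
  have /twistor_planeP ZX : Z \in twistor_plane by rewrite memvE.
  have [|X oX ZE] := orbit_off ZX; last by exists X; rewrite // -ZE.
  apply/negP => ZXi; apply: zXi; apply/eqP; rewrite eqEdim -memvE ZXi !dim_vline Z0.
  by rewrite (pure_neq0 pXi).
split; last first.
  by move=> E; have := off_notin_line oX; rewrite -E memv_line.
split; first by rewrite dim_vline (off_spinor oX).
by rewrite -memvE; apply/twistor_planeP; exists X.
Qed.

Lemma D_twistor_pure : D_twistor Gamma G0 Xi `<=` twistor_space Gamma.
Proof.
move=> z zD; have [->|zXi] := pselect (z = <[Xi]>%VS); first by exists Xi.
have /D_minusP [X oX ->] : (D_twistor Gamma G0 Xi `\ <[Xi]>%VS) z by split.
by exists (c X *m Xi) => //; exact: (pure_cliff hsym hunit hcl pXi).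
Qed.

Lemma D_minus_hat : D_twistor Gamma G0 Xi `\ <[Xi]>%VS `<=` hat_set Gamma U.
Proof.
move=> z /D_minusP [X oX ->]; exists <[X]>%VS; first exact/(off_U Gamma hsym).
split; first by exists (c X *m Xi) => //; exact: (pure_cliff hsym hunit hcl pXi).
by rewrite -memvE (mem_check1 Gamma) (cliff_sq hcl) oX.1 oppr0 scale0r.
Qed.

Lemma D_minus_hat_point X : off_plane X ->
  (D_twistor Gamma G0 Xi `\ <[Xi]>%VS) `&` hat Gamma <[X]>%VS = [set <[c X *m Xi]>%VS].
Proof.
move=> oX; apply/seteqP; split=> [z [/D_minusP [Y oY ->] [_]]|_ ->].
  by rewrite -memvE => XY; rewrite /= (check_line hsym hunit hcl pXi oX oY XY).
have W : (D_twistor Gamma G0 Xi `\ <[Xi]>%VS) <[c X *m Xi]>%VS by apply/D_minusP; exists X.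
split=> //; split; first by apply: D_twistor_pure; case: W.
by rewrite -memvE (mem_check1 Gamma) (cliff_sq hcl) oX.1 oppr0 scale0r.
Qed.

End TwistorFamily.

(** The fibre of the projection from [K] through the point of [X]. *)
Definition fibre (K : {vspace V}) X : set {vspace V} := projective_points (<[X]> + K)%VS `&` U.

(** For a null vector [a X + n] with [a != 0] and [n] in [N0], nullity means
    that [n] is orthogonal to [X]. *)
Lemma fibre_N0 X : off_plane X -> fibre N0 X = projective_points (check Gamma <[c X *m Xi]>%VS) `&` U.
Proof.
move=> oX; rewrite (check_cliff hsym hunit hcl pXi oX) /fibre.
apply/seteqP; split=> x [[dx xP] Ux]; split=> //; split=> //; last first.
  by apply: subv_trans xP _; rewrite addvS ?subvv ?capvSl.
have [Y oY xY] := off_gen hsym Ux; move: xP; rewrite xY -!memvE.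
move=> /memv_addP [_ /vlineP [a ->]] [n nN YE]; rewrite YE memv_add ?rpredZ ?memv_line //.
have a0 : a != 0.
  by apply: contraTneq nN => a0; move: oY.2; rewrite YE a0 scale0r add0r.
apply/memv_capP; split=> //; rewrite (orth1 hsym); have /eqP := oY.1; rewrite YE.
rewrite !(hform_simp hsym) oX.1 (hformC hsym n) (pure_isotropic hcl pXi nN).
by rewrite !mulr0 add0r addr0 -mulr2n mulrn_eq0 /= mulf_eq0 (negPf a0).
Qed.

Section Fibre.
Variable K : {vspace V}.
Hypothesis KO : (K <= orth h N0)%VS.

Lemma fibre_self X : off_plane X -> fibre K X <[X]>%VS.
Proof.
move=> oX; split; last exact/(off_U Gamma hsym).
by split; [rewrite dim_vline (off_neq0 oX)|rewrite addvSl].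
Qed.

Lemma off_orth X : off_plane X -> X \notin orth h N0.
Proof.
move=> oX; have [I IN XI] := off_dual hsym hunit hcl pXi oX.
by apply/(orthP h) => /(_ I IN) /eqP; rewrite (hformC hsym) XI oner_eq0.
Qed.

Lemma fibre_coef X Y : off_plane Y -> Y \in (<[X]> + K)%VS ->
  exists a k, [/\ a != 0, k \in K & Y = a *: X + k].
Proof.
move=> oY /memv_addP [_ /vlineP [a ->]] [k kK YE]; exists a, k; split=> //.
apply: contraTneq (subvP KO _ kK) => a0; have := off_orth oY.
by rewrite YE a0 scale0r add0r.
Qed.

Lemma fibre_eq X Y : off_plane X -> off_plane Y -> Y \in (<[X]> + K)%VS -> fibre K X = fibre K Y.
Proof.
move=> oX oY XY; rewrite /fibre; congr (projective_points _ `&` _).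
have [a [k [a0 kK YE]]] := fibre_coef oY XY.
apply: subv_anti; rewrite !subv_add !addvSr -!memvE XY /= !andbT.
have -> : X = a^-1 *: Y + - (a^-1 *: k).
  by rewrite YE scalerDr scalerA mulVf // scale1r addrK.
by rewrite memv_add ?rpredN ?rpredZ ?memv_line.
Qed.

Lemma fibreP X x : off_plane X -> fibre K X x <->
  exists2 Y, off_plane Y & x = <[Y]>%VS /\ Y \in (<[X]> + K)%VS.
Proof.
move=> oX; split=> [[[dx xP] Ux]|[Y oY [-> YX]]].
  by have [Y oY xY] := off_gen hsym Ux; exists Y; rewrite // xY -memvE in xP *.
by split; [split; [rewrite dim_vline (off_neq0 oY)|rewrite -memvE]|apply/(off_U Gamma hsym)].
Qed.

End Fibre.

(** The subspace of dimension [m] common to all gamma-planes of the fibre for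
    [K = N0^perp]. *)
Definition axis X := (N0 :&: orth h <[X]>)%VS.

Lemma axis_eq X Y : off_plane Y -> Y \in (<[X]> + orth h N0)%VS -> axis X = axis Y.
Proof.
move=> oY /(fibre_coef (subvv _) oY) [a [k [a0 /(orthP h) kK ->]]].
apply/vspaceP => Z; rewrite /axis !memv_cap; apply: andb_id2l => ZN.
rewrite !(orth1 hsym) !(hform_simp hsym) (hformC hsym k) kK // addr0 mulf_eq0.
by rewrite (negPf a0).
Qed.

(** The same correction by a multiple of [X] as in [perp_N_dist_mod]. *)
Lemma axis_inj X Y : off_plane X -> axis X = axis Y -> Y \in (<[X]> + orth h N0)%VS.
Proof.
move=> oX HE; have [I IN XI] := off_dual hsym hunit hcl pXi oX.
rewrite -[Y](subrK (hf Y I *: X)) addrC memv_add ?rpredZ ?memv_line //.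
apply/(orthP h) => n nN.
have : n - hf X n *: I \in axis Y.
  rewrite -HE; apply/memv_capP; split; first by rewrite rpredB // rpredZ.
  by rewrite (orth1 hsym) linearB /= hformZr XI mulr1 subrr.
move=> /memv_capP [_]; rewrite (orth1 hsym) linearB /= hformZr => /eqP E.
by rewrite (hformC hsym) !(hform_simp hsym) mulrC.
Qed.

(** All points of [P] off [N0] lie in one fibre, so they are orthogonal to the
    axis; the points in [N0] are as well.  By maximality [P] contains the
    axis. *)
Lemma gamma_plane_axis X P : off_plane X ->
  contains_gamma_plane h U (fibre (orth h N0) X) P -> (P :&: N0)%VS = axis X.
Proof.
move=> oX [[dP iP] [y [yP Uy]] PL].
have {dP} dP : \dim P = m.+1 by move: dP; rewrite /is_plane; lia.
have PH Y : Y \in P -> off_plane Y -> axis X = axis Y.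
  move=> YP oY; apply: axis_eq => //.
  have : fibre (orth h N0) X <[Y]>%VS.
    apply: PL; split; last exact/(off_U Gamma hsym).
    by split; [rewrite dim_vline (off_neq0 oY)|rewrite -memvE].
  by move=> [[_]]; rewrite -memvE.
have [Y oY yY] := off_gen hsym Uy.
have YP : Y \in P by case: yP => _; rewrite yY -memvE.
apply/vspaceP => Z; apply/idP/idP => [/memv_capP [ZP ZN]|ZH].
  rewrite (PH Y) //; apply/memv_capP; rewrite (orth1 hsym); split=> //.
  by rewrite (isotropic_orth hsym iP YP ZP).
have ZN : Z \in N0 by case/memv_capP: ZH.
apply/memv_capP; split=> //; apply: (isotropic_max hsym hunit iP dP).
  exact: (pure_isotropic hcl pXi).
move=> W WP; have [WN|WN] := boolP (W \in N0).
  exact: (N0_orth hsym hcl pXi).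
move: ZH; rewrite (PH W) //; last by split=> //; exact: iP.
by move=> /memv_capP [_]; rewrite (orth1 hsym) (hformC hsym) => /eqP.
Qed.

(** A common point off [N0] would identify the fibres, so the intersection is
    that of the two axes, which are distinct hyperplanes of [N0]. *)
Lemma gamma_planes_meet X1 X2 P1 P2 : off_plane X1 -> off_plane X2 ->
  fibre (orth h N0) X1 <> fibre (orth h N0) X2 ->
  contains_gamma_plane h U (fibre (orth h N0) X1) P1 ->
  contains_gamma_plane h U (fibre (orth h N0) X2) P2 ->
  is_plane (m%:Z - 2) (P1 :&: P2)%VS.
Proof.
move=> o1 o2 L12 C1 C2; have H1 := gamma_plane_axis o1 C1; have H2 := gamma_plane_axis o2 C2.
have PH : (P1 :&: P2 = axis X1 :&: axis X2)%VS.
  apply/vspaceP => W; rewrite -H1 -H2 !memv_cap; apply/idP/idP; last first.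
    by move=> /andP [/andP [-> _] /andP [-> _]].
  move=> /andP [W1 W2]; rewrite W1 W2 !andTb andbb; apply: contraT => WN.
  have oW : off_plane W by split=> //; case: C1 => [[_ i1] _ _]; exact: i1.
  have F : (projective_points P1 `&` U) <[W]>%VS /\ (projective_points P2 `&` U) <[W]>%VS.
    by split; (split; [split; [rewrite dim_vline (off_neq0 oW)|rewrite -memvE]|apply/(off_U Gamma hsym)]).
  case: L12; transitivity (fibre (orth h N0) W).
    apply: fibre_eq => //; case: C1 => _ _ /(_ _ F.1) [[_]]; by rewrite -memvE.
  apply/esym; apply: fibre_eq => //; case: C2 => _ _ /(_ _ F.2) [[_]]; by rewrite -memvE.
rewrite /is_plane PH.
have d1 := dim_N0_orth hsym hunit hcl pXi o1; have d2 := dim_N0_orth hsym hunit hcl pXi o2.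
have sub : (axis X1 + axis X2 <= N0)%VS by rewrite subv_add !capvSl.
have := dimvS sub; have := dimv_sum_cap (axis X1) (axis X2).
rewrite [\dim (axis X1)]d1 [\dim (axis X2)]d2 (pure_dim pXi) => E le.
have ne : (m < \dim (axis X1 + axis X2))%N.
  rewrite ltnNge; apply/negP => le'; apply: L12; apply: fibre_eq => //.
  apply: axis_inj => //; apply/eqP; rewrite eqEdim [\dim (axis X1)]d1 [\dim (axis X2)]d2 leqnn andbT.
  have /eqP -> : axis X2 == (axis X1 + axis X2)%VS by rewrite eqEdim addvSr [\dim (axis X2)]d2.
  exact: addvSl.
move: E le ne; move: (\dim (axis X1 + axis X2)) (\dim (axis X1 :&: axis X2)) => a b; lia.
Qed.

(** Correcting the vector of [pure_in_orbit] by a multiple of [I] makes it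
    orthogonal to [O] as well, without changing its action on [Xi]. *)
Lemma unit_normal O I : off_plane O -> I \in N0 -> hf O I = 1 ->
  exists u, [/\ c u *m Xi = Xi, forall Y, Y \in N0 -> hf u Y = 0, hf u O = 0, hf u u = -1 &
    orth h N0 = (<[u]> + N0)%VS].
Proof.
move=> oO IN OI; have [E EXi EN] := pure_in_orbit hsym hunit hcl pXi.
pose u := E - hf E O *: I; have uXi : c u *m Xi = Xi.
  by rewrite linearB linearZ /= mulmxBl EXi -scalemxAl (cliff_N0 IN) scaler0 subr0.
have uN Y : Y \in N0 -> hf u Y = 0.
  move=> YN; rewrite (hformC hsym) /u linearB linearZ /= EN // (N0_orth hsym hcl pXi YN IN).
  by rewrite mulr0 subrr.
have uu : hf u u = -1.
  have := cliff_sq hcl u Xi; rewrite !uXi => /eqP; rewrite -{1}[Xi]scale1r -subr_eq0 -scalerBl.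
  by rewrite scaler_eq0 (negPf (pure_neq0 pXi)) orbF opprK addr_eq0 => /eqP ->; rewrite opprK.
exists u; split=> //.
  by rewrite /u (hformDl hsym) (hformNl hsym) (hformZl hsym) (hformC hsym I) OI mulr1 subrr.
apply/esym/eqP; rewrite eqEdim subv_add; apply/andP; split.
  apply/andP; split; last exact: (isotropicP hsym (pure_isotropic hcl pXi)).
  by rewrite -memvE; apply/(orthP h) => Y YN; rewrite (hformC hsym) uN.
rewrite dim_add_line; last first.
  apply/negP => /(pure_isotropic hcl pXi) /eqP; by rewrite uu oppr_eq0 oner_eq0.
have := dim_orth hsym hunit N0; rewrite (pure_dim pXi).
move: (\dim (orth h N0)) => d; lia.
Qed.

End Twistors.

(** * Differentiation and flat charts *)

Section Calculus.
Variables (K : numFieldType).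

(** Derivatives of quadratic maps, read off their expansion: the chart, its
    linear forms and the affine curves below are all of this kind. *)
Lemma is_derive_poly2 (V W : normedModType K) (f : V -> W) (x v : V) (a b : W) :
  (forall t, f (t *: v + x) = f x + t *: a + t ^+ 2 *: b) -> is_derive x v f a.
Proof.
move=> fE; have lim : (fun t : K => t^-1 *: ((f \o shift x) (t *: v) - f x)) @ 0^' --> a.
  have E : {near 0^', (fun t : K => (a + t *: b : W)) =1 (fun t => t^-1 *: ((f \o shift x) (t *: v) - f x))}.
    near=> t; have t0 : t != 0 by near: t; exact: nbhs_dnbhs_neq.
    rewrite /= fE -(addrA (f x)) [X in X - _]addrC addrK scalerDr !scalerA mulVf // scale1r.
    by rewrite expr2 mulrA mulVf // mul1r.
  apply: cvg_trans; first exact: (near_eq_cvg E).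
  suff : (fun t : K => (a + t *: b : W)) @ 0^' --> a + 0 *: b by rewrite scale0r addr0.
  by apply: cvgD; [exact: cvg_cst|apply: cvgZr_tmp; exact: nbhs_dnbhs].
by apply: DeriveDef; [apply/cvg_ex; exists a|exact: cvg_lim].
Unshelve. all: by end_near. Qed.

Lemma differentiable_rV_linear n (W : normedModType K) (f : {linear 'rV[K]_n -> W}) x :
  differentiable f x.
Proof.
have -> : (f : _ -> _) = \sum_(i < n) (fun y : 'rV[K]_n => y 0 i *: f (delta_mx 0 i)).
  apply/funext => y; rewrite fct_sumE {1}(row_sum_delta y) linear_sum.
  by apply: eq_bigr => i _; rewrite linearZ.
by apply: differentiable_sum => i; apply/differentiableZl/differentiable_coord.
Qed.

Lemma derive_linear (V W : normedModType K) (f : {linear V -> W}) x v : 'D_v f x = f v.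
Proof.
have H : is_derive x v f (f v).
  apply: (@is_derive_poly2 _ _ _ _ _ _ 0) => t.
  by rewrite linearP scaler0 addr0 addrC.
exact: derive_val.
Qed.

Lemma derive_comp (U V W : normedModType K) (f : U -> V) (g : V -> W) x v :
  differentiable f x -> differentiable g (f x) ->
  'D_v (g \o f) x = 'D_('D_v f x) g (f x).
Proof.
move=> df dg; rewrite !deriveE //; last exact: differentiable_comp.
by rewrite diff_comp.
Qed.

Lemma differentiable_mx (V : normedModType K) m n (f : V -> 'M[K]_(m, n)) x :
  (forall i j, differentiable (fun y => f y i j : K) x) -> differentiable f x.
Proof.
move=> df; have -> : f = \sum_(i < m) \sum_(j < n) (fun y => f y i j *: delta_mx i j).
  apply/funext => y; rewrite fct_sumE {1}(matrix_sum_delta (f y)); apply: eq_bigr => i _.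
  by rewrite fct_sumE.
by apply: differentiable_sum => i; apply: differentiable_sum => j; apply: differentiableZl.
Qed.

End Calculus.

Section Charts.
Variables (C : numClosedFieldType) (m : nat).
Local Notation V := 'rV[C]_((2 * m).+3).
Local Notation En := 'rV[C]_((2 * m).+1).
Variables (h : 'M[C]_((2 * m).+3)).
Hypotheses (hsym : h^T = h) (hunit : h \in unitmx).
Local Notation hf := (hform h).
Variable c : flat_chart h.
Local Notation O := (fc_O c).
Local Notation I := (fc_I c).
Local Notation e := (fc_e c).
Local Notation X := (chart_vec c).
Implicit Types (x v w : En).

(** The derivative of the chart at [x] in the direction [v]. *)
Definition tangent x v : V := v *m e - hf (v *m e) (x *m e) *: I.

Lemma chart_Oe x : hf O (x *m e) = 0.
Proof. by rewrite /hform trmx_mul mulmxA (fc_Oe c) mul0mx mxE. Qed.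
Lemma chart_Ie x : hf I (x *m e) = 0.
Proof. by rewrite /hform trmx_mul mulmxA (fc_Ie c) mul0mx mxE. Qed.

Definition chart_simp := (chart_Oe, chart_Ie, fc_OO c, fc_II c, fc_OI c).

Lemma chart_null x : hf (X x) (X x) = 0.
Proof.
rewrite /chart_vec /flat_metric !(hform_simp hsym) (hformC hsym (x *m e) O) (hformC hsym (x *m e) I).
rewrite (hformC hsym I O) !chart_simp; set q := hf _ _.
by field.
Qed.

Lemma chart_I x : hf (X x) I = 1.
Proof.
rewrite /chart_vec !(hform_simp hsym) (hformC hsym (x *m e) I) !chart_simp.
by rewrite mulr0 oppr0 !addr0.
Qed.

Lemma tangent_linear x : linear (tangent x).
Proof.
move=> a v w; rewrite /tangent mulmxDl -scalemxAl !(hform_simp hsym) scalerDl opprD scalerBr.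
by rewrite scalerA addrACA.
Qed.
HB.instance Definition _ x := GRing.isLinear.Build C En V *:%R (tangent x) (tangent_linear x).

Lemma tangent_I x v : hf (tangent x v) I = 0.
Proof. by rewrite /tangent !(hform_simp hsym) (hformC hsym _ I) !chart_simp mulr0 subrr. Qed.

Lemma is_derive_chart x v : is_derive x v X (tangent x v).
Proof.
apply: (@is_derive_poly2 _ _ _ _ _ _ _ (- (2^-1 * flat_metric c v v) *: I)) => t.
rewrite /chart_vec /tangent /flat_metric mulmxDl -scalemxAl !(hform_simp hsym).
rewrite (hformC hsym (x *m e) (v *m e)); set a := hf _ _; set b := hf _ _; set d := hf _ _.
rewrite scalerBr; apply/rowP => i; rewrite !mxE; set ve := \sum_j _; set xe := \sum_j _.
by field.
Qed.

Lemma derive_chart x v : 'D_v X x = tangent x v.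
Proof. by have H := is_derive_chart x v; exact: derive_val. Qed.

Lemma tangent_orth x v : hf (X x) (tangent x v) = 0.
Proof.
rewrite /chart_vec /tangent !(hform_simp hsym) (hformC hsym (x *m e) (v *m e)).
rewrite (hformC hsym (x *m e) I) !chart_simp; set a := hf _ _; set b := _ * flat_metric _ _ _.
by ring.
Qed.

Definition emb x : V := x *m e.
Lemma emb_linear : linear emb. Proof. by move=> a v w; rewrite /emb mulmxDl -scalemxAl. Qed.
HB.instance Definition _ := GRing.isLinear.Build C En V *:%R emb emb_linear.

Lemma emb_inj x : x *m e = 0 -> x = 0.
Proof.
move=> xe; rewrite -[x](mulmxK (fc_ee c)) !mulmxA xe !mul0mx.
by [].
Qed.

Lemma hform_emb_sum v x : hf (v *m e) (x *m e) = \sum_i v 0 i * hf (row i e) (x *m e).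
Proof. exact: hform_mulmxl. Qed.

Lemma differentiable_form (p : V) (E : normedModType C) (f : E -> V) y :
  differentiable f y -> differentiable (fun z => hf p (f z) : C) y.
Proof.
move=> df; have lp : scalable_for *:%R (hf p : V -> C^o) by move=> a Y; rewrite hformZr.
have lf : linear (hf p : V -> C^o) by move=> a Y Z; rewrite linearP.
pose L : {linear V -> C^o} := HB.pack (hf p : V -> C^o) (GRing.isLinear.Build C V C^o *:%R (hf p) lf).
apply: (differentiable_comp df (g := L)); exact: differentiable_rV_linear.
Qed.

End Charts.

(** * Integrability *)

(** The two hypotheses are the derivatives of a minor along the two sections;
    in their difference the symmetric term [g] cancels. *)
Lemma bracket_identity (F : comPzRingType) (Xp Xq Vp Vq Wp Wq Ap Aq Bp Bq g ip iq : F) :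
  Wp * Vq + Xp * (Aq - g * iq) = Wq * Vp + Xq * (Ap - g * ip) ->
  Vp * Wq + Xp * (Bq - g * iq) = Vq * Wp + Xq * (Bp - g * ip) ->
  Vp * Wq = Vq * Wp -> Xp * (Bq - Aq) = Xq * (Bp - Ap).
Proof.
move=> k1 k2 mn; apply: subr0_eq.
have -> : Xp * (Bq - Aq) - Xq * (Bp - Ap) =
  (Vp * Wq + Xp * (Bq - g * iq) - (Vq * Wp + Xq * (Bp - g * ip))) -
  (Wp * Vq + Xp * (Aq - g * iq) - (Wq * Vp + Xq * (Ap - g * ip))) -
  (Vp * Wq - Vq * Wp) *+ 2 by ring.
by rewrite k1 k2 mn !subrr mul0rn !subr0.
Qed.

Section ScalarForms.
Variables (C : numFieldType) (n : nat).

Lemma scalar_differentiable (L : 'rV[C]_n -> C) x : linear_for *%R L -> differentiable L x.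
Proof.
move=> lL; have lL' : linear (L : _ -> C^o) by move=> a Y Z; rewrite lL.
pose L' : {linear 'rV[C]_n -> C^o} := HB.pack (L : _ -> C^o) (GRing.isLinear.Build C _ C^o *:%R L lL').
exact: (differentiable_rV_linear L').
Qed.

Lemma scalar_is_derive (E : normedModType C) (L : 'rV[C]_n -> C) (f : E -> 'rV[C]_n) x w :
  linear_for *%R L -> differentiable f x -> is_derive x w (fun y => L (f y)) (L ('D_w f x)).
Proof.
move=> lL df; have lL' : linear (L : _ -> C^o) by move=> a Y Z; rewrite lL.
pose L' : {linear 'rV[C]_n -> C^o} := HB.pack (L : _ -> C^o) (GRing.isLinear.Build C _ C^o *:%R L lL').
have dL : differentiable L (f x) by exact: scalar_differentiable.
apply: DeriveDef; first exact/diff_derivable/(differentiable_comp df).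
by rewrite (derive_comp _ df (g := L)) // (derive_linear L').
Qed.

Lemma coord_scalar i : linear_for *%R (fun v : 'rV[C]_n => v 0 i).
Proof. by move=> a Y Z; rewrite !mxE. Qed.

End ScalarForms.

Section Frobenius.
Variables (C : numClosedFieldType) (m : nat).
Local Notation V := 'rV[C]_((2 * m).+3).
Local Notation S := 'cV[C]_(2 ^ m.+1)%N.
Local Notation MS := 'M[C]_(2 ^ m.+1)%N.
Local Notation En := 'rV[C]_((2 * m).+1).
Variables (h : 'M[C]_((2 * m).+3)) (Gamma : 'I_((2 * m).+3) -> MS).
Hypotheses (hsym : h^T = h) (hunit : h \in unitmx).
Hypothesis hcl : clifford_relations h Gamma.
Local Notation hf := (hform h).
Variable Xi : S.
Hypothesis pXi : pure Gamma Xi.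
Local Notation N0 := (check Gamma <[Xi]>%VS).
Local Notation U := (quadric h `\` projective_points N0).
Local Notation off_plane := (off_plane h Gamma Xi).
Implicit Types (X Y : V).

Lemma orth_orth (K : {vspace V}) : orth h (orth h K) = K.
Proof.
apply/esym/eqP; rewrite eqEdim (memv_orthC hsym) ?subvv //=.
have := dim_orth hsym hunit K; have := dim_orth hsym hunit (orth h K).
move: (\dim (orth h (orth h K))) (\dim (orth h K)) (\dim K) => a b d; lia.
Qed.

Variable K : {vspace V}.
Hypotheses (NK : (N0 <= K)%VS) (KO : (K <= orth h N0)%VS).

Lemma N0_orthK : (N0 <= orth h K)%VS. Proof. exact: (memv_orthC hsym KO). Qed.

Lemma in_K Y : (forall p, p \in orth h K -> hf p Y = 0) -> Y \in K.
Proof. by move=> H; rewrite -[K]orth_orth; apply/(orthP h). Qed.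

Lemma orthK_l p Y : p \in orth h K -> Y \in K -> hf p Y = 0.
Proof. by move=> /(orthP h) pK YK; rewrite (hformC hsym) pK. Qed.

Definition proportional X Y :=
  forall p q, p \in orth h K -> q \in orth h K -> hf p X * hf q Y = hf q X * hf p Y.

(** Membership in [x + K] is expressed by minors of functionals of [K^perp],
    with no choice of a non-zero functional, so that the equations can be
    differentiated. *)
Lemma proportionalP X Y : off_plane X -> proportional X Y <-> Y \in (<[X]> + K)%VS.
Proof.
move=> oX; split=> [XY|/memv_addP [_ /vlineP [a ->]] [k kK ->] p q pK qK].
  have [I IN XI] := off_dual hsym hunit hcl pXi oX.
  rewrite -[Y](subrK (hf I Y *: X)) addrC memv_add ?rpredZ ?memv_line //.
  apply: in_K => p pK; have := XY I p (subvP N0_orthK _ IN) pK.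
  by rewrite !(hform_simp hsym) (hformC hsym I X) XI mul1r => ->; rewrite mulrC subrr.
rewrite !(hform_simp hsym) (orthK_l pK kK) (orthK_l qK kK); ring.
Qed.

Lemma dist_modP X Y : off_plane X -> hf X Y = 0 ->
  Y \in dist_mod h K <[X]> <-> proportional X Y.
Proof.
move=> oX XY; rewrite proportionalP // /dist_mod memv_cap (orth1 hsym) XY eqxx.
by [].
Qed.

Variable D : distribution C m.
Hypothesis DE : forall x, U x -> D x = dist_mod h K x.

Section InChart.
Variable c : flat_chart h.
Local Notation O := (fc_O c).
Local Notation I := (fc_I c).
Local Notation e := (fc_e c).
Local Notation cv := (chart_vec c).

Lemma in_dist_mod x v : U (chart_pt c x) ->
  in_distribution D c x v <-> proportional (cv x) (tangent c x v).
Proof.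
move=> Ux; rewrite /in_distribution DE // (derive_chart hsym).
by apply: dist_modP; [exact/(off_U Gamma hsym)|exact: tangent_orth].
Qed.

Lemma is_derive_hform_chart p x w : is_derive x w (fun y => hf p (cv y)) (hf p (tangent c x w)).
Proof.
have lp : linear_for *%R (hf p) by move=> a Y Z; rewrite linearP.
apply: (@is_derive_poly2 _ _ _ (fun y => hf p (cv y) : C^o) x w _
         (hf p (- (2^-1 * flat_metric c w w) *: I))) => t.
have := is_derive_chart hsym c x w.
rewrite /chart_vec /tangent /flat_metric mulmxDl -scalemxAl !(hform_simp hsym).
rewrite (hformC hsym (x *m e) (w *m e)) => _.
set a := hf p O; set b := hf _ _; set d := hf _ _; rewrite /GRing.scale /=.
by field.
Qed.

Lemma is_derive_hform_tangent p x w (v : En -> En) : differentiable v x ->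
  is_derive x w (fun y => hf p (tangent c y (v y)))
    (hf p (tangent c x ('D_w v x)) - hf (v x *m e) (w *m e) * hf p I).
Proof.
move=> dv; pose n := (2 * m).+1.
pose b := \sum_(i < n) ((fun y => v y 0 i : C) * (fun y => hf (row i e) (y *m e))) : En -> C.
have -> : (fun y => hf p (tangent c y (v y))) =
          (fun y => hf p (v y *m e)) - (hf p I) *: (b : En -> C^o).
  apply/funext => y; rewrite /tangent !(hform_simp hsym) (hform_emb_sum hsym).
  rewrite [RHS]/= mulrC; congr (_ - _ * _).
  by rewrite /b fct_sumE; apply: eq_bigr.
have He q : linear_for *%R (fun z : En => hf q (z *m e)).
  by move=> a Y Z; rewrite mulmxDl -scalemxAl !(hform_simp hsym).
have db : is_derive x w b (\sum_(i < n) (v x 0 i *: hf (row i e) (w *m e) +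
            hf (row i e) (x *m e) *: ('D_w v x) 0 i)).
  apply: is_derive_sum => i; apply: is_deriveM.
    exact: (scalar_is_derive w (coord_scalar i) dv).
  apply: is_derive_eq; first exact: (scalar_is_derive (f := id) w (He _)).
  by rewrite derive_id.
have dp := scalar_is_derive w (He p) dv.
have dZ : is_derive x w (hf p I *: (b : En -> C^o)) _ := @is_deriveZ C En C^o b (hf p I) x w _ db.
apply: (is_derive_eq (@is_deriveB C En C^o _ _ x w _ _ dp dZ)).
rewrite big_split /= /tangent !(hform_simp hsym) !(hform_emb_sum hsym) -addrA -opprD.
congr (_ - _); rewrite -mulrDl mulrC; congr (_ * _).
by rewrite addrC; congr (_ + _); apply: eq_bigr => i _; rewrite /GRing.scale /= // mulrC.
Qed.

(** Both sections satisfy the minor equations near [x]; differentiate those of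
    each along the other and subtract.  The terms quadratic in the first
    derivatives vanish since at [x] both tangent vectors are proportional to
    [X] on [K^perp]. *)
Lemma dist_mod_bracket (o : set En) v w x : open o ->
  local_section U D c o v -> local_section U D c o w -> o x ->
  in_distribution D c x (lie_bracket v w x).
Proof.
move=> oo sv sw ox.
have [Ux dv Dv] := sv x ox; have [_ dw Dw] := sw x ox.
apply/(in_dist_mod _ Ux) => p q pK qK.
have key v1 v2 : local_section U D c o v1 -> local_section U D c o v2 ->
  hf p (tangent c x (v2 x)) * hf q (tangent c x (v1 x)) +
  hf p (cv x) * (hf q (tangent c x ('D_(v2 x) v1 x)) - hf (v1 x *m e) (v2 x *m e) * hf q I) =
  hf q (tangent c x (v2 x)) * hf p (tangent c x (v1 x)) +
  hf q (cv x) * (hf p (tangent c x ('D_(v2 x) v1 x)) - hf (v1 x *m e) (v2 x *m e) * hf p I).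
  move=> s1 s2; have [_ d1 _] := s1 x ox.
  have H r t := is_deriveM (is_derive_hform_chart r x (v2 x))
                  (is_derive_hform_tangent t (v2 x) d1).
  have nE : \forall y \near x,
      ((fun y => hf p (cv y)) * (fun y => hf q (tangent c y (v1 y))) : En -> C) y =
      ((fun y => hf q (cv y)) * (fun y => hf p (tangent c y (v1 y))) : En -> C) y.
    apply: filterS (open_nbhs_nbhs (conj oo ox)) => y oy.
    have [Uy _ Dy] := s1 y oy; exact: (in_dist_mod _ Uy).1 Dy p q pK qK.
  have := near_eq_derive (v2 x) nE.
  rewrite (@derive_val _ _ _ _ _ _ _ (H p q)) (@derive_val _ _ _ _ _ _ _ (H q p)).
  rewrite /GRing.scale /= => E.
  by rewrite addrC (mulrC (hf p (tangent _ _ _))) E addrC; congr (_ + _); rewrite mulrC.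
have kv := key _ _ sv sw; have kw := key _ _ sw sv.
have Pv := (in_dist_mod _ Ux).1 Dv; have Pw := (in_dist_mod _ Ux).1 Dw.
have [J JN XJ] := off_dual hsym hunit hcl pXi ((off_U Gamma hsym _ _).1 Ux).
have JK := subvP N0_orthK _ JN; rewrite (hformC hsym) in XJ.
have minor : hf p (tangent c x (v x)) * hf q (tangent c x (w x)) =
             hf q (tangent c x (v x)) * hf p (tangent c x (w x)).
  have := Pv J p JK pK; have := Pv J q JK qK; have := Pw J p JK pK; have := Pw J q JK qK.
  by rewrite XJ !mul1r => -> -> -> ->; rewrite mulrACA [RHS]mulrACA (mulrC (hf q _)).
have -> : tangent c x (lie_bracket v w x) =
    tangent c x ('D_(v x) w x) - tangent c x ('D_(w x) v x).
  exact: (linearB (tangent c x)).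
have hB r Z W : hf r (Z - W) = hf r Z - hf r W by rewrite linearB.
rewrite !(hB _ (tangent c x ('D_(v x) w x))).
by rewrite (hformC hsym (v x *m e)) in kv; exact: bracket_identity kv kw minor.
Qed.

End InChart.
End Frobenius.

(** * Holomorphic frames *)

Section ChartFrames.
Variables (C : numClosedFieldType) (m : nat).
Local Notation V := 'rV[C]_((2 * m).+3).
Local Notation S := 'cV[C]_(2 ^ m.+1)%N.
Local Notation MS := 'M[C]_(2 ^ m.+1)%N.
Local Notation En := 'rV[C]_((2 * m).+1).
Variables (h : 'M[C]_((2 * m).+3)).
Hypotheses (hsym : h^T = h) (hunit : h \in unitmx).
Local Notation hf := (hform h).
Implicit Types (X Y : V).

Variable c : flat_chart h.
Local Notation O := (fc_O c).
Local Notation I := (fc_I c).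
Local Notation e := (fc_e c).
Local Notation cv := (chart_vec c).

Lemma differentiable_chart y : differentiable cv y.
Proof.
have dl k (L : {linear En -> 'rV[C]_k}) x : differentiable L x by exact: differentiable_rV_linear.
pose q := \sum_(i < (2 * m).+1) ((fun z : En => z 0 i : C) * (fun z : En => hf (row i e) (emb c z) : C)).
have -> : cv = cst O + emb c - (fun z => (2^-1 * q z) *: I).
  apply/funext => z; rewrite /chart_vec /flat_metric (hform_emb_sum hsym).
  by congr (_ - (_ * _) *: _); rewrite /q fct_sumE.
apply: differentiableB; first by apply: differentiableD; [exact: differentiable_cst|exact: dl].
apply: differentiableZl; apply: (@differentiableM _ _ (cst 2^-1 : En -> C) q).
  exact: differentiable_cst.
apply: differentiable_sum => i; apply: differentiableM; first exact: differentiable_coord.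
by apply: differentiable_form; exact: dl.
Qed.

(** The rows of [e] span the orthogonal of the hyperbolic plane of [O] and [I],
    which has their number as its dimension. *)
Lemma chart_span Y : hf Y O = 0 -> hf Y I = 0 -> (Y <= e)%MS.
Proof.
move=> YO YI; pose P := orth h (<[O]> + <[I]>)%VS.
have dP : \dim P = (2 * m).+1 := dim_orth_hyperbolic hsym hunit (fc_II c) (fc_OI c).
have PE Z : Z \in P = (hf Z O == 0) && (hf Z I == 0).
  apply/(orthP h)/andP => [H|[/eqP ZO /eqP ZI] _ /memv_addP [_ /vlineP [a ->]] [_ /vlineP [b ->] ->]].
    rewrite !(hformC hsym Z) !H // ?memvE ?addvSl ?addvSr //.
  by rewrite !(hform_simp hsym) !(hformC hsym _ Z) ZO ZI !mulr0 addr0.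
have [B fB PB] := vspace_row_basis dP.
have eB : (e <= B)%MS.
  apply/row_subP => i; rewrite -PB PE -[row i e]mulmx1 rowE mulmx1.
  by rewrite (hformC hsym _ O) (hformC hsym _ I) chart_Oe chart_Ie !eqxx.
have re : \rank e = (2 * m).+1.
  apply/eqP; rewrite eqn_leq rank_leq_row /=.
  have := mxrank_unit (fc_ee c); rewrite -mulmxA => {1}<-.
  exact: mxrankM_maxl.
have : (B <= e)%MS.
  by rewrite -(geq_leqif (mxrank_leqif_sup eB)) re; move: fB; rewrite /row_free => /eqP ->.
by apply: submx_trans; rewrite -PB PE YO YI !eqxx.
Qed.

(** The coordinates with respect to the rows of [e], orthogonally to [O] and
    [I]. *)
Definition coframe Y : En := Y *m h *m e^T *m invmx (e *m h *m e^T).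

Lemma coframe_linear : linear coframe.
Proof. by move=> a Y Z; rewrite /coframe !mulmxDl -!scalemxAl. Qed.
HB.instance Definition _ := GRing.isLinear.Build C V En *:%R coframe coframe_linear.

Lemma coframe_emb x : coframe (x *m e) = x.
Proof. by rewrite /coframe -(mulmxA x e h) -(mulmxA x (e *m h) e^T) mulmxK ?(fc_ee c). Qed.
Lemma coframe_O : coframe O = 0. Proof. by rewrite /coframe (fc_Oe c) mul0mx. Qed.
Lemma coframe_I : coframe I = 0. Proof. by rewrite /coframe (fc_Ie c) mul0mx. Qed.

Lemma chart_decomp Y : Y = hf Y I *: O + hf Y O *: I + coframe Y *m e.
Proof.
pose Z := Y - (hf Y I *: O + hf Y O *: I).
have IO : hf I O = 1 by rewrite (hformC hsym) fc_OI.
have /submxP [a Za] : (Z <= e)%MS.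
  apply: chart_span.
    by rewrite /Z !(hform_simp hsym) IO fc_OO mulr1 mulr0 add0r subrr.
  by rewrite /Z !(hform_simp hsym) fc_OI fc_II mulr1 mulr0 addr0 subrr.
have YE : Y = hf Y I *: O + hf Y O *: I + a *m e by rewrite -Za /Z addrC subrK.
rewrite {1}YE; congr (_ + _ *m _); rewrite [in RHS]YE !linearD !linearZ /=.
by rewrite coframe_O coframe_I !scaler0 !add0r coframe_emb.
Qed.

(** The inverse of [tangent] on [X^perp] modulo [X]. *)
Definition retract x Y : En := coframe Y - hf Y I *: x.

Lemma retract_linear x : linear (retract x).
Proof.
move=> a Y Z; rewrite /retract linearP !(hform_simp hsym) scalerDl opprD scalerBr scalerA.
by rewrite addrACA.
Qed.
HB.instance Definition _ x := GRing.isLinear.Build C V En *:%R (retract x) (retract_linear x).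

Lemma retract_chart x : retract x (cv x) = 0.
Proof.
rewrite /retract chart_I // scale1r /chart_vec !linearD linearN linearZ /=.
by rewrite coframe_O coframe_I coframe_emb scaler0 subr0 add0r subrr.
Qed.

Lemma retract_tangent x v : retract x (tangent c x v) = v.
Proof.
rewrite /retract tangent_I // scale0r subr0 /tangent linearB linearZ /=.
by rewrite coframe_I coframe_emb scaler0 subr0.
Qed.

Lemma retractK x Y : hf Y (cv x) = 0 -> Y = hf Y I *: cv x + tangent c x (retract x Y).
Proof.
move=> YX; have YE := chart_decomp Y; set y := coframe Y in YE.
have YO : hf Y O = - hf (y *m e) (x *m e) + 2^-1 * flat_metric c x x * hf Y I.
  have : hf Y (x *m e) = hf (y *m e) (x *m e).
    by rewrite {1}YE !(hform_simp hsym) chart_Oe chart_Ie !mulr0 !add0r.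
  move: YX; rewrite /chart_vec !hformDr hformNr hformZr => + E; rewrite E => YX.
  by rewrite -[LHS](subr0 _) -YX; ring.
rewrite {1}YE YO /tangent /retract -/y /chart_vec mulmxBl -scalemxAl !(hform_simp hsym) /flat_metric.
set a := hf Y I; set b := hf _ _; set q := hf _ _.
apply/rowP => i; rewrite !mxE; set yi := \sum_j _; set xi := \sum_j _.
by field.
Qed.

Lemma row_free_emb : row_free e.
Proof.
rewrite -kermx_eq0; apply/rowV0P => v /sub_kermxP; exact: emb_inj.
Qed.

Variables (Gamma : 'I_((2 * m).+3) -> MS).
Hypothesis hcl : clifford_relations h Gamma.
Variable Xi : S.
Hypothesis pXi : pure Gamma Xi.
Local Notation N0 := (check Gamma <[Xi]>%VS).
Local Notation U := (quadric h `\` projective_points N0).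
Local Notation off_plane := (off_plane h Gamma Xi).

(** With [J] in [N0] and [h(J, X0) = 1], and [B] a basis of [N0 :&: X0^perp], the
    vectors [h(J, X) B_i - h(B_i, X) J] form a basis of [N0 :&: X^perp] as long
    as [h(J, X) != 0]; they are polynomial in the coordinates. *)
Lemma dist_mod_frame (D : distribution C m) x0 :
  (forall x, U x -> D x = dist_mod h N0 x) -> U (chart_pt c x0) ->
  exists (o : set En) (s : En -> 'M[C]_(m, (2 * m).+1)),
    [/\ open o, o x0 & forall x, o x ->
      [/\ U (chart_pt c x), differentiable s x, row_free (s x) &
          forall v, in_distribution D c x v <-> (v <= s x)%MS]].
Proof.
move=> DE /(off_U Gamma hsym) oX0.
have [J JN XJ] := off_dual hsym hunit hcl pXi oX0.
have [B fB PB] := vspace_row_basis (dim_N0_orth hsym hunit hcl pXi oX0).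
pose f p y := hf p (cv y).
have df p y : differentiable (f p : En -> C) y.
  by apply: differentiable_form; exact: differentiable_chart.
pose w y : 'M[C]_(m, (2 * m).+3) := \matrix_i (f J y *: row i B - f (row i B) y *: J).
pose s y := \matrix_i retract y (row i (w y)).
exists [set y | f J y != 0], s; split.
- rewrite openE => y fy; rewrite /interior.
  have cf : f J @ y --> f J y by exact: differentiable_continuous (df J y).
  exact: cvgr_neq0 cf fy.
- by rewrite /= /f (hformC hsym) XJ oner_eq0.
move=> x /= fx; have oX : off_plane (cv x).
  split; first exact: chart_null.
  by apply: contra fx => XN; rewrite /f (N0_orth hsym hcl pXi).
have Ux : U (chart_pt c x) by exact/(off_U Gamma hsym).
have BN i : row i B \in N0 /\ hf (row i B) (cv x0) = 0.
  have : row i B \in (N0 :&: orth h <[cv x0]>)%VS by rewrite PB row_sub.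
  by move=> /memv_capP [BN]; rewrite (orth1 hsym) (hformC hsym) => /eqP.
have wE a : a *m w x = f J x *: (a *m B) - f (a *m B) x *: J.
  have -> : f (a *m B) x = \sum_i a 0 i * f (row i B) x by exact: hform_mulmxl.
  rewrite mulmx_sum_row [a *m B]mulmx_sum_row scaler_sumr scaler_suml -sumrB.
  by apply: eq_bigr => i _; rewrite rowK scalerBr !scalerA mulrC.
have sE a : a *m s x = retract x (a *m w x).
  rewrite !mulmx_sum_row linear_sum; apply: eq_bigr => i _.
  by rewrite linearZ /= !rowK.
have wN a : a *m w x \in N0 /\ hf (a *m w x) (cv x) = 0.
  have BaN : a *m B \in N0.
    by rewrite mulmx_sum_row rpred_sum // => i _; rewrite rpredZ //; case: (BN i).
  rewrite wE; split; first by rewrite rpredB ?rpredZ.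
  by rewrite /f !(hformDl hsym, hformNl hsym, hformZl hsym) mulrC subrr.
split=> //.
- apply: differentiable_mx => i j.
  have -> : (fun y => s y i j) = (fun y => coframe (row i (w y)) 0 j : C) -
      (fun y => hf I (row i (w y)) : C) * (fun y => y 0 j : C).
    have E (z y : En) (a : C) : (z - a *: y) 0 j = z 0 j - a * y 0 j by rewrite !mxE.
    by apply/funext => y; rewrite /s mxE /retract E (hformC hsym _ I).
  have dw : differentiable (fun y => row i (w y) : V) x.
    have -> : (fun y => row i (w y)) = (fun y => f J y *: row i B) - (fun y => f (row i B) y *: J).
      by apply/funext => y; rewrite rowK.
    by apply: differentiableB; apply: differentiableZl; exact: df.
  apply: differentiableB; last first.
    by apply: differentiableM; [exact: differentiable_form|exact: differentiable_coord].
  apply: (differentiable_comp dw (g := fun Y => coframe Y 0 j : C)).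
  by apply: scalar_differentiable => a Y Z; rewrite linearP !mxE.
- rewrite -kermx_eq0; apply/rowV0P => a /sub_kermxP; rewrite sE => ra.
  have [aN aX] := wN a; have t0 : tangent c x 0 = 0 by exact: (linear0 (tangent c x)).
  have := retractK aX; rewrite ra t0 addr0 => aE.
  have : a *m w x = 0.
    rewrite aE; have [->|b0] := eqVneq (hf (a *m w x) I) 0; first by rewrite scale0r.
    by have := oX.2; rewrite aE rpredZeq (negPf b0) /= in aN; rewrite aN.
  rewrite wE => /eqP; rewrite subr_eq0 => /eqP E.
  have fa : f (a *m B) x = 0.
    have := congr1 (hf (cv x0)) E; rewrite !hformZr XJ mulr1 => <-.
    rewrite mulmx_sum_row linear_sum big1 ?mulr0 // => i _.
    by rewrite linearZ /= (hformC hsym) (BN i).2 mulr0.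
  move: E; rewrite fa scale0r => /eqP; rewrite scaler_eq0 (negPf fx) /= => /eqP aB.
  by apply: (row_free_inj fB); rewrite aB mul0mx.
move=> v; rewrite /in_distribution DE // (derive_chart hsym) /dist_mod memv_cap (orth1 hsym).
rewrite tangent_orth // eqxx /=; split.
  move=> /memv_addP [_ /vlineP [b ->]] [n nN E].
  have nX : hf (cv x) n = 0.
    have := tangent_orth hsym c x v; rewrite E linearD /= hformZr chart_null //.
    by rewrite mulr0 add0r.
  have vE : v = retract x n.
    by rewrite -(retract_tangent x v) E linearD linearZ /= retract_chart scaler0 add0r.
  (* The combination of the frame is found at [x0], by projecting [n] to
     [N0 :&: X0^perp] along [J]. *)
  pose n' := n - hf n (cv x0) *: J.
  have : n' \in (N0 :&: orth h <[cv x0]>)%VS.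
    apply/memv_capP; rewrite rpredB ?rpredZ // (orth1 hsym); split=> //.
    by rewrite /n' linearB /= hformZr XJ mulr1 (hformC hsym n) subrr.
  rewrite PB => /submxP [a n'E]; apply/submxP; exists ((f J x)^-1 *: a).
  rewrite sE vE; congr (retract x _); rewrite -scalemxAl wE -n'E.
  have -> : f n' x = - hf n (cv x0) * f J x.
    rewrite /f /n' !(hformDl hsym, hformNl hsym, hformZl hsym) (hformC hsym n (cv x)) nX.
    by rewrite add0r mulNr.
  by rewrite mulNr scaleNr opprK mulrC -scalerA -scalerDr scalerA mulVf // scale1r subrK.
move=> /submxP [a ->]; rewrite sE; have [aN aX] := wN a.
have := retractK aX => E.
have -> : tangent c x (retract x (a *m w x)) = - hf (a *m w x) I *: cv x + a *m w x.
  by rewrite {3}E scaleNr addKr.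
by rewrite memv_add ?rpredZ ?memv_line.
Qed.

End ChartFrames.

(** * Curves tangent to their own lines *)

Section RealSegments.
Variable R : realType.
Local Notation C := (complexes R).

Lemma complexes_gt0 (e : C) : 0 < e -> 0 < complex.Re e /\ e = (complex.Re e)%:C%C.
Proof.
case: e => x y; rewrite ltcE /= => /andP [/eqP -> x0]; split=> //.
Qed.

Lemma normc_real (t : R) : `|t%:C%C : C| = (`|t|)%:C%C.
Proof. by rewrite normc_def /= expr0n addr0 sqrtr_sqr. Qed.

Lemma Re_le_norm (z : C) : (`|complex.Re z|)%:C%C <= `|z|.
Proof.
rewrite normc_def lecR -sqrtr_sqr ler_wsqrtr // lerDl; exact: sqr_ge0.
Qed.

Lemma Im_le_norm (z : C) : (`|complex.Im z|)%:C%C <= `|z|.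
Proof.
rewrite normc_def lecR -sqrtr_sqr ler_wsqrtr // lerDr; exact: sqr_ge0.
Qed.

(** The argument [part] stands for the real or the imaginary part, here and
    below. *)
Lemma cvg_part (part : C -> R) (T : Type) (F : set_system T) (f : T -> C) (l : C) :
  Filter F -> additive part -> (forall z, (`|part z|)%:C%C <= `|z|) ->
  f @ F --> l -> (fun x => part (f x)) @ F --> part l.
Proof.
move=> FF addp lep /cvgrPdist_lt fl; apply/cvgrPdist_lt => r r0.
have r0' : 0 < (r%:C%C : C) by rewrite ltcR.
apply: filterS (fl _ r0') => x xr; rewrite -addp -ltcR.
exact: le_lt_trans (lep _) xr.
Qed.

Lemma cvg_real_complex0 : (fun t : R => t%:C%C : C) @ 0^' --> (0 : C)^'.
Proof.
move=> A [e /= e0 eA]; have [r0 eE] := complexes_gt0 e0.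
exists (complex.Re e) => //= t; rewrite /= sub0r normrN => te t0; apply: eA.
  by rewrite /= sub0r normrN normc_real eE ltcR.
by apply: contra t0 => /eqP [->].
Qed.

Lemma part_is_derive (part : C -> R) (f : C -> C) (t : R) (d : C) :
  additive part -> (forall z, (`|part z|)%:C%C <= `|z|) ->
  (forall (k : R) z, part (k%:C%C * z) = k * part z) ->
  is_derive (t%:C%C : C) (1 : C) f d ->
  is_derive t (1 : R) (fun t => part (f t%:C%C)) (part d).
Proof.
move=> addp lep sp [fd fv].
have lim : (fun k : C => k^-1 *: (f (k *: 1 + t%:C%C) - f t%:C%C)) @ 0^' --> d.
  by rewrite -fv; exact: fd.
have lim2 := cvg_comp _ _ cvg_real_complex0 lim.
have lim3 := cvg_part _ addp lep lim2.
have E : (fun k : R => k^-1 *: (part (f (k *: 1 + t)%:C%C) - part (f t%:C%C))) =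
  (fun k : R => part ((fun k : C => k^-1 *: (f (k *: 1 + t%:C%C) - f t%:C%C)) k%:C%C)).
  apply/funext => k /=; rewrite /GRing.scale /= !mulr1 -fmorphV sp addp.
  by rewrite -rmorphD.
have lim4 : (fun k : R => k^-1 *: (part (f (k *: 1 + t)%:C%C) - part (f t%:C%C))) @ 0^' --> part d.
  by rewrite E; exact: lim3.
by apply: DeriveDef; [apply/cvg_ex; exists (part d)|exact: cvg_lim].
Qed.

(** Two solutions of the same linear equation have a constant ratio. *)
Lemma ratio_constant (f g k : R -> R) :
  (forall t : R, 0 <= t <= 1 -> [/\ g t != 0, is_derive t (1 : R) f (k t * f t) &
                                is_derive t (1 : R) g (k t * g t)]) ->
  f 1 / g 1 = f 0 / g 0.
Proof.
move=> H.
have dr (t : R) : 0 <= t <= 1 -> is_derive t (1 : R) (fun t => f t / g t) 0.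
  move=> /H [g0 df dg].
  have dV : is_derive t (1 : R) (fun y => (g y)^-1) (- (g t) ^- 2 *: (k t * g t)).
    by apply: DeriveDef; [apply: derivableV|rewrite deriveV // derive_val].
  apply: (is_derive_eq (is_deriveM df dV)).
  by rewrite /GRing.scale /=; field.
have cr : {within `[0, 1], continuous (fun t => f t / g t)}.
  apply: derivable_within_continuous => t; rewrite in_itv /= => t01.
  by have [] := dr t t01.
have dro (t : R) : t \in `]0, 1[%R -> is_derive t (1 : R) (fun t => f t / g t) ((fun=> 0) t).
  by rewrite in_itv /= => /andP [t0 t1]; apply: dr; rewrite !ltW.
have [c _ E] := MVT (ltr01 : 0 < 1 :> R) dro cr.
by apply: subr0_eq; rewrite E mul0r.
Qed.

(** If [F' = a F], then the entries of [F F^*] and the squared norm of [F] all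
    satisfy the real equation [y' = 2 (Re a) y], so that the projector
    [F F^* / |F|^2] on the line of [F] is constant. *)
Lemma proportional_on_segment d (F : 'I_d -> C -> C) :
  (forall t : R, 0 <= t <= 1 -> (exists i, F i t%:C%C != 0) /\
     exists a, forall i, is_derive (t%:C%C : C) (1 : C) (F i) (a * F i t%:C%C)) ->
  exists l, forall i, F i 1 = l * F i 0.
Proof.
move=> H.
pose p i t := complex.Re (F i t%:C%C); pose q i t := complex.Im (F i t%:C%C).
pose N (t : R) := \sum_i (p i t ^+ 2 + q i t ^+ 2).
have /choice [a aE] : forall t : R, exists a : C, 0 <= t <= 1 ->
    forall i, is_derive (t%:C%C : C) (1 : C) (F i) (a * F i t%:C%C).
  move=> t; have [t01|_] := boolP (0 <= t <= 1); last by exists 0.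
  by have [_ [b bE]] := H t t01; exists b.
pose al t := complex.Re (a t); pose be t := complex.Im (a t).
have Radd : additive (@complex.Re R : C -> R) by move=> [x y] [u v].
have Iadd : additive (@complex.Im R : C -> R) by move=> [x y] [u v].
have Rs (k : R) (z : C) : complex.Re (k%:C%C * z) = k * complex.Re z.
  by case: z => x y /=; rewrite mul0r subr0.
have Is (k : R) (z : C) : complex.Im (k%:C%C * z) = k * complex.Im z.
  by case: z => x y /=; rewrite mul0r addr0.
have dp i (t : R) : 0 <= t <= 1 -> is_derive t (1 : R) (p i) (al t * p i t - be t * q i t).
  move=> t01; have := part_is_derive Radd Re_le_norm Rs (aE t t01 i).
  by rewrite /al /be /p /q; case: (a t) => x y; case: (F i _).
have dq i (t : R) : 0 <= t <= 1 -> is_derive t (1 : R) (q i) (al t * q i t + be t * p i t).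
  move=> t01; have := part_is_derive Iadd Im_le_norm Is (aE t t01 i).
  by rewrite /al /be /p /q; case: (a t) => x y; case: (F i _).
have N0 (t : R) : 0 <= t <= 1 -> N t != 0.
  move=> /H [[i Fi] _]; apply: contra Fi => /eqP Nt.
  have Ni : p i t ^+ 2 + q i t ^+ 2 = 0.
    apply/eqP; move/eqP: Nt; rewrite /N psumr_eq0; last by move=> j _; rewrite addr_ge0 ?sqr_ge0.
    by move=> /allP /(_ i); apply; rewrite mem_index_enum.
  move/eqP: Ni; rewrite paddr_eq0 ?sqr_ge0 // !sqrf_eq0 /p /q.
  by case: (F i _) => x y /= /andP [/eqP -> /eqP ->].
have dN (t : R) : 0 <= t <= 1 -> is_derive t (1 : R) N (2 * al t * N t).
  move=> t01; have -> : N = \sum_i (p i * p i + q i * q i : R -> R).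
    by apply/funext => s; rewrite fct_sumE.
  have D i := is_deriveD (is_deriveM (dp i t t01) (dp i t t01)) (is_deriveM (dq i t t01) (dq i t t01)).
  apply: (is_derive_eq (is_derive_sum D)).
  rewrite fct_sumE mulr_sumr; apply: eq_bigr => i _; rewrite /GRing.scale /= !fctE.
  by ring.
have t0 : 0 <= (0 : R) <= 1 by rewrite lexx ler01.
have t1 : 0 <= (1 : R) <= 1 by rewrite lexx ler01.
(* The entries of the projector, split into real and imaginary parts. *)
have cP i j : (p i 1 * p j 1 + q i 1 * q j 1) / N 1 = (p i 0 * p j 0 + q i 0 * q j 0) / N 0.
  apply: (@ratio_constant (p i * p j + q i * q j) N (fun t => 2 * al t)) => t t01.
  split; [exact: N0| |exact: dN].
  apply: (is_derive_eq (is_deriveD (is_deriveM (dp i t t01) (dp j t t01))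
                                   (is_deriveM (dq i t t01) (dq j t t01)))).
  by rewrite /GRing.scale /= !fctE; ring.
have cQ i j : (q i 1 * p j 1 - p i 1 * q j 1) / N 1 = (q i 0 * p j 0 - p i 0 * q j 0) / N 0.
  apply: (@ratio_constant (q i * p j - p i * q j) N (fun t => 2 * al t)) => t t01.
  split; [exact: N0| |exact: dN].
  apply: (is_derive_eq (is_deriveB (is_deriveM (dq i t t01) (dp j t t01))
                                   (is_deriveM (dp i t t01) (dq j t t01)))).
  by rewrite /GRing.scale /= !fctE; ring.
have prod i j (t : R) : F i t%:C%C * (F j t%:C%C)^*%C =
    ((p i t * p j t + q i t * q j t) +i* (q i t * p j t - p i t * q j t))%C.
  rewrite /p /q; case: (F i _) => x y; case: (F j _) => u v /=.
  by apply/eqP; rewrite eq_complex /=; apply/andP; split; apply/eqP; ring.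
have scal (x y k : R) : (x +i* y)%C * (k%:C%C : C) = ((x * k) +i* (y * k))%C.
  by apply/eqP; rewrite eq_complex /= !mulr0 subr0 add0r !eqxx.
have cF i j : F i 1 * (F j 1)^*%C * ((N 1)^-1)%:C%C = F i 0 * (F j 0)^*%C * ((N 0)^-1)%:C%C.
  by have := prod i j 1; have := prod i j 0 => -> ->; rewrite !scal cP cQ.
have [[j Fj] _] := H 1 t1.
have Fj' : (F j 1)^*%C * ((N 1)^-1)%:C%C != 0.
  by rewrite mulf_neq0 ?conjc_eq0 // fmorph_eq0 invr_eq0 N0.
exists ((F j 0)^*%C * ((N 0)^-1)%:C%C / ((F j 1)^*%C * ((N 1)^-1)%:C%C)) => i.
apply: (mulIf Fj'); rewrite mulrA cF [RHS]mulrAC divfK //.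
by rewrite -mulrA mulrC.
Qed.

(** The complex plane is the union of the real lines through the origin. *)
Lemma connected_complexes : connected [set: C].
Proof.
have lineC (z : C) : continuous (fun t : R => t%:C%C * z : C).
  move=> t; apply: cvgMr_tmp; apply/cvgrPdist_lt => e e0.
  have [r0 ->] := complexes_gt0 e0; near=> s.
  rewrite -rmorphB normc_real ltcR; near: s.
  exact: (@cvgrPdist_lt _ _ _ _ _ _ _).1 (@cvg_id _ _) _ r0.
have -> : [set: C] = \bigcup_(z in [set: C]) [set (t%:C%C * z : C) | t in [set: R]].
  by apply/seteqP; split=> // z _; exists z => //; exists 1; rewrite // mul1r.
apply: bigcup_connected; first by exists 0 => z _; exists 0; rewrite // mul0r.
move=> z _; apply: connected_continuous_connected.
  by rewrite -set_itvNyy; apply/connected_intervalP/interval_is_interval.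
exact: continuous_subspaceT (lineC z).
Unshelve. all: by end_near. Qed.

End RealSegments.

(** * Leaves *)

Lemma ball_segment (C : numFieldType) (V : normedModType C) (a u v : V) (r t : C) :
  0 <= t <= 1 -> ball a r u -> ball a r v -> ball a r (u + t *: (v - u)).
Proof.
move=> /andP [t0 t1]; rewrite -!ball_normE /= => ur vr.
have -> : a - (u + t *: (v - u)) = (1 - t) *: (a - u) + t *: (a - v).
  rewrite scalerBl scale1r opprD addrA -[RHS]addrA; congr (_ + _).
  by rewrite -!scalerN -scalerDr !opprB subrKA.
apply: le_lt_trans (ler_normD _ _) _; rewrite !normrZ (ger0_norm t0).
rewrite (@ger0_norm _ (1 - t)) ?subr_ge0 //.
have [->|tn0] := eqVneq t 0; first by rewrite subr0 mul1r mul0r addr0.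
have tp : 0 < t by rewrite lt0r tn0.
have -> : r = (1 - t) * r + t * r by ring.
by apply: ler_ltD; [apply: ler_wpM2l; [rewrite subr_ge0|exact: ltW]|rewrite ltr_pM2l].
Qed.

Section ChartExists.
Variables (C : numClosedFieldType) (m : nat).
Local Notation V := 'rV[C]_((2 * m).+3).
Variables (h : 'M[C]_((2 * m).+3)).
Hypotheses (hsym : h^T = h) (hunit : h \in unitmx).
Local Notation hf := (hform h).

(** Any basis of the orthogonal of a hyperbolic plane gives a chart. *)
Lemma chart_exists (X J : V) : hf X X = 0 -> hf J J = 0 -> hf X J = 1 ->
  exists c : flat_chart h, fc_O c = X /\ fc_I c = J.
Proof.
move=> XX JJ XJ; pose P := orth h (<[X]> + <[J]>)%VS.
have dP : \dim P = (2 * m).+1 := dim_orth_hyperbolic hsym hunit JJ XJ.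
have [e fe Pe] := vspace_row_basis dP.
have eP i : row i e \in P by rewrite Pe row_sub.
have Xe : X *m h *m e^T = 0.
  apply/rowP => i; rewrite [RHS]mxE.
  have /(orthP h)/(_ X) := eP i; rewrite memvE addvSl => /(_ isT) E; rewrite -[RHS]E.
  by rewrite /hform !mxE; apply: eq_bigr => j _; rewrite !mxE.
have Je : J *m h *m e^T = 0.
  apply/rowP => i; rewrite [RHS]mxE.
  have /(orthP h)/(_ J) := eP i; rewrite memvE addvSr => /(_ isT) E; rewrite -[RHS]E.
  by rewrite /hform !mxE; apply: eq_bigr => j _; rewrite !mxE.
have ee : e *m h *m e^T \in unitmx.
  rewrite -row_free_unit -kermx_eq0; apply/rowV0P => v /sub_kermxP vK.
  suff ve : v *m e = 0 by apply: (row_free_inj fe); rewrite ve mul0mx.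
  have veP : v *m e \in P by rewrite Pe submxMl.
  apply: (hform_eq0 hunit) => Y.
  have : Y - hf J Y *: X - hf X Y *: J \in P.
    apply/(orthP h) => _ /memv_addP [_ /vlineP [a ->]] [_ /vlineP [b ->] ->].
    rewrite !(hformDr, hformNr, hformZr) !(hformDl hsym) !(hformZl hsym) XX JJ XJ.
    rewrite (hformC hsym J X) XJ; ring.
  rewrite Pe => /submxP [b E].
  have -> : Y = b *m e + hf J Y *: X + hf X Y *: J by rewrite -E addrAC subrK subrK.
  have veX : hf (v *m e) X = 0.
    by rewrite (hformC hsym); have /(orthP h) -> := veP; rewrite // memvE addvSl.
  have veJ : hf (v *m e) J = 0.
    by rewrite (hformC hsym); have /(orthP h) -> := veP; rewrite // memvE addvSr.
  rewrite !(hformDr, hformZr) veX veJ !mulr0 !addr0 /hform trmx_mul !mulmxA.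
  by rewrite -(mulmxA v e h) -(mulmxA v (e *m h)) vK mul0mx mxE.
by exists (FlatChart XX JJ XJ Xe Je ee).
Qed.

End ChartExists.

Section Leaves.
Variables (R : realType) (m : nat).
Local Notation C := (complexes R).
Local Notation V := 'rV[C]_((2 * m).+3).
Local Notation S := 'cV[C]_(2 ^ m.+1)%N.
Local Notation MS := 'M[C]_(2 ^ m.+1)%N.
Local Notation En := 'rV[C]_((2 * m).+1).
Variables (h : 'M[C]_((2 * m).+3)) (Gamma : 'I_((2 * m).+3) -> MS).
Hypotheses (hsym : h^T = h) (hunit : h \in unitmx).
Hypothesis hcl : clifford_relations h Gamma.
Local Notation hf := (hform h).
Variable Xi : S.
Hypothesis pXi : pure Gamma Xi.
Local Notation N0 := (check Gamma <[Xi]>%VS).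
Local Notation U := (quadric h `\` projective_points N0).
Local Notation off_plane := (off_plane h Gamma Xi).
Local Notation fibre := (fibre h Gamma Xi).
Implicit Types (X Y : V).

Variable K : {vspace V}.
Hypotheses (NK : (N0 <= K)%VS) (KO : (K <= orth h N0)%VS).
Variable k : nat.
Hypothesis dK : \dim K = k.+1.
Variable D : distribution C m.
Hypothesis DE : forall x, U x -> D x = dist_mod h K x.

Lemma proportional_mod q (B : 'M[C]_(q, (2 * m).+3)) (l : C) X Y :
  (forall v, (v \in orth h K) = (v <= B)%MS) ->
  (forall i, hf (row i B) Y = l * hf (row i B) X) -> Y \in (<[X]> + K)%VS.
Proof.
move=> PB H; rewrite -[Y](subrK (l *: X)) addrC memv_add ?rpredZ ?memv_line //.
apply: (in_K hsym hunit) => p; rewrite PB => /submxP [b ->].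
rewrite hformDr hformNr hformZr !(hform_mulmxl hsym b B) mulr_sumr -sumrB big1 // => i _.
by rewrite H mulrCA subrr.
Qed.

(** Restrict the projection to the segment from [u0] to [u1]: tangency to the
    distribution says that its derivative is a multiple of itself. *)
Lemma plaque_fibre (c : flat_chart h) (phi : 'rV[C]_k -> En) a r u0 u1 : ball a r u0 -> ball a r u1 ->
  (forall u, ball a r u -> [/\ U (chart_pt c (phi u)), differentiable phi u &
     forall v, in_distribution D c (phi u) ('D_v phi u)]) ->
  chart_vec c (phi u1) \in (<[chart_vec c (phi u0)]> + K)%VS.
Proof.
move=> b0 b1 H; have [B fB PB] := vspace_row_basis (erefl (\dim (orth h K))).
have BK i : row i B \in orth h K by rewrite PB row_sub.
pose g (t : C) := u0 + t *: (u1 - u0).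
pose F i (t : C) : C := hf (row i B) (chart_vec c (phi (g t))).
have dg t : differentiable (g : C -> _) t.
  apply: differentiableD; first exact: differentiable_cst.
  exact: differentiableZl.
have Dg t : 'D_(1 : C) (g : C -> _) t = u1 - u0.
  have : is_derive (t : C) (1 : C) (g : C -> _) (u1 - u0); last by move=> ?; exact: derive_val.
  apply: (@is_derive_poly2 _ C _ g t 1 _ 0) => s.
  by rewrite /g scaler0 addr0 scalerDl addrCA addrC /GRing.scale /= mulr1.
have g0 : g 0 = u0 by rewrite /g scale0r addr0.
have g1 : g 1 = u1 by rewrite /g scale1r addrC subrK.
have [l lE] : exists l, forall i, F i 1 = l * F i 0.
  apply: proportional_on_segment => t t01; pose tc : C := t%:C%C; rewrite -/tc.
  have bt : ball a r (g tc).
    by apply: ball_segment => //; move: t01; rewrite !lecR.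
  have [Ut dphi Dphi] := H _ bt; have oX := (off_U Gamma hsym _ _).1 Ut.
  set X := chart_vec c (phi (g tc)) in oX; split.
    have [J JN XJ] := off_dual hsym hunit hcl pXi oX.
    have /submxP [b Jb] : (J <= B)%MS by rewrite -PB (subvP (N0_orthK hsym KO)).
    apply: contrapT => Fi; move/eqP: XJ; rewrite (hformC hsym) Jb (hform_mulmxl hsym) big1.
      by rewrite eq_sym oner_eq0.
    move=> i _; have [->|Fi0] := eqVneq (hf (row i B) X) 0; first by rewrite mulr0.
    by case: Fi; exists i.
  have := (in_dist_mod hsym hunit hcl pXi KO DE _ Ut).1 (Dphi (u1 - u0)).
  move/(proportionalP hsym hunit hcl pXi KO _ oX) => /memv_addP [_ /vlineP [s ->]] [kk kK E].
  exists s => i; have dF : differentiable (fun y => hf (row i B) (chart_vec c y) : C) (phi (g tc)).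
    by apply: differentiable_form; exact: differentiable_chart.
  have dpg : differentiable (phi \o (g : C -> _)) tc by exact: differentiable_comp.
  have dFi : differentiable (F i : C -> C) tc.
    exact: (differentiable_comp dpg dF).
  apply: DeriveDef; first exact: diff_derivable.
  rewrite (derive_comp (1 : C) dpg dF) (derive_comp (1 : C) (dg _) dphi) Dg.
  have HD := is_derive_hform_chart hsym c (row i B) (phi (g tc)) ('D_(u1 - u0) phi (g tc)).
  rewrite (@derive_val _ _ _ _ _ _ _ HD) E hformDr hformZr.
  by rewrite (orthK_l hsym (BK i) kK) addr0.
have lE' i : hf (row i B) (chart_vec c (phi u1)) = l * hf (row i B) (chart_vec c (phi u0)).
  by have := lE i; rewrite /F g0 g1.
exact: (proportional_mod PB lE').
Qed.

Lemma plaque_U P : plaque h U k D P -> P `<=` U.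
Proof.
move=> [c [phi [a [r [_ _ -> H]]]]] _ [u bu <-]; by case: (H u bu).
Qed.

Lemma plaque_in_fibre P x X : plaque h U k D P -> P x -> off_plane X ->
  x = <[X]>%VS -> P `<=` fibre K X.
Proof.
move=> pP Px oX xX y Py; have Uy := plaque_U pP Py; have [Y oY yY] := off_gen hsym Uy.
apply/(fibreP hsym _ _ oX); exists Y => //; split=> //.
case: pP Px Py => c [phi [a [r [r0 inj PE H]]]]; rewrite PE => -[u0 b0 ux] [u1 b1 uy].
have H' u : ball a r u -> [/\ U (chart_pt c (phi u)), differentiable phi u &
     forall v, in_distribution D c (phi u) ('D_v phi u)].
  move=> bu; have [h1 h2 _ h4] := H u bu; split=> // v; apply/h4; by exists v.
have E := plaque_fibre b0 b1 H'.
have -> : (<[X]> = <[chart_vec c (phi u0)]>)%VS by rewrite -xX -ux.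
have : Y \in <[chart_vec c (phi u1)]>%VS by rewrite -/(chart_pt c (phi u1)) uy yY memv_line.
by case/vlineP => b ->; rewrite rpredZ.
Qed.

(** The part of the manifold in a fibre is a union of plaques. *)
Lemma integral_in_fibre L X : connected_integral_manifold h U k D L -> off_plane X -> L <[X]>%VS ->
  L `<=` fibre K X.
Proof.
move=> [_ plq con] oX LX.
have LU x : L x -> U x by move=> /plq [P [pP Px _]]; exact: plaque_U pP _ Px.
suff <- : L `&` fibre K X = L by move=> x [].
apply: con; first by move=> x [].
  by exists <[X]>%VS; split=> //; exact: fibre_self.
move=> P pP PL [x [Px [Lx Fx]]] y Py; split; first exact: PL.
have [Y oY [xY YX]] := (fibreP hsym _ _ oX).1 Fx.
rewrite (fibre_eq hsym hunit hcl pXi KO oX oY YX).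
exact: (plaque_in_fibre pP Px oY xY).
Qed.

Section FlatModel.
Variable X : V.
Hypothesis oX : off_plane X.

(** Take [X] as the origin and [J] in [N0] as the point at infinity.  All
    chart vectors pair to [1] with [J], which is orthogonal to [N0], so they
    stay off [N0]; and a tangent vector, which pairs to zero with [J], is in
    [x + K] only if it is in [K]. *)
Lemma flat_model : exists (c : flat_chart h) (M : 'M[C]_(k, (2 * m).+1)),
  [/\ row_free M, forall y, U (chart_pt c y),
      forall y v, in_distribution D c y v <-> (v <= M)%MS &
      fibre K X = [set chart_pt c (u *m M) | u in [set: 'rV[C]_k]]].
Proof.
have [J JN XJ] := off_dual hsym hunit hcl pXi oX.
have JJ := pure_isotropic hcl pXi JN.
have [c [cO cI]] := chart_exists hsym hunit oX.1 JJ XJ.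
have oc y : off_plane (chart_vec c y).
  split; first exact: chart_null.
  have := chart_I hsym c y; rewrite cI => E; apply/negP => XN.
  by move/eqP: E; rewrite (N0_orth hsym hcl pXi XN JN) eq_sym oner_eq0.
have Uc y : U (chart_pt c y) by apply/(off_U Gamma hsym); exact: oc.
have JK := subvP NK _ JN.
have KJ Y : Y \in K -> hf Y J = 0.
  by move=> YK; have /(orthP h) := subvP KO _ YK => /(_ J JN); rewrite (hformC hsym).
have dQ : \dim (K :&: orth h <[X]>) = k.
  by have := dim_cap_orth hsym JK (X := X); rewrite XJ oner_eq0 dK => /(_ isT) [].
have [B fB PB] := vspace_row_basis dQ.
have Be : (B <= fc_e c)%MS.
  apply/row_subP => i; have : row i B \in (K :&: orth h <[X]>)%VS by rewrite PB row_sub.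
  move=> /memv_capP [BK]; rewrite (orth1 hsym) => /eqP BX.
  by apply: (chart_span hsym hunit); rewrite ?cO ?cI ?(KJ _ BK) // (hformC hsym) BX.
have /submxP [M BM] := Be.
have Me y : (y <= M)%MS = (y *m fc_e c \in K).
  rewrite -(submxMfree y M (row_free_emb c)) -BM -PB memv_cap (orth1 hsym) -cO.
  by rewrite chart_Oe eqxx andbT.
have fM : row_free M.
  rewrite /row_free eqn_leq rank_leq_row /=; move: fB; rewrite /row_free => /eqP {1}<-.
  by rewrite BM mxrankM_maxl.
have Dc y v : in_distribution D c y v <-> (v <= M)%MS.
  rewrite Me /in_distribution DE // (derive_chart hsym) /dist_mod memv_cap (orth1 hsym).
  rewrite tangent_orth // eqxx /=.
  have tK : (tangent c y v \in K) = (v *m fc_e c \in K).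
    rewrite /tangent cI; apply/idP/idP => H.
      by rewrite -[v *m _](subrK (hf (v *m fc_e c) (y *m fc_e c) *: J)) rpredD // rpredZ.
    by rewrite rpredB // rpredZ.
  rewrite -tK; split=> [/memv_addP [_ /vlineP [b ->]] [n nK E]|tKK]; last first.
    by rewrite (subvP (addvSr _ _)).
  have := tangent_I hsym c y v; rewrite E (hformDl hsym) (hformZl hsym) chart_I // mulr1.
  by rewrite cI (KJ _ nK) addr0 => ->; rewrite scale0r add0r.
exists c, M; split=> //; apply/seteqP; split.
  move=> x /(fibreP hsym _ _ oX) [Y oY [-> YX]].
  have [b [n [b0 nK YE]]] := fibre_coef hsym hunit hcl pXi KO oY YX.
  pose n' := b^-1 *: n; have n'K : n' \in K by rewrite rpredZ.
  pose Y' := X + n'; have YY' : Y = b *: Y' by rewrite YE scalerDr scalerA divff // scale1r.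
  have Y'Y' : hf Y' Y' = 0.
    move: oY.1; rewrite YY' (hformZl hsym) hformZr => /eqP.
    by rewrite !mulf_eq0 (negPf b0) /= => /eqP.
  have n'E := chart_decomp hsym hunit c n'; rewrite cI cO (KJ _ n'K) scale0r add0r in n'E.
  set y := coframe c n' in n'E.
  have yK : y *m fc_e c \in K.
    have -> : y *m fc_e c = n' - hf n' X *: J by rewrite {1}n'E addrC addKr.
    by rewrite rpredB // rpredZ.
  have n'n' : hf n' n' = flat_metric c y y.
    rewrite {1}n'E (hformDl hsym) (hformZl hsym) (hformC hsym J) (KJ _ n'K) mulr0 add0r.
    rewrite n'E hformDr hformZr -[J]cI (hformC hsym (y *m _)) chart_Ie mulr0 add0r.
    by [].
  (* The coefficient of [J] in the decomposition is forced by nullity. *)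
  have Y'E : Y' = chart_vec c y.
    rewrite /chart_vec cO cI /Y' {1}n'E -!addrA; congr (_ + _).
    rewrite addrC; congr (_ + _); rewrite -scaleNr; congr (_ *: _).
    have two0 : (2 : C) != 0 by rewrite pnatr_eq0.
    apply: (mulfI two0); rewrite mulrN mulrA divff // mul1r -n'n'.
    have := Y'Y'; rewrite /Y' !(hformDl hsym) !hformDr oX.1 (hformC hsym n' X) => E.
    by apply: subr0_eq; rewrite -[RHS]E; ring.
  have /submxP [u yu] : (y <= M)%MS by rewrite Me.
  exists u => //; rewrite /chart_pt -yu -Y'E; apply/eqP; rewrite eqEdim -memvE YY'.
  rewrite !dim_vline; have -> : Y' != 0.
    by apply: contraTneq (off_neq0 oY) => Y0; rewrite YY' Y0 scaler0 eqxx.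
  rewrite scaler_eq0 (negPf b0) /=.
  have -> : Y' \in <[b *: Y']>%VS by apply/vlineP; exists b^-1; rewrite scalerA mulVf // scale1r.
  by case: eqP.
move=> _ [u _ <-]; apply/(fibreP hsym _ _ oX); exists (chart_vec c (u *m M)) => //; split=> //.
rewrite /chart_vec cO cI -addrA memv_add ?memv_line // rpredB ?rpredZ //.
by rewrite -Me submxMl.
Qed.

(** In the flat model the fibre is the increasing union of the plaques given by
    the balls around the origin, and any two points lie in one of them. *)
Lemma fibre_integral : connected_integral_manifold h U k D (fibre K X).
Proof.
have [c [M [fM Uc Dc FE]]] := flat_model.
have dphi u : differentiable (fun u : 'rV[C]_k => u *m M) u.
  exact: (differentiable_rV_linear (mulmxr M)).
have Dphi v u : 'D_v (fun u : 'rV[C]_k => u *m M) u = v *m M.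
  exact: (derive_linear (mulmxr M)).
have plq r : 0 < r -> plaque h U k D [set chart_pt c (u *m M) | u in ball (0 : 'rV[C]_k) r].
  move=> r0; exists c, (fun u => u *m M), 0, r; split=> //.
    by move=> u v _ _; exact: row_free_inj.
  move=> u _; split=> //.
    by move=> v; rewrite Dphi => vM; apply: (row_free_inj fM); rewrite vM mul0mx.
  move=> w; rewrite Dc; split=> [/submxP [v ->]|[v ->]]; first by exists v; rewrite Dphi.
  by rewrite Dphi submxMl.
have plqF r : [set chart_pt c (u *m M) | u in ball (0 : 'rV[C]_k) r] `<=` fibre K X.
  by move=> _ [u _ <-]; rewrite FE; exists u.
have inball (u : 'rV[C]_k) r : `|u| < r -> ball (0 : 'rV[C]_k) r u.
  by rewrite -ball_normE /= sub0r normrN.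
split.
- by exists <[X]>%VS; exact: fibre_self.
- rewrite FE => _ [u _ <-]; exists [set chart_pt c (u *m M) | u in ball (0 : 'rV[C]_k) (`|u| + 1)].
  rewrite -FE; split=> //; first by apply: plq; rewrite ltr_wpDl.
  by exists u => //; apply: inball; rewrite ltrDl.
move=> A AF [x0 Ax0] sat; apply/seteqP; split=> // y; rewrite FE => -[u1 _ <-].
have := AF _ Ax0; rewrite FE => -[u0 _ u0E].
(* A ball around the origin that contains both points. *)
pose r := `|u0| + `|u1| + 1; have r0 : 0 < r by rewrite ltr_wpDl ?addr_ge0.
apply: (sat _ (plq r r0) (plqF r)).
  exists x0; split=> //; exists u0 => //; apply: inball.
  by rewrite /r -addrA ltrDl ltr_wpDl.
by exists u1 => //; apply: inball; rewrite /r addrAC ltrDr ltr_wpDl.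
Qed.

End FlatModel.

Lemma leaf_fibre L : leaf h U k D L <-> exists2 X, off_plane X & L = fibre K X.
Proof.
split=> [[cim max]|[X oX ->]].
  have [[x Lx] plq _] := cim; have [P [pP Px _]] := plq _ Lx.
  have [X oX xX] := off_gen hsym (plaque_U pP Px); exists X => //; apply/esym.
  apply: max; first exact: fibre_integral.
  by apply: integral_in_fibre => //; rewrite -xX.
split; first exact: fibre_integral.
move=> L' cim FL; apply/seteqP; split=> //; apply: integral_in_fibre => //.
exact/FL/fibre_self.
Qed.

End Leaves.

(** * The conformal Killing spinor and the theorem *)

Section Killing.
Variables (C : numClosedFieldType) (m : nat).
Local Notation V := 'rV[C]_((2 * m).+3).
Local Notation S := 'cV[C]_(2 ^ m.+1)%N.
Local Notation MS := 'M[C]_(2 ^ m.+1)%N.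
Local Notation En := 'rV[C]_((2 * m).+1).
Variables (h : 'M[C]_((2 * m).+3)) (Gamma : 'I_((2 * m).+3) -> MS).
Hypotheses (hsym : h^T = h).
Hypothesis hcl : clifford_relations h Gamma.
Local Notation hf := (hform h).
Local Notation cl := (cliff Gamma).

(** The projection of a spinor to the kernel of [J] along the kernel of [Y],
    for null vectors with [h(J, Y) = 1]. *)
Definition flat_part (J : V) (Xi : S) (Y : V) : S := - 2^-1 *: (cl J *m (cl Y *m Xi)).

Lemma flat_part_linear J Xi : linear (flat_part J Xi).
Proof.
move=> a Y Z; rewrite /flat_part [cl (_ + _)]linearP mulmxDl -scalemxAl linearP /= scalerDr.
by rewrite !scalerA mulrC.
Qed.
HB.instance Definition _ J Xi := GRing.isLinear.Build C V S *:%R (flat_part J Xi) (flat_part_linear J Xi).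

Lemma flat_gammaE (c : flat_chart h) v : flat_gamma Gamma c v = cl (v *m fc_e c).
Proof.
rewrite /flat_gamma mulmx_sum_row linear_sum; apply: eq_bigr => a _.
by rewrite linearZ.
Qed.

(** The representative [- I X Xi / 2] has derivative [- I v Xi / 2 = v I Xi / 2],
    since [I] kills its own image and is orthogonal to the coordinate
    vectors; hence [zeta] is the constant [- (sqrt 2 / 2) I Xi]. *)
Lemma conformal_killing_projection Xi : conformal_killing h Gamma (tractor_projection Xi).
Proof.
move=> c; pose J := fc_I c.
have JJ (Z : S) : cl J *m (cl J *m Z) = 0 by rewrite (cliff_sq hcl) fc_II oppr0 scale0r.
have df x : differentiable (flat_part J Xi \o chart_vec c) x.
  apply: differentiable_comp; first exact: differentiable_chart.
  exact: differentiable_rV_linear.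
exists (flat_part J Xi \o chart_vec c), (fun=> - (sqrtC 2 / 2) *: (cl J *m Xi)); split=> //.
- split=> [x|x _ /vlineP [a ->]]; first by rewrite /= /flat_part -scalemxAr JJ scaler0.
  rewrite linearZ /= -scalemxAl /tractor_projection; set X := chart_vec c x.
  suff -> : cl X *m (flat_part J Xi X - Xi) = 0 by rewrite scaler0.
  have XX (Z : S) : cl X *m (cl X *m Z) = 0.
    by rewrite (cliff_sq hcl) chart_null // oppr0 scale0r.
  rewrite mulmxBr /flat_part -scalemxAr (cliff_swap hcl X J) XX linear0 oppr0 sub0r chart_I // mulr1.
  by rewrite scalerN scalerA mulNr mulVf ?pnatr_eq0 // scaleN1r opprK subrr.
- by move=> x; rewrite -scalemxAr JJ scaler0.
- move=> x v; rewrite (derive_comp _ (differentiable_chart hsym c x)); last exact: differentiable_rV_linear.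
rewrite (derive_linear (flat_part J Xi)) (derive_chart hsym) flat_gammaE -scalemxAr scalerA.
have two0 : (2 : C) != 0 by rewrite pnatr_eq0.
have s0 : sqrtC (2 : C) != 0 by rewrite sqrtC_eq0.
have -> : (sqrtC (2 : C))^-1 * - (sqrtC 2 / 2) = - 2^-1 by rewrite mulrN mulrA mulVf // mul1r.
have E : flat_part J Xi (tangent c x v) = flat_part J Xi (v *m fc_e c).
  rewrite /tangent [LHS]linearB /= (linearZ_LR (flat_part J Xi)) /=.
  by rewrite [X in _ - _ *: X]/flat_part JJ !scaler0 subr0.
apply/eqP; rewrite addr_eq0; apply/eqP; apply: (etrans E).
by rewrite /flat_part (cliff_swap hcl) chart_Ie mulr0 scale0r subr0 scalerN.
Qed.

End Killing.

Section OneParameter.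
Variables (R : realType) (m : nat).
Local Notation C := (complexes R).
Local Notation V := 'rV[C]_((2 * m).+3).
Local Notation S := 'cV[C]_(2 ^ m.+1)%N.
Local Notation MS := 'M[C]_(2 ^ m.+1)%N.
Variables (h : 'M[C]_((2 * m).+3)) (Gamma : 'I_((2 * m).+3) -> MS).
Hypotheses (hsym : h^T = h) (hunit : h \in unitmx).
Hypothesis hcl : clifford_relations h Gamma.
Local Notation hf := (hform h).
Local Notation cl := (cliff Gamma).
Variable Xi : S.
Hypothesis pXi : pure Gamma Xi.
Local Notation N0 := (check Gamma <[Xi]>%VS).
Local Notation U := (quadric h `\` projective_points N0).
Local Notation off_plane := (off_plane h Gamma Xi).
Local Notation fibre := (fibre h Gamma Xi).
Implicit Types (X Y : V).

(** With [u] the unit normal, the conic of null directions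
    [X_t = O + t u + (t^2 / 2) I] in the orthogonal of the axis gives the
    gamma-planes of [X_t Xi = O Xi + t Xi], for all complex [t]; the missing
    point of the conic is the direction of [I]. *)
Lemma fibre_one_parameter O : off_plane O -> one_parameter_family Gamma U (fibre (orth h N0) O).
Proof.
move=> oO; have [I IN OI] := off_dual hsym hunit hcl pXi oO.
have [u [uXi uN uO uu N0E]] := unit_normal hsym hunit hcl pXi oO IN OI.
have II := pure_isotropic hcl pXi IN.
pose X (t : C) : V := O + t *: u + (t ^+ 2 / 2) *: I.
have XI t : hf (X t) I = 1.
  by rewrite /X !(hformDl hsym) !(hformZl hsym) OI II uN // !mulr0 !addr0.
have uX t : hf u (X t) = - t.
  by rewrite /X !hformDr !hformZr uO uu uN // !mulr0 add0r addr0 mulrN1.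
have oX t : off_plane (X t).
  split; last first.
    by apply/negP => XN; move/eqP: (XI t); rewrite (N0_orth hsym hcl pXi XN IN) eq_sym oner_eq0.
  rewrite {1}/X !(hformDl hsym) !(hformZl hsym) uX (hformC hsym I) XI /X !hformDr !hformZr oO.1.
  rewrite (hformC hsym O u) uO OI; by field.
have Xk t : X t \in (<[O]> + orth h N0)%VS.
  rewrite /X -addrA memv_add ?memv_line // N0E memv_add ?rpredZ ?memv_line //.
have XXi t : cl (X t) *m Xi = cl O *m Xi + t *: Xi.
  rewrite /X !linearD !linearZ /= !mulmxDl -!scalemxAl uXi (cliff_N0 IN).
  by rewrite scaler0 addr0.
pose H := (N0 :&: orth h <[O]>)%VS.
have XH t : (N0 :&: orth h <[X t]>)%VS = H.
  by apply/esym; exact: (axis_eq hsym hunit hcl pXi (oX t) (Xk t)).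
have cX t : check Gamma <[cl O *m Xi + t *: Xi]> = (<[X t]> + H)%VS.
  by rewrite -XXi (check_cliff hsym hunit hcl pXi (oX t)) XH.
have HN Y : Y \in H -> Y \in N0 by case/memv_capP.
have meet s t Y : Y \in (<[X s]> + H)%VS -> Y \in (<[X t]> + H)%VS ->
    s = t \/ Y \in H.
  move=> /memv_addP [_ /vlineP [a ->]] [n nH YE] /memv_addP [_ /vlineP [b ->]] [n' n'H YE'].
  have := congr1 (hf I) YE; rewrite {1}YE' !hformDr !hformZr !(hformC hsym I) !XI.
  rewrite !(N0_orth hsym hcl pXi _ IN) ?HN // !addr0 !mulr1 => ba.
  have := congr1 (hf u) YE; rewrite {1}YE' !hformDr !hformZr !uX !uN ?HN // !addr0 ba.
  have [a0 _|a0] := eqVneq a 0; first by right; rewrite YE a0 scale0r add0r.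
  by move/(mulfI a0)/oppr_inj; left.
exists [set: C], (fun t => cl O *m Xi + t *: Xi), H; split.
- by split; [exact: openT|exact: connected_complexes|exists 0].
- move=> t _; split; last first.
    exists <[X t]>%VS; first exact/(off_U Gamma hsym).
    split; first by exists (cl (X t) *m Xi); [exact: (pure_cliff hsym hunit hcl pXi)|rewrite XXi].
    by rewrite cX addvSl.
  have : is_derive t (1 : C) (fun t : C => cl O *m Xi + t *: Xi) Xi; last by case.
  apply: (@is_derive_poly2 _ _ _ (fun t : C => cl O *m Xi + t *: Xi) t 1 Xi 0) => s.
  by rewrite scaler0 addr0 scalerDl addrCA addrC /GRing.scale /= mulr1.
- move=> s t _ _ E; have : X s \in (<[X t]> + H)%VS by rewrite -cX -E cX memvE addvSl.
  have : X s \in (<[X s]> + H)%VS by rewrite memvE addvSl.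
  move=> h1 h2; have [//|/HN XN] := meet _ _ _ h1 h2.
  by have := (oX s).2; rewrite XN.
- split; first by rewrite /is_plane (dim_N0_orth hsym hunit hcl pXi oO); lia.
  move=> s t _ _ st; rewrite !cX; apply/vspaceP => Y; apply/memv_capP/idP => [[h1 h2]|YH].
    by have [E|//] := meet _ _ _ h1 h2; rewrite E eqxx in st.
  by split; rewrite (subvP (addvSr _ _)).
apply/seteqP; split=> [x|x [[t _ [dx]]]].
  move=> Fx; have [Y oY [xY]] := (fibreP hsym _ _ oO).1 Fx.
  move=> /(fibre_coef hsym hunit hcl pXi (subvv _) oY) [a [k [a0 kO YE]]].
  have Ux : U x by case: Fx.
  split=> //; pose Y' := O + a^-1 *: k; pose t := - hf u Y'; exists t => //=.
  have k'O : a^-1 *: k \in orth h N0 by rewrite rpredZ.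
  have YY' : Y = a *: Y' by rewrite YE scalerDr scalerA divff // scale1r.
  have wO : Y' - X t \in orth h N0.
    rewrite /Y' /X -(addrA O (t *: u)) opprD addrACA subrr add0r rpredB // N0E memv_add ?rpredZ ?memv_line //.
  have wN : Y' - X t \in N0.
    have := wO; rewrite N0E => /memv_addP [_ /vlineP [b ->]] [n nN E].
    have e1 : hf u (Y' - X t) = 0 by rewrite linearB /= uX /t opprK subrr.
    have : hf u (b *: u + n) = 0 by rewrite -E.
    rewrite hformDr hformZr uu uN // addr0 mulrN1 => /eqP; rewrite oppr_eq0 => /eqP b0.
    by rewrite E b0 scale0r add0r.
  split; first by case: Ux => -[].
  rewrite cX xY -memvE YY' rpredZ //.
  rewrite -[Y'](subrK (X t)) addrC memv_add ?memv_line // -(XH t).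
  apply/memv_capP; split=> //; rewrite (orth1 hsym) linearB /= (oX t).1 subr0.
  have Y'Y' : hf Y' Y' = 0.
    by move: oY.1; rewrite YY' (hformZl hsym) hformZr => /eqP; rewrite !mulf_eq0 (negPf a0) /= => /eqP.
  have nB Z W : hf (Z - W) (Z - W) = hf Z Z + hf W W - hf W Z *+ 2.
    by rewrite !(hformDl hsym, hformNl hsym) !hformDr !hformNr (hformC hsym Z W); ring.
  have := pure_isotropic hcl pXi wN; rewrite (nB Y' (X t)) Y'Y' (oX t).1 addr0 sub0r.
  by move/eqP; rewrite oppr_eq0 mulrn_eq0.
move=> + Ux; have [Y oY xY] := off_gen hsym Ux; rewrite /= cX xY -memvE => YX.
apply/(fibreP hsym _ _ oO); exists Y => //; split=> //.
move: YX => /memv_addP [_ /vlineP [b ->]] [n nH ->].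
rewrite rpredD ?rpredZ // (subvP (addvSr _ _)) //.
by rewrite (subvP (isotropicP hsym (pure_isotropic hcl pXi))) // HN.
Qed.

End OneParameter.

Theorem proposition4p2 (R : realType) (m : nat)
    (h : 'M[complexes R]_((2 * m).+3))
    (Gamma : 'I_((2 * m).+3) -> 'M[complexes R]_(2 ^ m.+1)%N)
    (G0 : 'M[complexes R]_(2 ^ m.+1)%N)
    (Xi : 'cV[complexes R]_(2 ^ m.+1)%N) :
  (1 <= m)%N ->
  h^T = h -> h \in unitmx -> clifford_relations h Gamma ->
  G0 != 0 -> spin_invariant h Gamma G0 ->
  pure Gamma Xi ->
  let Xi_check := check Gamma <[Xi]>%VS in
  let U := quadric h `\` projective_points Xi_check in
  let xi := tractor_projection Xi in
  let N := N_of h Gamma xi in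
  let D_Xi := D_twistor Gamma G0 Xi in
  [/\ conformal_killing h Gamma xi, pure_spinor_field h Gamma xi &
      zero_set h Gamma xi = projective_points Xi_check] /\
  [/\ almost_null_structure h U N, integrable h U N & co_integrable h U N] /\
  [/\ (exists2 P : {vspace 'cV[complexes R]_(2 ^ m.+1)%N},
         is_plane (m%:Z + 1) P & D_Xi = projective_points P),
      D_Xi `<=` twistor_space Gamma &
      arises_from h Gamma U N (D_Xi `\ <[Xi]>%VS)] /\
  (forall L, leaf h U m N L ->
     exists P, [/\ gamma_plane h P, L = projective_points P `&` U &
                   is_plane (m%:Z - 1) (P :&: Xi_check)%VS]) /\
  (forall L, leaf h U m.+1 (perp h N) L -> one_parameter_family Gamma U L) /\
  (forall L1 L2, leaf h U m.+1 (perp h N) L1 -> leaf h U m.+1 (perp h N) L2 ->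
     L1 <> L2 ->
   forall P1 P2, contains_gamma_plane h U L1 P1 ->
     contains_gamma_plane h U L2 P2 ->
     is_plane (m%:Z - 2) (P1 :&: P2)%VS).
Proof.
move=> m1 hsym hunit hcl G00 inv pXi Xi_check U xi N D_Xi.
have NO : (Xi_check <= orth h Xi_check)%VS.
  exact: (isotropicP hsym (pure_isotropic hcl pXi)).
have NE x : U x -> N x = dist_mod h Xi_check x by exact: (N_of_dist_mod hsym hunit hcl pXi).
have PE x : U x -> perp h N x = dist_mod h (orth h Xi_check) x.
  exact: (perp_N_dist_mod hsym hunit hcl pXi).
have dN : \dim Xi_check = m.+1 := pure_dim pXi.
have dO : \dim (orth h Xi_check) = m.+2.
  have := dim_orth hsym hunit Xi_check; rewrite dN.
  move: (\dim (orth h Xi_check)) => d; lia.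
have leafN L := leaf_fibre hsym hunit hcl pXi (subvv _) NO dN NE L.
have leafP L := leaf_fibre hsym hunit hcl pXi NO (subvv _) dO PE L.
have zeroP x : quadric h x -> spinor_vanishes Gamma x Xi <-> (x <= Xi_check)%VS.
  move=> _; split=> [v|/subvP xN X Xx]; last exact/(cliff_N0 (Xi := Xi))/xN.
  by apply/subvP => X Xx; rewrite /Xi_check (mem_N0 Gamma); apply/eqP/v.
have Nchk X : off_plane h Gamma Xi X -> N <[X]>%VS = check Gamma <[cliff Gamma X *m Xi]>.
  exact: (N_of_check hsym hunit hcl pXi).
have dchk X : off_plane h Gamma Xi X -> \dim (check Gamma <[cliff Gamma X *m Xi]>) = m.+1.
  by move=> oX; case: (pure_cliff hsym hunit hcl pXi oX).
have ichk X : off_plane h Gamma Xi X -> isotropic h (check Gamma <[cliff Gamma X *m Xi]>).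
  by move=> oX; apply: (check_isotropic hcl); exact: off_spinor oX.
have offN x : quadric h x -> ~ spinor_vanishes Gamma x Xi -> exists2 X, off_plane h Gamma Xi X & x = <[X]>%VS.
  move=> qx nv; apply: (off_gen hsym); split=> // -[_ xN]; exact/nv/zeroP.
split; [split|split; [split|split; [split|split; [|split]]]].
- exact: conformal_killing_projection.
- by move=> x qx /(offN _ qx) [X oX ->]; rewrite -/N Nchk // dchk.
- apply/seteqP; split=> x.
    by move=> [qx v]; split; [case: qx|apply/(zeroP x qx)].
  move=> [dx xN]; have qx : quadric h x.
    by split=> // X Xx; apply: (pure_isotropic hcl pXi); exact: (subvP xN).
  by split=> //; apply/(zeroP x qx).
- split; first split.
  + move=> x Ux; have [X oX xX] := off_gen hsym Ux; rewrite xX Nchk // dchk //; split=> //.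
      by rewrite -memvE (mem_check1 Gamma) (cliff_sq hcl) oX.1 oppr0 scale0r.
    apply/subvP => Y YN; rewrite (orth1 hsym); apply/eqP.
    apply: (isotropic_orth hsym (ichk X oX) _ YN).
    by rewrite (mem_check1 Gamma) (cliff_sq hcl) oX.1 oppr0 scale0r.
  + by move=> c x0; exact: (dist_mod_frame hsym hunit hcl pXi NE).
  + move=> x Ux; have [X oX xX] := off_gen hsym Ux; rewrite /perp xX Nchk //.
    rewrite subv_cap (isotropicP hsym (ichk X oX)) andbT.
    apply/subvP => Y YN; rewrite (orth1 hsym); apply/eqP.
    apply: (isotropic_orth hsym (ichk X oX) _ YN).
    by rewrite (mem_check1 Gamma) (cliff_sq hcl) oX.1 oppr0 scale0r.
- by move=> c o v w oo sv sw x ox; apply: (dist_mod_bracket hsym hunit hcl pXi NO NE oo sv sw ox).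
- by move=> c o v w oo sv sw x ox; apply: (dist_mod_bracket hsym hunit hcl pXi (subvv _) PE oo sv sw ox).
- exists (twistor_plane Gamma Xi); last exact: (D_twistorE hsym hunit hcl pXi G00 inv).
  by rewrite /is_plane (dim_twistor_plane hunit pXi); lia.
- exact: (D_twistor_pure hsym hunit hcl pXi G00 inv).
- split; first exact: (D_minus_hat hsym hunit hcl pXi G00 inv).
    move=> x Ux; have [X oX ->] := off_gen hsym Ux.
    exists <[cliff Gamma X *m Xi]>%VS; last exact: Nchk.
    exact: (D_minus_hat_point hsym hunit hcl pXi G00 inv).
  move=> L; rewrite leafN; split=> [[X oX ->]|[z /(D_minusP hsym hunit hcl pXi G00 inv) [X oX ->] ->]].
    exists <[cliff Gamma X *m Xi]>%VS; first by apply/(D_minusP hsym hunit hcl pXi G00 inv); exists X.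
    exact: (fibre_N0 hsym hunit hcl pXi).
  by exists X => //; apply/esym; exact: (fibre_N0 hsym hunit hcl pXi).
- move=> L /leafN [X oX ->]; exists (check Gamma <[cliff Gamma X *m Xi]>%VS); split.
  + by split; [rewrite /is_plane dchk //; lia|exact: ichk].
  + exact: (fibre_N0 hsym hunit hcl pXi).
  + rewrite /is_plane; suff -> : (check Gamma <[cliff Gamma X *m Xi]> :&: Xi_check)%VS =
        (Xi_check :&: orth h <[X]>)%VS by rewrite (dim_N0_orth hsym hunit hcl pXi oX); lia.
    rewrite (check_cliff hsym hunit hcl pXi oX); apply/vspaceP => Y.
    apply/memv_capP/idP => [[/memv_addP [_ /vlineP [a ->]] [n nH ->] YN]|YH].
      have [a0|a0] := eqVneq a 0; first by rewrite a0 scale0r add0r.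
      have [nN _] := memv_capP nH.
      have := rpredB YN nN; rewrite addrK rpredZeq (negPf a0) /= => XN.
      by have := oX.2; rewrite XN.
    by split; [rewrite (subvP (addvSr _ _))|case/memv_capP: YH].
- by move=> L /leafP [X oX ->]; exact: (fibre_one_parameter hsym hunit hcl pXi oX).
- move=> L1 L2 /leafP [X1 o1 ->] /leafP [X2 o2 ->] ne P1 P2.
  exact: (gamma_planes_meet hsym hunit hcl pXi o1 o2 ne).
Qed.
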